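(* Let $(G,\pi)$ be a parity game, $\tau$ a strategy for Odd, $T$ the perfect $(n,d/2)$-universal tree, and $\mu:V\to\bar L(T)$ a node labeling such that $G_\tau$ has no loose arcs with respect to $\mu$. Then $\mu^{\mathcal{G}^\uparrow_\tau}$ can be computed in $O(d(m+n\log n))$ time.
   Context: A parity game: finite directed graph $G=(V,E)$, every node with an outgoing arc, $V=V_0\sqcup V_1$, priorities $\pi:V\to\{1,\dots,d\}$, $d$ even, $n=|V|$, $m=|E|$. A strategy for Odd is $\tau:V_1\to V$ with $v\tau(v)\in E$; $G_\tau=(V,E_\tau)$ with $E_\tau=\{vw\in E:v\in V_0\}\cup\{v\tau(v):v\in V_1\}$. An Even strategy $\sigma:V_0\to V$ gives $G_\sigma$ (all arcs out of $V_1$, only $v\sigma(v)$ out of $v\in V_0$). The perfect $(n,d/2)$-universal tree $T$ is the ordered tree consisting of all tuples of length at most $d/2$ with entries in $\{0,1,\dots,n-1\}$, ordered lexicographically; its leaves are the tuples $\xi=(\xi_{d-1},\xi_{d-3},\dots,\xi_1)$ of length $d/2$. For $p\in[d]$, $\xi|_p$ deletes the components with index $<p$. $\bar L(T)=L(T)\cup\{\top\}$ with $\top$ maximal and $\top|_p=\top$. For $\mu:V\to\bar L(T)$ (labelings ordered pointwise): arc $vw$ non-violated if ($\pi(v)$ even and $\mu(v)|_{\pi(v)}\ge\mu(w)|_{\pi(v)}$) or ($\pi(v)$ odd and ($\mu(v)|_{\pi(v)}>\mu(w)|_{\pi(v)}$ or $\mu(v)=\mu(w)=\top$)); violated otherwise;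 tight if $\mu(v)$ is the smallest element of $\bar L(T)$ making $vw$ non-violated when substituted for $\mu(v)$; loose if neither. $\mu$ is feasible in $G_\tau$ if some Even strategy $\sigma$ makes all arcs of $G_\tau\cap G_\sigma$ non-violated. $\mu^{\mathcal{G}^\uparrow_\tau}$ is the pointwise least labeling $\nu\ge\mu$ feasible in $G_\tau$ (it exists). *)

(* Defs.v *)
From HB Require Import structures.
From mathcomp Require Import all_boot all_order.

Set Implicit Arguments.
Unset Strict Implicit.
Unset Printing Implicit Defensive.

(* Parity games *)

Record parity_game (V : finType) (d : nat) := ParityGame {
  arc : rel V;
  even_nodes : {set V};
  prio : V -> nat;
  arc_out : forall v, exists w, arc v w;
  prio_range : forall v, 1 <= prio v <= d;
  d_even : ~~ odd d }.

Definition odd_nodes V d (G : parity_game V d) : {set V} := ~: even_nodes G.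

Definition num_arcs V d (G : parity_game V d) : nat :=
  #|[set e : V * V | arc G e.1 e.2]|.

(* A strategy is a total function on V of which only the values on the nodes of
   the player concerned are ever used. *)
Definition odd_strategy V d (G : parity_game V d) (tau : V -> V) : Prop :=
  forall v, v \in odd_nodes G -> arc G v (tau v).

Definition even_strategy V d (G : parity_game V d) (sigma : V -> V) : Prop :=
  forall v, v \in even_nodes G -> arc G v (sigma v).

Definition arc_tau V d (G : parity_game V d) (tau : V -> V) : rel V :=
  fun v w => arc G v w && ((v \in odd_nodes G) ==> (w == tau v)).

Definition arc_sigma V d (G : parity_game V d) (sigma : V -> V) : rel V :=
  fun v w => arc G v w && ((v \in even_nodes G) ==> (w == sigma v)).

(* The perfect (n, d/2)-universal tree: its vertices are the tuples of length at
   most d/2 over {0, ..., n-1}, its leaves those of length d/2. *)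

Definition leaf (n d : nat) : Type := (d./2).-tuple 'I_n.

(* Leaves together with the top element, which is None. *)
Definition label (n d : nat) : Type := option (leaf n d).

(* The entry at position j of xi = (xi_{d-1}, xi_{d-3}, ..., xi_1) is the
   component of index d - 1 - 2j. *)
Definition trunc_leaf n d (p : nat) (xi : leaf n d) : seqlexi 'I_n :=
  mask [seq p <= d.-1 - j.*2 | j <- iota 0 d./2] xi.

Definition trunc n d (p : nat) (x : label n d) : option (seqlexi 'I_n) :=
  omap (trunc_leaf p) x.

Definition le_top n (x y : option (seqlexi 'I_n)) : bool :=
  match x, y with
  | _, None => true
  | None, Some _ => false
  | Some s, Some t => (s <= t)%O
  end.

Definition lt_top n (x y : option (seqlexi 'I_n)) : bool :=
  (x != y) && le_top x y.

Definition le_label n d (x y : label n d) : bool :=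
  le_top (omap val x : option (seqlexi 'I_n)) (omap val y).

(* Node labelings *)

Definition labeling (V : finType) (d : nat) : Type := V -> label #|V| d.

Definition le_labeling V d (mu nu : labeling V d) : Prop :=
  forall v, le_label (mu v) (nu v).

Definition non_violated V d (G : parity_game V d) (mu : labeling V d)
    (v w : V) : bool :=
  let p := prio G v in
  if odd p then
    lt_top (trunc p (mu w)) (trunc p (mu v))
      || ((mu v == None) && (mu w == None))
  else le_top (trunc p (mu w)) (trunc p (mu v)).

(* On a self-loop the substitution changes the labels of both ends of the arc. *)
Definition subst V d (mu : labeling V d) (v : V) (x : label #|V| d) :
    labeling V d :=
  fun u => if u == v then x else mu u.

Definition tight V d (G : parity_game V d) (mu : labeling V d) (v w : V) : Prop :=
  non_violated G mu v w /\
  forall x, non_violated G (subst mu v x) v w -> le_label (mu v) x.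

Definition loose V d (G : parity_game V d) (mu : labeling V d) (v w : V) : Prop :=
  non_violated G mu v w /\ ~ tight G mu v w.

Definition feasible V d (G : parity_game V d) (tau : V -> V)
    (mu : labeling V d) : Prop :=
  exists2 sigma, even_strategy G sigma &
    forall v w, arc_tau G tau v w -> arc_sigma G sigma v w ->
      non_violated G mu v w.

Definition is_least_feasible V d (G : parity_game V d) (tau : V -> V)
    (mu nu : labeling V d) : Prop :=
  [/\ le_labeling mu nu, feasible G tau nu &
      forall nu', le_labeling mu nu' -> feasible G tau nu' ->
        le_labeling nu nu'].

(* Random access machine.

   Structured programs over finitely many registers and finitely many
   unbounded arrays, all addressed by natural numbers.  (A single memory
   simulates K arrays with constant overhead by interleaving them.)  Every
   value computed must fit in a machine word, i.e. be at most W; otherwise the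
   program is stuck.  Each operator, register read, array read, store,
   assignment and test costs one unit of time. *)

Inductive binop := Add | Sub | Mul | Div | Lt | Eq.

(* Subtraction is truncated and division by zero yields zero. *)
Definition eval_binop (o : binop) : nat -> nat -> nat :=
  match o with
  | Add => addn
  | Sub => subn
  | Mul => muln
  | Div => divn
  | Lt => fun x y => x < y
  | Eq => fun x y => x == y
  end.

Inductive expr :=
| Cst of nat
| Reg of nat
| Get of nat & expr
| Op of binop & expr & expr.

Inductive cmd :=
| Skip
| Assign of nat & expr
| Put of nat & expr & expr
| Seq of cmd & cmd
| If of expr & cmd & cmd
| While of expr & cmd.

Record state := State { reg : nat -> nat; arr : nat -> nat -> nat }.

Definition set_reg (s : state) (x v : nat) : state :=
  State (fun y => if y == x then v else reg s y) (arr s).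

Definition set_arr (s : state) (a i v : nat) : state :=
  State (reg s) (fun b j => if (b == a) && (j == i) then v else arr s b j).

Definition word (W v : nat) : option nat := if v <= W then Some v else None.

Fixpoint eval (W : nat) (s : state) (e : expr) : option nat :=
  match e with
  | Cst v => word W v
  | Reg x => word W (reg s x)
  | Get a e1 => obind (fun i => word W (arr s a i)) (eval W s e1)
  | Op o e1 e2 =>
      obind (fun v1 => obind (fun v2 => word W (eval_binop o v1 v2))
                             (eval W s e2))
            (eval W s e1)
  end.

Fixpoint cost (e : expr) : nat :=
  match e with
  | Cst _ | Reg _ => 1
  | Get _ e1 => (cost e1).+1
  | Op _ e1 e2 => (cost e1 + cost e2).+1
  end.

(* [exec W c s t s']: started in state s, the program c halts in state s' after
   t units of time. *)
Inductive exec (W : nat) : cmd -> state -> nat -> state -> Prop :=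
| ExecSkip s : exec W Skip s 1 s
| ExecAssign s x e v :
    eval W s e = Some v ->
    exec W (Assign x e) s (cost e).+1 (set_reg s x v)
| ExecPut s a e1 e2 i v :
    eval W s e1 = Some i -> eval W s e2 = Some v ->
    exec W (Put a e1 e2) s (cost e1 + cost e2).+1 (set_arr s a i v)
| ExecSeq s c1 t1 s1 c2 t2 s2 :
    exec W c1 s t1 s1 -> exec W c2 s1 t2 s2 ->
    exec W (Seq c1 c2) s (t1 + t2) s2
| ExecIf s e v c1 c2 t s' :
    eval W s e = Some v -> exec W (if v != 0 then c1 else c2) s t s' ->
    exec W (If e c1 c2) s (cost e + t).+1 s'
| ExecWhileStop s e c :
    eval W s e = Some 0 ->
    exec W (While e c) s (cost e).+1 s
| ExecWhileLoop s e v c t1 s1 t2 s2 :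
    eval W s e = Some v -> v != 0 ->
    exec W c s t1 s1 -> exec W (While e c) s1 t2 s2 ->
    exec W (While e c) s (cost e + t1 + t2).+1 s2.

(* Encoding of instances: nodes are numbered from 0 by [enum_rank]. *)

Definition node_code (V : finType) (v : V) : nat := enum_rank v.

(* A flag, which is 1 for the top element, followed by d/2 components, in the
   order xi_{d-1}, ..., xi_1 (all 0 for the top element). *)
Definition label_code n d (x : label n d) : seq nat :=
  match x with
  | None => 1 :: nseq d./2 0
  | Some xi => 0 :: [seq val i | i <- val xi]
  end.

Definition labeling_code V d (mu : labeling V d) : seq nat :=
  flatten [seq label_code (mu v) | v <- enum V].

(* [arcs] lists the arcs of the graph, in any order. *)
Definition arc_list V d (G : parity_game V d) (arcs : seq (V * V)) : Prop :=
  uniq arcs /\ forall v w, ((v, w) \in arcs) = arc G v w.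

(* Registers 0, 1 and 2 hold n, m and d; arrays 0 to 5 hold, for each node, its
   owner (1 for Odd), its priority, its image under tau (0 for the nodes of
   Even) and its label, and for each arc its tail and its head.  Everything
   else is zero. *)
Definition input_state V d (G : parity_game V d) (tau : V -> V)
    (mu : labeling V d) (arcs : seq (V * V)) : state :=
  State (nth 0 [:: #|V|; num_arcs G; d])
    (fun a => nth 0 (nth [::]
      [:: [seq nat_of_bool (v \in odd_nodes G) | v <- enum V];
          [seq prio G v | v <- enum V];
          [seq (if v \in odd_nodes G then node_code (tau v) else 0)
             | v <- enum V];
          labeling_code mu;
          [seq node_code e.1 | e <- arcs];
          [seq node_code e.2 | e <- arcs]] a)).

(* The result is delivered at the beginning of array 6. *)
Definition outputs V d (s : state) (nu : labeling V d) : Prop :=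
  forall i, i < size (labeling_code nu) -> arr s 6 i = nth 0 (labeling_code nu) i.

(* Main.v *)
(* Labels are numbers with d/2 digits in base n, and top is n^(d/2).  The arc vw is
   non-violated iff lift_v(mu w) <= mu v, where lift_v rounds to multiples of a
   power of n: down if the priority of v is even, strictly up if it is odd.  That
   G_tau has no loose arcs means mu v <= lift_v(mu w) for all its arcs.

   Call an arc vw skipped if v has even priority p and vw lies on a cycle through
   nodes of priority at most p.  The least feasible labeling is the least nu with
   nu v = min (lift_v(mu w) over skipped arcs, lift_v(nu w) over the others).
   Indeed, going around the cycle of a skipped arc vw raises labels by less than
   the unit to which lift_v rounds, so lift_v(nu w) <= nu v when nu v comes from
   mu w.  Conversely, in any feasible labeling, following the arcs of a strategy
   of Even from a node below top ends in a cycle; the arc leaving a node of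
   maximal priority on it is skipped, whence nu is no larger there.

   To compute nu, take for every even p the strongly connected components of the
   nodes of priority at most p, numbered in topological order, and interlace these
   numbers with the digits of a label to form a key.  Along every arc vw that is
   not skipped, the key of v with label lift_v(x) exceeds that of w with label x,
   so Dijkstra's algorithm applies.  As keys have O(d log n) bits, the queue is a
   radix heap, in which a node is filed under the length of the common prefix of
   its key and the key extracted last.  That length only grows, which bounds the
   total time spent on keys by O(d n log n). *)
Require Import Defs.
From HB Require Import structures.
From Stdlib Require Import Classical.
From mathcomp Require Import all_boot all_order zify.

Set Implicit Arguments.
Unset Strict Implicit.
Unset Printing Implicit Defensive.

(** * A logic of running times *)

(** Labels alone cannot serve as keys for Dijkstra's algorithm, because the lift of an even priority
    rounds down and may fall below the label it starts from. The loss is confined to the digits that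
    the lift erases. Unless the arc is skipped, the component number placed just before those digits
    is larger at the tail of the arc than at its head, and so outweighs the loss. Skipped arcs
    escape this argument, but they offer constants taken from [mu], which are all inserted before
    the search starts. The absence of loose arcs, [mu v <= lift_v(mu w)], keeps every offered label
    above [mu]. The bound [nu >= mu] therefore holds by itself, and the equations contain no maximum
    with [mu]. A key does not fit into a machine word, so neither keys nor the last extracted key
    [X] are ever assembled. Bits are read from rows of cells, and in place of [X] the program uses a
    row whose relevant bits agree with it: that of the node just settled, or a row of zeros. Each
    comparison of bits either raises the level of a node, which happens O(d log n) times per node,
    or ends the offer or move at hand. *)

Fixpoint evalp (s : state) (e : expr) : nat :=
  match e with
  | Cst v => v
  | Reg x => reg s x
  | Get a e1 => arr s a (evalp s e1)
  | Op o e1 e2 => eval_binop o (evalp s e1) (evalp s e2)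
  end.

(** The exponent of a bound: if all cells are at most [N] and [N >= 8], the value is at most
    [N ^ edeg e]. A sum costs one more factor [N]. [Get] keeps the degree of its index, since the
    index has to fit in a word as well. *)
Fixpoint edeg (e : expr) : nat :=
  match e with
  | Cst _ | Reg _ => 1
  | Get _ e1 => edeg e1
  | Op Add e1 e2 => (maxn (edeg e1) (edeg e2)).+1
  | Op Mul e1 e2 => edeg e1 + edeg e2
  | Op _ e1 e2 => maxn (edeg e1) (edeg e2)
  end.

Fixpoint emax (e : expr) : nat :=
  match e with
  | Cst v => v
  | Reg _ => 0
  | Get _ e1 => emax e1
  | Op _ e1 e2 => maxn (emax e1) (emax e2)
  end.

(** The constants 12 and 8 are chosen to cover all expressions of the programs below, so that the
    check is a computation. *)
Definition ok_expr (e : expr) : bool := (edeg e <= 12) && (emax e <= 8).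

Definition bounded (N : nat) (s : state) : Prop :=
  (forall x, reg s x <= N) /\ (forall a i, arr s a i <= N).

Lemma edeg_gt0 e : 0 < edeg e.
Proof. by elim: e => //= -[] e1 H1 e2 H2 //=; lia. Qed.

Lemma evalp_le N s e : 8 <= N -> bounded N s -> emax e <= 8 ->
  evalp s e <= N ^ edeg e.
Proof.
move=> N8 [bR bA].
have N0 : 0 < N by lia.
elim: e => [v|x|a e1 IH1|o e1 IH1 e2 IH2] /=.
- by rewrite expn1; lia.
- by rewrite expn1.
- by move=> _; apply: leq_trans (bA _ _) _; rewrite -{1}[N]expn1 leq_pexp2l ?edeg_gt0.
move=> He.
have {}IH1 := IH1 (leq_trans (leq_maxl _ _) He).
have {}IH2 := IH2 (leq_trans (leq_maxr _ _) He).
have L k : k <= maxn (edeg e1) (edeg e2) -> N ^ k <= N ^ maxn (edeg e1) (edeg e2).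
  by move=> ?; rewrite leq_pexp2l.
have L1 := L _ (leq_maxl (edeg e1) (edeg e2)).
have L2 := L _ (leq_maxr (edeg e1) (edeg e2)).
have P0 : 0 < N ^ maxn (edeg e1) (edeg e2) by rewrite expn_gt0 N0.
case: o => /=.
- by rewrite expnS; nia.
- by lia.
- by rewrite expnD leq_mul.
- by apply: leq_trans (leq_div _ _) _; lia.
- by case: (_ < _); lia.
- by case: (_ == _); lia.
Qed.

Lemma eval_ok W N s e : 8 <= N -> N ^ 12 <= W -> bounded N s -> ok_expr e ->
  eval W s e = Some (evalp s e).
Proof.
move=> N8 NW bs /andP[].
have wordE v : v <= N ^ 12 -> word W v = Some v.
  by move=> h; rewrite /word (leq_trans h NW).
have N0 : 0 < N by lia.
have up e' : edeg e' <= 12 -> emax e' <= 8 -> evalp s e' <= N ^ 12.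
  move=> h1 h2; apply: leq_trans (evalp_le N8 bs h2) _.
  by rewrite leq_pexp2l.
elim: e => [v|x|a e1 IH1|o e1 IH1 e2 IH2] h1 h2 /=.
- exact: wordE (up _ h1 h2).
- exact: wordE (up _ h1 h2).
- by rewrite IH1 //= wordE //; apply: (up (Get a e1)).
have [d1 d2] : edeg e1 <= 12 /\ edeg e2 <= 12.
  have := edeg_gt0 e1; have := edeg_gt0 e2.
  by case: o h1 {h2} => /=; lia.
move: (h2) => /=; rewrite geq_max => /andP[m1 m2].
rewrite IH1 // IH2 //= wordE //; exact: (up (Op o e1 e2)).
Qed.

(** Total correctness with a running time. The bound [N] on all stored values is carried along, so
    that overflow is excluded once and for all: intermediate values stay below [N ^ 12]. *)
Definition wp (W N : nat) (c : cmd) (s : state) (Q : nat -> state -> Prop) : Prop :=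
  bounded N s -> exists t s', [/\ exec W c s t s', bounded N s' & Q t s'].

Definition fits (W N : nat) : bool := (8 <= N) && (N ^ 12 <= W).

Section Wp.
Variables (W N : nat).
Hypothesis WN : fits W N.
Local Notation wp := (wp W N).

Lemma fits_eval s e : bounded N s -> ok_expr e -> eval W s e = Some (evalp s e).
Proof. by case/andP: WN => *; apply: (@eval_ok _ N). Qed.

Lemma wp_mono c s (Q Q' : nat -> state -> Prop) :
  (forall t s', Q t s' -> Q' t s') -> wp c s Q -> wp c s Q'.
Proof. by move=> h H /H[t [s' [? ? /h]]]; exists t, s'. Qed.

Lemma wp_bounded c s Q : (bounded N s -> wp c s Q) -> wp c s Q.
Proof. by move=> h b; apply: h. Qed.

Lemma wp_skip s (Q : nat -> state -> Prop) : Q 1 s -> wp Skip s Q.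
Proof. by move=> q b; exists 1, s; split=> //; constructor. Qed.

Lemma wp_assign x e s (Q : nat -> state -> Prop) : ok_expr e -> evalp s e <= N ->
  Q (cost e).+1 (set_reg s x (evalp s e)) -> wp (Assign x e) s Q.
Proof.
move=> oke le q b; exists (cost e).+1, (set_reg s x (evalp s e)); split=> //.
  by constructor; apply: fits_eval.
by case: b => b1 b2; split=> //= y; case: eqP.
Qed.

Lemma wp_put a e1 e2 s (Q : nat -> state -> Prop) :
  ok_expr e1 -> ok_expr e2 -> evalp s e2 <= N ->
  Q (cost e1 + cost e2).+1 (set_arr s a (evalp s e1) (evalp s e2)) ->
  wp (Put a e1 e2) s Q.
Proof.
move=> ok1 ok2 le q b.
exists (cost e1 + cost e2).+1, (set_arr s a (evalp s e1) (evalp s e2)); split=> //.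
  by constructor; apply: fits_eval.
by case: b => b1 b2; split=> //= c j; case: andP.
Qed.

Lemma wp_seq c1 c2 s (Q : nat -> state -> Prop) :
  wp c1 s (fun t1 s1 => wp c2 s1 (fun t2 s2 => Q (t1 + t2) s2)) ->
  wp (Seq c1 c2) s Q.
Proof.
move=> H b; have [t1 [s1 [x1 b1 H1]]] := H b.
have [t2 [s2 [x2 b2 q]]] := H1 b1.
by exists (t1 + t2), s2; split=> //; econstructor; eauto.
Qed.

Lemma wp_if e c1 c2 s (Q : nat -> state -> Prop) : ok_expr e ->
  (evalp s e != 0 -> wp c1 s (fun t s' => Q (cost e + t).+1 s')) ->
  (evalp s e == 0 -> wp c2 s (fun t s' => Q (cost e + t).+1 s')) ->
  wp (If e c1 c2) s Q.
Proof.
move=> oke H1 H2 b; have ev := fits_eval b oke.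
case: (boolP (evalp s e == 0)) => h.
  have [t [s' [x bs' q]]] := H2 h b.
  by exists (cost e + t).+1, s'; split=> //; econstructor; eauto; rewrite h.
have [t [s' [x bs' q]]] := H1 h b.
by exists (cost e + t).+1, s'; split=> //; econstructor; eauto; rewrite h.
Qed.

(* The number k is a potential: it pays for the running time, so that nested
   loops can share one budget. *)
Lemma wp_while (I : nat -> state -> Prop) k0 e c s
    (Q : nat -> state -> Prop) : ok_expr e -> I k0 s ->
  (forall k s1, bounded N s1 -> I k s1 -> evalp s1 e != 0 ->
     wp c s1 (fun t s2 => exists2 k', I k' s2 & t + (cost e).+1 + k' <= k)) ->
  (forall t k s1, I k s1 -> evalp s1 e = 0 -> t + k <= k0 + (cost e).+1 ->
     Q t s1) ->
  wp (While e c) s Q.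
Proof.
move=> oke Is step fin b.
suff: exists t s', [/\ exec W (While e c) s t s', bounded N s' &
    exists k, [/\ I k s', evalp s' e = 0 & t + k <= k0 + (cost e).+1]].
  by case=> t [s' [x bs' [k [I' e0 le]]]]; exists t, s'; split=> //; apply: fin le.
elim/ltn_ind: k0 s Is b {fin} => k IH s Is b.
have ev := fits_eval b oke.
have [e0|e0] := eqVneq (evalp s e) 0.
  exists (cost e).+1, s; split=> //; last by exists k; split=> //; lia.
  by apply: ExecWhileStop; rewrite ev e0.
have [t1 [s1 [x1 b1 [k1 I1 le1]]]] := step k s b Is e0 b.
have [|t2 [s2 [x2 b2 [k2 [I2 e2 le2]]]]] := IH k1 _ s1 I1 b1; first by lia.
exists (cost e + t1 + t2).+1, s2; split=> //; last by exists k2; split=> //; lia.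
exact: ExecWhileLoop ev e0 x1 x2.
Qed.

Fixpoint regs_of (c : cmd) : seq nat :=
  match c with
  | Assign x _ => [:: x]
  | Seq c1 c2 | If _ c1 c2 => regs_of c1 ++ regs_of c2
  | While _ c => regs_of c
  | _ => [::]
  end.

Fixpoint arrs_of (c : cmd) : seq nat :=
  match c with
  | Put a _ _ => [:: a]
  | Seq c1 c2 | If _ c1 c2 => arrs_of c1 ++ arrs_of c2
  | While _ c => arrs_of c
  | _ => [::]
  end.

(** What a program leaves alone is read off its syntax, so specifications can be restricted to what
    changes. *)
Definition frame (c : cmd) (s s' : state) : Prop :=
  (forall x, x \notin regs_of c -> reg s' x = reg s x) /\
  (forall a, a \notin arrs_of c -> arr s' a =1 arr s a).

Lemma exec_frame c s t s' : exec W c s t s' -> frame c s s'.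
Proof.
elim=> {c s t s'} //=.
- by move=> s x e v _; split=> //= y; rewrite inE => /negbTE->.
- by move=> s a e1 e2 i v _ _; split=> //= b; rewrite inE => /negbTE-> j.
- move=> s c1 t1 s1 c2 t2 s2 _ [r1 a1] _ [r2 a2]; split=> /= x;
    rewrite mem_cat negb_or => /andP[n1 n2]; first by rewrite r2 // r1.
  by move=> i; rewrite a2 // a1.
- move=> s e v c1 c2 t s' _ _ [r a]; split=> /= x;
    rewrite mem_cat negb_or => /andP[n1 n2]; [apply: r|apply: a]; by case: (v != 0).
- move=> s e v c t1 s1 t2 s2 _ _ _ [r1 a1] _ [r2 a2]; split=> /= x n1.
    by rewrite r2 // r1.
  by move=> i; rewrite a2 // a1.
Qed.

Lemma wp_frame c s (Q : nat -> state -> Prop) :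
  wp c s (fun t s' => frame c s s' -> Q t s') -> wp c s Q.
Proof.
move=> H /H[t [s' [x b q]]]; exists t, s'; split=> //.
exact: q (exec_frame x).
Qed.

End Wp.

(** * Labels as numbers *)

(** For [d] even and [0 < p <= d], the component of index [d - 1 - 2 j] survives truncation at [p]
    exactly if [j < kept d p]. *)
Definition kept (d p : nat) : nat := (d.+1 - p)./2.

Definition unit_of (n d p : nat) : nat := n ^ (d./2 - kept d p).

(* Labels are read as numbers in base n, with top = n ^ d./2: liftl p x is the
   least label y such that an arc from a node of priority p labelled y to a
   node labelled x is not violated. *)
Definition liftl (n d p x : nat) : nat :=
  let K := unit_of n d p in
  if odd p then minn (n ^ d./2) ((x %/ K).+1 * K) else x %/ K * K.

Section Lift.
Variables (n d : nat).
Hypotheses (n_gt0 : 0 < n) (evd : ~~ odd d).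
Local Notation liftl := (liftl n d).
Local Notation K := (unit_of n d).
Local Notation top := (n ^ d./2).

Lemma unit_gt0 p : 0 < K p.
Proof. by rewrite expn_gt0 n_gt0. Qed.

Lemma lift_mono p x y : x <= y -> liftl p x <= liftl p y.
Proof.
move=> xy; have := leq_div2r (K p) xy; have := unit_gt0 p.
rewrite /liftl; case: odd; last by move=> ? ?; rewrite leq_mul2r; lia.
by move=> ? ?; rewrite leq_min geq_minl /= geq_min leq_mul2r ltnS; lia.
Qed.

Lemma unit_dvd_top p : K p %| top.
Proof. by rewrite dvdn_exp2l // leq_subr. Qed.

Lemma lift_le_top p x : x <= top -> liftl p x <= top.
Proof.
by move=> ?; rewrite /liftl; case: odd; rewrite ?geq_minl // (leq_trans (leq_trunc_div _ _)).
Qed.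

Lemma lift_top p : liftl p top = top.
Proof.
rewrite /liftl; case: odd; last by rewrite divnK // unit_dvd_top.
by apply/minn_idPl; rewrite mulSn divnK ?unit_dvd_top // leq_addl.
Qed.

Lemma unit_dvd p q : q <= p -> K q %| K p.
Proof. by move=> ?; rewrite dvdn_exp2l // /kept; lia. Qed.

(** An odd [q <= p] is below the even [p], so the lift at [q] respects at least one digit more than
    that at [p] and adds at most one n-th of the unit of [p]. *)
Lemma lift_unit_le p q x : 0 < p <= d -> ~~ odd p -> q <= p ->
  liftl q x <= x + n ^ (d./2 - kept d p).-1.
Proof.
move=> p0d evp qp; rewrite /liftl; case: ifP => oq; last first.
  by apply: leq_trans (leq_trunc_div _ _) (leq_addr _ _).
rewrite geq_min; apply/orP; right; rewrite mulSn addnC leq_add ?leq_trunc_div //.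
by rewrite leq_pexp2l // /kept; lia.
Qed.

(** The unit of [q] divides that of [p], so rounding down at [q] does not change the quotient by the
    unit of [p], and rounding up does not lower it. Staying below top excludes the cap. *)
Lemma lift_unit_ge p q x : q <= p -> liftl q x < top ->
  x %/ K p <= liftl q x %/ K p.
Proof.
move=> qp; have K0 := unit_gt0 q; have Kp := unit_gt0 p.
have low : x %/ K p <= (x %/ K q * K q) %/ K p.
  have /dvdnP[r Er] := unit_dvd qp.
  rewrite leq_divRL // {2}Er mulnA leq_mul2r; apply/orP; right.
  rewrite leq_divRL // -mulnA -Er; exact: leq_trunc_div.
rewrite /liftl; case: ifP => // oq h.
have -> : minn top ((x %/ K q).+1 * K q) = (x %/ K q).+1 * K q.
  by apply/minn_idPr; move: h; rewrite gtn_min ltnn /= => /ltnW.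
by apply: leq_trans low _; apply: leq_div2r; rewrite leq_mul2r leqnSn orbT.
Qed.

End Lift.

(** * The least feasible labeling through its local equations *)

Section Least.
Variables (V : finType) (d : nat) (E sk : rel V) (pr : V -> nat).
Variables (mu D : V -> nat).
Local Notation n := #|V|.
Local Notation top := (n ^ d./2).
Local Notation liftl := (liftl n d).
Local Notation K := (unit_of n d).

Definition low_arc (q : nat) : rel V := fun x y => [&& E x y, pr x <= q & pr y <= q].

Hypotheses (evd : ~~ odd d) (prd : forall v, 0 < pr v <= d).
Hypothesis E_out : forall v, exists w, E v w.
Hypothesis D_top : forall v, D v <= top.
Hypothesis mu_D : forall v, mu v <= D v.
Hypothesis sk_sound : forall v w, sk v w ->
  [/\ E v w, ~~ odd (pr v), pr w <= pr v & connect (low_arc (pr v)) w v].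
Hypothesis sk_complete : forall v w, E v w -> ~~ odd (pr v) -> pr w <= pr v ->
  connect (low_arc (pr v)) w v -> sk v w.
Hypothesis D_arc : forall v w, E v w -> ~~ sk v w -> D v <= liftl (pr v) (D w).
Hypothesis D_sk : forall v w, sk v w -> D v <= liftl (pr v) (mu w).
Hypothesis D_attained : forall v, D v < top ->
  (exists2 w, sk v w & D v = liftl (pr v) (mu w)) \/
  (exists2 w, E v w & D v = liftl (pr v) (D w)).

Lemma n_gt0 (v : V) : 0 < n.
Proof. by apply/card_gt0P; exists v. Qed.

Lemma D_all_arcs v w : E v w -> D v <= liftl (pr v) (D w).
Proof.
move=> Evw; case: (boolP (sk v w)) => [s|s]; last exact: D_arc.
by apply: leq_trans (D_sk s) _; apply: lift_mono; rewrite ?(n_gt0 v).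
Qed.

(** By [lift_unit_le], each arc through priorities at most [p] contributes at most one n-th of the
    unit of [p]. *)
Lemma D_low_path p y r : 0 < p <= d -> ~~ odd p -> path (low_arc p) y r ->
  D y <= D (last y r) + size r * n ^ (d./2 - kept d p).-1.
Proof.
move=> p0d evp; elim: r y => [|z r IH] y /=; first by lia.
move=> /andP[/and3P[Eyz py pz] /IH].
have := lift_unit_le (n_gt0 y) evd (D z) p0d evp py.
have := D_all_arcs Eyz; rewrite mulSn.
  move=> h1 h2 h3; apply: leq_trans h1 (leq_trans h2 _).
  by rewrite addnCA addnC leq_add2l.
Qed.

Lemma D_feasible v : exists2 w, E v w & liftl (pr v) (D w) <= D v.
Proof.
have n0 := n_gt0 v.
case: (ltnP (D v) top) => [/D_attained[]|Dt]; last first.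
- by have [w Evw] := E_out v; exists w => //; apply: leq_trans (lift_le_top _ (D_top w)) Dt.
- by case=> w Evw ->; exists w.
case=> w /sk_sound[Evw ev pw /connectP[r0 r0p lv]] Dv; exists w => //.
(* A path without repeated nodes has fewer than [n] arcs, so the total gain is less than one unit of
   [pr v]. *)
case/shortenP: r0p lv => r rp ru _ lv.
have := D_low_path (prd v) ev rp; rewrite -lv.
have sr : size r < n by have := max_card (mem (w :: r)); rewrite (card_uniqP ru).
set K' := n ^ _ => le.
have EK : K (pr v) = n * K'.
  rewrite /K' /unit_of -expnS prednK // subn_gt0 /kept.
  have := prd v; lia.
have K'0 : 0 < K' by rewrite expn_gt0 n0.
(* [D v] is a multiple of the unit, so [D w], being less than one unit above it, rounds down to at
   most [D v]. *)
move: Dv; rewrite /liftl (negbTE ev) => Dv.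
rewrite Dv leq_mul2r -ltnS; apply/orP; right.
rewrite ltn_divLR ?unit_gt0 // mulSn addnC -Dv EK.
by apply: leq_ltn_trans le _; rewrite ltn_add2l ltn_pmul2r.
Qed.

Lemma D_least (N : V -> nat) : (forall v, mu v <= N v <= top) ->
  (forall v, exists2 w, E v w & liftl (pr v) (N w) <= N v) ->
  forall v, D v <= N v.
Proof.
move=> muN feas v0; rewrite leqNgt; apply/negP => bad0.
have n0 := n_gt0 v0.
have /fin_all_exists[g gP] : forall v, exists w, E v w /\ liftl (pr v) (N w) <= N v.
  by move=> v; have [w] := feas v; exists w.
pose bad v := N v < D v.
have badg v : bad v -> bad (g v).
  move=> bv; rewrite /bad ltnNge; apply/negP => le; move: bv; rewrite /bad ltnNge.
  have [Ev Nv] := gP v; case/negP; apply: leq_trans (D_all_arcs Ev) _.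
  by apply: leq_trans Nv; apply: lift_mono.
(* Bad nodes are closed under [g]. The smallest orbit of a bad node is a cycle of [g], all of whose
   nodes have this same orbit. *)
pose R x := [set y | fconnect g x y].
have R_sub x y : y \in R x -> R y \subset R x.
  rewrite inE => xy; apply/subsetP => z; rewrite !inE; exact: connect_trans.
have [x badx minx] : exists2 x, bad x & forall y, bad y -> #|R x| <= #|R y|.
  by case: (@arg_minnP _ v0 bad (fun x => #|R x|) bad0) => x; exists x.
have bad_it k y : bad y -> bad (iter k g y) by elim: k => //= k IH /IH/badg.
have badR y : y \in R x -> bad y.
  by rewrite inE => /iter_findex <-; apply: bad_it.
have RE y : y \in R x -> R y = R x.
  by move=> yx; apply/eqP; rewrite eqEcard R_sub //= minx // badR.
have gR y : y \in R x -> g y \in R x.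
  by rewrite !inE => xy; apply: connect_trans xy (fconnect1 _ _).
have xR : x \in R x by rewrite inE connect0.
have [u uR umax] : exists2 u, u \in R x & forall y, y \in R x -> pr y <= pr u.
  by case: (@arg_maxnP _ x (mem (R x)) pr xR) => u; exists u.
have guu : fconnect g (g u) u.
  by have := uR; rewrite -(RE _ (gR _ uR)) inE.
have Ntop y : y \in R x -> N y < top.
  by move=> /badR; rewrite /bad => yb; apply: leq_trans yb (D_top y).
have it k y : y \in R x -> iter k g y \in R x by elim: k => //= k IH /IH/gR.
(* Labels on the cycle are below top, so the digits kept at its largest priority cannot increase
   from a node to its successor; going around, they are constant. *)
have step y : y \in R x -> N (g y) %/ K (pr u) <= N y %/ K (pr u).
  move=> yR; have [_ le] := gP y.
  have lt : liftl (pr y) (N (g y)) < top by apply: leq_ltn_trans le (Ntop _ yR).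
  apply: leq_trans (lift_unit_ge n0 evd (umax _ yR) lt) _.
  exact: leq_div2r.
have steps k y : y \in R x -> N (iter k g y) %/ K (pr u) <= N y %/ K (pr u).
  move=> yR; elim: k => //= k; apply: leq_trans; apply: step; exact: it.
have conn k y : y \in R x -> connect (low_arc (pr u)) y (iter k g y).
  move=> yR; elim: k => //= k /connect_trans; apply; apply: connect1.
  have kR := it k _ yR.
  by rewrite /low_arc (gP _).1 !umax ?gR.
have [Eu Nu] := gP u.
have := iter_findex guu; set k := findex _ _ _ => ku.
have := steps k _ (gR _ uR); rewrite ku => Kle.
have := conn k _ (gR _ uR); rewrite ku => Kconn.
have K0 := unit_gt0 d n0 (pr u).
(* An odd largest priority would force these constant digits to increase strictly; an even one makes
   the arc out of [u] skipped, which bounds [D u] by a lift of [mu]. *)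
case: (boolP (odd (pr u))) => op.
  move: Nu; rewrite /liftl op leqNgt => /negP; apply.
  rewrite leq_min (Ntop _ uR) /=.
  by apply: leq_trans (ltn_ceil (N u) K0) _; rewrite leq_mul2r ltnS Kle orbT.
have := badR _ uR; rewrite /bad ltnNge => /negP; apply.
apply: leq_trans (D_sk (sk_complete Eu op (umax _ (gR _ uR)) Kconn)) _.
apply: leq_trans Nu; apply: lift_mono => //.
by have /andP[] := muN (g u).
Qed.

End Least.

(** * Digit strings in base n as numbers *)

Definition value (n : nat) (s : seq nat) : nat := foldl (fun a x => a * n + x) 0 s.

Lemma foldl_value n a s :
  foldl (fun a x => a * n + x) a s = a * n ^ size s + value n s.
Proof.
rewrite /value; elim/last_ind: s => [|s x IH] /=; first by rewrite expn0; lia.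
by rewrite -!cats1 !foldl_cat /= IH size_cat addn1 expnSr; lia.
Qed.

Lemma value_cons n x s : value n (x :: s) = x * n ^ size s + value n s.
Proof. by rewrite {1}/value /= foldl_value; lia. Qed.

Lemma value_cat n s t : value n (s ++ t) = value n s * n ^ size t + value n t.
Proof. by rewrite {1}/value foldl_cat foldl_value. Qed.

Lemma value_lt n s : all (gtn n) s -> value n s < n ^ size s.
Proof.
elim: s => [|x s IH] //= /andP[xn /IH].
rewrite value_cons expnS; move: (n ^ _) (value _ _) xn => N v /= xn vN; nia.
Qed.

Lemma value_take n s c : all (gtn n) s -> c <= size s ->
  value n (take c s) = value n s %/ n ^ (size s - c).
Proof.
move=> a cs; rewrite -{2}(cat_take_drop c s) value_cat size_drop.
have := a; rewrite -{1}(cat_take_drop c s) all_cat => /andP[_ /value_lt].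
rewrite size_drop => lt; rewrite divnMDl ?divn_small ?addn0 //.
by apply: leq_ltn_trans lt.
Qed.

Lemma value_lt_cons n x y s t : size s = size t -> all (gtn n) s ->
  x < y -> value n (x :: s) < value n (y :: t).
Proof.
move=> st /value_lt lt xy; rewrite !value_cons -st.
have : x.+1 * n ^ size s <= y * n ^ size s by rewrite leq_mul2r xy orbT.
rewrite mulSn; move: (n ^ _) (_ * _) (_ * _) lt => N a b; lia.
Qed.

Lemma value_inj n s t : size s = size t -> all (gtn n) s -> all (gtn n) t ->
  value n s = value n t -> s = t.
Proof.
elim: s t => [|x s IH] [|y t] //= [st] /andP[xn sn] /andP[yn tn] E.
have xy : x = y.
  case: (ltngtP x y) => // lt.
    by have := value_lt_cons st sn lt; rewrite E ltnn.
  by have := value_lt_cons (esym st) tn lt; rewrite E ltnn.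
by rewrite xy (IH t) //; move: E; rewrite xy !value_cons st => /addnI.
Qed.

Lemma all_val n (s : seq 'I_n) : all (gtn n) (map val s).
Proof. by apply/allP => _ /mapP[i _ ->] /=. Qed.

Lemma lexi_value n (s t : seqlexi 'I_n) : size s = size t ->
  (s <= t)%O = (value n (map val s) <= value n (map val t)).
Proof.
elim: s t => [|x s IH] [|y t] //= [st].
rewrite Order.SeqLexiOrder.lexi_cons !leEord.
have sz : size (map val s) = size (map val t) by rewrite !size_map.
case: (ltngtP x y) => [lt|lt|/val_inj ->] /=.
- by rewrite ltnW // value_lt_cons ?all_val.
- by apply/esym/negbTE; rewrite -ltnNge value_lt_cons ?all_val.
- by rewrite IH // !value_cons sz leq_add2l.
Qed.

Definition num n d (x : label n d) : nat :=
  if x is Some xi then value n (map val (val xi)) else n ^ d./2.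

Lemma num_Some_lt n d (xi : leaf n d) : num (Some xi : label n d) < n ^ d./2.
Proof. by have := value_lt (all_val (val xi)); rewrite size_map size_tuple. Qed.

Lemma num_le n d (x : label n d) : num x <= n ^ d./2.
Proof. by case: x => [xi|] //; apply: ltnW (num_Some_lt _). Qed.

Lemma le_labelE n d (x y : label n d) : le_label x y = (num x <= num y).
Proof.
case: x y => [x|] [y|] //=; rewrite /le_label /=.
- by rewrite lexi_value // !size_tuple.
- by rewrite ltnW // (num_Some_lt x).
- by rewrite leqNgt (num_Some_lt y).
- by rewrite leqnn.
Qed.

Lemma num_digits n d (s : seq nat) : 0 < n -> size s = d./2 -> all (gtn n) s ->
  exists xi : leaf n d, map val (val xi) = s.
Proof.
case: n => // n _ sz sn.
have szp : size (map (@inord n) s) == d./2 by rewrite size_map sz.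
exists (Tuple szp) => /=; rewrite -map_comp -[RHS]map_id.
by apply/eq_in_map => i /(allP sn) /= lt; rewrite inordK.
Qed.

Lemma value_surj n h k : k < n ^ h ->
  exists s, [/\ size s = h, all (gtn n) s & value n s = k].
Proof.
elim: h k => [|h IH] k; first by case: k => // _; exists [::].
rewrite expnS => lt.
have K0 : 0 < n ^ h by move: lt; case: (n ^ h) => //; rewrite muln0.
have [s [sz sn E]] := IH (k %% n ^ h) (ltn_pmod _ K0).
exists (k %/ n ^ h :: s); split=> /=; rewrite ?sz //.
  by rewrite sn andbT ltn_divLR.
by rewrite value_cons sz E -divn_eq.
Qed.

Lemma num_surj n d k : 0 < n -> k <= n ^ d./2 -> exists x : label n d, num x = k.
Proof.
move=> n0; rewrite leq_eqVlt => /predU1P[->|lt]; first by exists None.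
have [s [sz sn E]] := value_surj lt.
have [xi Exi] := num_digits n0 sz sn.
by exists (Some xi); rewrite /= Exi.
Qed.

Lemma mask_ltn (T : Type) h c (s : seq T) : size s = h ->
  mask [seq j < c | j <- iota 0 h] s = take c s.
Proof.
have gen a : mask [seq j < c | j <- iota a (size s)] s = take (c - a) s.
  elim: s a => [|x s IH] a //=; case: ltnP => ac; rewrite IH.
    by rewrite -(subnSK ac).
  have -> : c - a = 0 by lia.
  have -> : c - a.+1 = 0 by lia.
  by rewrite !take0.
by move=> <-; rewrite gen subn0.
Qed.

Lemma trunc_leafE n d p (xi : leaf n d) : ~~ odd d -> 0 < p <= d ->
  trunc_leaf p xi = take (kept d p) xi :> seq 'I_n.
Proof.
move=> evd p0d; rewrite /trunc_leaf -(mask_ltn _ (size_tuple xi)).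
congr mask; apply/eq_in_map => j; rewrite mem_iota add0n /= => jh.
by rewrite /kept; apply/idP/idP; lia.
Qed.

Lemma kept_le d p : 0 < p -> kept d p <= d./2.
Proof. by rewrite /kept; lia. Qed.

Lemma size_trunc n d p (xi : leaf n d) : ~~ odd d -> 0 < p <= d ->
  size (trunc_leaf p xi : seq 'I_n) = kept d p.
Proof.
move=> evd p0d; rewrite trunc_leafE // size_takel // size_tuple.
by apply: kept_le; lia.
Qed.

Lemma value_trunc n d p (xi : leaf n d) : ~~ odd d -> 0 < p <= d ->
  value n (map val (trunc_leaf p xi : seq 'I_n)) =
  num (Some xi : label n d) %/ unit_of n d p.
Proof.
move=> evd p0d; rewrite trunc_leafE // map_take value_take ?all_val //.
  by rewrite size_map size_tuple.
by rewrite size_map size_tuple; apply: kept_le; lia.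
Qed.

Arguments num : simpl never.

(** The lift fixes [n ^ d./2] and odd lifts are capped there, which reproduces the clause for two
    top labels at an odd priority. *)
Lemma non_violatedE (V : finType) d (G : parity_game V d) (mu : labeling V d) v w :
  non_violated G mu v w =
  (liftl #|V| d (prio G v) (num (mu w)) <= num (mu v)).
Proof.
have n0 : 0 < #|V| by apply/card_gt0P; exists v.
have evd := d_even G; have p0d := prio_range G v.
rewrite /non_violated; set p := prio G v in p0d *.
have K0 := unit_gt0 d n0 p.
have teq (x y : leaf #|V| d) : (trunc_leaf p x == trunc_leaf p y) =
    (num (Some x : label _ d) %/ unit_of #|V| d p ==
     num (Some y : label _ d) %/ unit_of #|V| d p).
  rewrite -!value_trunc //; apply/eqP/eqP => [->|] // /value_inj E.
  by apply: (inj_map val_inj); apply: E; rewrite ?all_val // !size_map !size_trunc.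
have tle (x y : leaf #|V| d) : (trunc_leaf p x <= trunc_leaf p y)%O =
    (num (Some x : label _ d) %/ unit_of #|V| d p <=
     num (Some y : label _ d) %/ unit_of #|V| d p).
  by rewrite lexi_value ?size_trunc // !value_trunc.
case: ifP => op.
  case Ev: (mu v) => [y|]; last first.
    rewrite (leq_trans (lift_le_top _ (num_le _))) //=.
    by case: (mu w) => [x|]; rewrite ?orbT // /lt_top.
  rewrite /= orbF.
  case Ew: (mu w) => [x|] /=; last first.
    by rewrite /lt_top /= leqNgt lift_top // num_Some_lt.
  rewrite /lt_top /= tle (inj_eq Some_inj) teq -ltn_neqAle.
  rewrite /liftl op geq_min [X in X || _]leqNgt num_Some_lt /=.
  by rewrite -leq_divRL.
case Ev: (mu v) => [y|]; last first.
  rewrite (leq_trans (lift_le_top _ (num_le _))) //=.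
  by case: (mu w).
case Ew: (mu w) => [x|] /=; last first.
  by rewrite leqNgt lift_top // num_Some_lt.
by rewrite tle /liftl op -leq_divRL.
Qed.

(** * Loose arcs and feasibility in terms of numbers *)

Section Link.
Variables (V : finType) (d : nat) (G : parity_game V d) (tau : V -> V).
Local Notation n := #|V|.

Lemma no_loose_le (mu : labeling V d) v w : ~ loose G mu v w ->
  num (mu v) <= liftl n d (prio G v) (num (mu w)).
Proof.
move=> nl; have n0 : 0 < n by apply/card_gt0P; exists v.
case: (boolP (non_violated G mu v w)) => [nv|]; last first.
  by rewrite non_violatedE -ltnNge => /ltnW.
rewrite leqNgt; apply/negP => lt; apply: nl; split=> // -[_ tgt].
(* Off loops, the lifted label itself refutes tightness. On a loop the substitution moves both ends,
   which calls for another argument. *)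
have [vw|vw] := eqVneq v w; last first.
  have [x Ex] := num_surj n0 (lift_le_top (prio G v) (num_le (mu w))).
  have := tgt x; rewrite non_violatedE /subst eqxx eq_sym (negbTE vw) Ex leqnn.
  by move=> /(_ isT); rewrite le_labelE Ex leqNgt lt.
subst w; move: nv lt; rewrite non_violatedE => nv lt.
(* An odd loop is non-violated only at top, which the lift fixes. An even loop is non-violated at
   label 0, so tightness forces label 0, and nothing is smaller. *)
case: (boolP (odd (prio G v))) => op.
  have := num_le (mu v); rewrite leq_eqVlt => /predU1P[top|ntop].
    by move: lt; rewrite top lift_top // ltnn.
  move: nv; rewrite {1}/liftl op geq_min leqNgt ntop /=.
  by rewrite leqNgt ltn_ceil ?unit_gt0.
have [x Ex] := num_surj (d := d) n0 (leq0n _).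
have := tgt x; rewrite non_violatedE /subst eqxx Ex /liftl (negbTE op) div0n mul0n.
move=> /(_ isT); rewrite le_labelE Ex leqn0 => /eqP m0.
by move: lt; rewrite m0 ltn0.
Qed.

Lemma arc_tau_out : odd_strategy G tau -> forall v, exists w, arc_tau G tau v w.
Proof.
move=> odds v; case: (boolP (v \in odd_nodes G)) => ov.
  by exists (tau v); rewrite /arc_tau odds // eqxx implybT.
by have [w vw] := arc_out G v; exists w; rewrite /arc_tau vw (negbTE ov).
Qed.

(** Within [G_tau] and [G_sigma] together every node has exactly one arc, so a strategy amounts to a
    choice of one non-violated arc per node. *)
Lemma feasibleP (nu : labeling V d) : odd_strategy G tau ->
  feasible G tau nu <->
  forall v, exists2 w, arc_tau G tau v w &
    liftl n d (prio G v) (num (nu w)) <= num (nu v).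
Proof.
move=> odds; split=> [[sigma evs nv] v|H].
  case: (boolP (v \in odd_nodes G)) => ov.
    exists (tau v); rewrite -?non_violatedE ?nv /arc_tau ?/arc_sigma ?odds ?eqxx ?implybT //=.
    by move: ov; rewrite inE => /negbTE->.
  have ev : v \in even_nodes G by move: ov; rewrite inE negbK.
  exists (sigma v); rewrite -?non_violatedE ?nv /arc_tau ?/arc_sigma ?evs ?eqxx ?implybT //=;
  by rewrite (negbTE ov).
have /fin_all_exists[g gP] : forall v, exists w, arc_tau G tau v w /\
    liftl n d (prio G v) (num (nu w)) <= num (nu v).
  by move=> v; have [w] := H v; exists w.
exists g => [v _|v w]; first by have [/andP[]] := gP v.
have [/andP[_ gt] le] := gP v.
rewrite non_violatedE => /andP[_ wt] /andP[_ ws].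
suff -> : w = g v by [].
case: (boolP (v \in odd_nodes G)) => ov.
  by move: wt gt; rewrite ov /= => /eqP-> /eqP.
by move: ws; move: ov; rewrite inE negbK => -> /eqP.
Qed.

Lemma least_feasible_num (mu nu : labeling V d) (sk : rel V) :
  let E := arc_tau G tau in
  let lab p (x : label n d) := liftl n d p (num x) in
  odd_strategy G tau ->
  (forall v, num (mu v) <= num (nu v)) ->
  (forall v w, sk v w -> [/\ E v w, ~~ odd (prio G v), prio G w <= prio G v &
     connect (low_arc E (prio G) (prio G v)) w v]) ->
  (forall v w, E v w -> ~~ odd (prio G v) -> prio G w <= prio G v ->
     connect (low_arc E (prio G) (prio G v)) w v -> sk v w) ->
  (forall v w, E v w -> ~~ sk v w -> num (nu v) <= lab (prio G v) (nu w)) ->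
  (forall v w, sk v w -> num (nu v) <= lab (prio G v) (mu w)) ->
  (forall v, nu v <> None ->
    (exists2 w, sk v w & num (nu v) = lab (prio G v) (mu w)) \/
    (exists2 w, E v w & num (nu v) = lab (prio G v) (nu w))) ->
  is_least_feasible G tau mu nu.
Proof.
move=> E lab odds munu sks skc arcs skle att.
have att' v : num (nu v) < n ^ d./2 ->
    (exists2 w, sk v w & num (nu v) = lab (prio G v) (mu w)) \/
    (exists2 w, E v w & num (nu v) = lab (prio G v) (nu w)).
  by move=> lt; apply: att => vN; move: lt; rewrite vN ltnn.
have top v := num_le (nu v).
split; first by move=> v; rewrite le_labelE.
  apply/feasibleP => //.
  exact: (D_feasible (d_even G) (prio_range G) (arc_tau_out odds) top munu sks
           arcs skle att').
move=> nu' munu' /feasibleP-/(_ odds) feas v; rewrite le_labelE.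
apply: (D_least (mu := fun v => num (mu v)) (D := fun v => num (nu v))
  (d_even G) top munu skc arcs skle _ feas).
by move=> u; rewrite num_le andbT -le_labelE munu'.
Qed.

End Link.

(** * Depth-first search and components *)

Definition reach (e : rel nat) (x y : nat) : Prop :=
  exists2 p, path e x p & last x p = y.

Lemma reach_refl e x : reach e x x.
Proof. by exists [::]. Qed.

Lemma reach_trans e x y z : reach e x y -> reach e y z -> reach e x z.
Proof.
case=> p pp <- [q pq <-]; exists (p ++ q); rewrite ?last_cat //.
by rewrite cat_path pp.
Qed.

Lemma reach1 (e : rel nat) x y : e x y -> reach e x y.
Proof. by move=> exy; exists [:: y]; rewrite //= exy. Qed.

Lemma reach_rev (e e' : rel nat) x y : (forall u v, e u v = e' v u) ->
  reach e x y -> reach e' y x.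
Proof.
move=> ee [p]; elim: p x => [|z p IH] x /=; first by move=> _ ->; apply: reach_refl.
move=> /andP[xz pz] lz; apply: reach_trans (IH _ pz lz) _.
by apply: reach1; rewrite -ee.
Qed.

Lemma reach_exit (e : rel nat) (P : pred nat) x y : P x -> ~~ P y -> reach e x y ->
  exists u v, [/\ P u, ~~ P v, reach e x u, e u v & reach e v y].
Proof.
move=> Px Py [p]; elim: p x Px => [|z p IH] x Px /=.
  by move=> _ E; rewrite -E Px in Py.
move=> /andP[xz pz] lz; case: (boolP (P z)) => Pz.
  have [u [v [Pu Pv zu uv vy]]] := IH z Pz pz lz.
  by exists u, v; split=> //; apply: reach_trans zu; apply: reach1.
by exists x, z; split=> //; [apply: reach_refl | exists p].
Qed.

Definition upd (T : Type) (f : nat -> T) (x : nat) (v : T) : nat -> T :=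
  fun y => if y == x then v else f y.

Lemma updx T (f : nat -> T) x v : upd f x v x = v.
Proof. by rewrite /upd eqxx. Qed.

Lemma updN T (f : nat -> T) x v y : y != x -> upd f x v y = f y.
Proof. by rewrite /upd => /negbTE->. Qed.

Record dfs_conf := DfsConf {
  dlab : nat -> nat; dptr : nat -> seq nat; dstk : seq nat; dfin : seq nat;
  dcnt : nat; didx : nat }.

Section Dfs.
Variables (n : nat) (H : pred nat) (adj : nat -> seq nat) (ord : seq nat).

Definition hedge : rel nat := fun x y => [&& H x, H y & y \in adj x].
Local Notation reach := (reach hedge).

Hypothesis adj_lt : forall x y, y \in adj x -> y < n.
Hypothesis ord_uniq : uniq ord.
Hypothesis ord_lt : forall x, x \in ord -> x < n.
Hypothesis ord_all : forall x, x < n -> H x -> x \in ord.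

(* A finished node x either shares its component with a node on the stack, or
   everything reachable from x is finished and the last finished such node
   belongs to the component of x. *)
Definition settled_scc (c : dfs_conf) (x : nat) : Prop :=
  (exists g, [/\ g \in dstk c, reach x g & reach g x]) \/
  (exists z, [/\ reach x z, reach z x &
     forall y, reach x y -> y \in dfin c /\ index y (dfin c) <= index z (dfin c)]).

(** One invariant for both passes of Kosaraju's method: [di_scc] is what the first pass delivers,
    while the second relies on [di_adj], by which labels do not increase along scanned edges, and on
    [di_root]. Roots are tried from the end of [ord], so a root has the largest index in its
    tree. *)
Record dfs_inv (c : dfs_conf) : Prop := DfsInv {
  di_lab : forall x, dlab c x != 0 -> [/\ H x, x < n & dlab c x <= dcnt c];
  di_uniq : uniq (dstk c ++ dfin c);
  di_mem : forall x, (x \in dstk c ++ dfin c) = (dlab c x != 0);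
  di_path : sorted (fun a b => hedge b a) (dstk c);
  di_adj : forall x, dlab c x != 0 -> exists2 pre, adj x = pre ++ dptr c x &
     forall y, y \in pre -> H y -> 0 < dlab c y <= dlab c x;
  di_done : forall x, x \in dfin c -> dptr c x = [::];
  di_top : forall x, x \in dstk c -> dlab c x = dcnt c;
  di_scc : forall x, x \in dfin c -> settled_scc c x;
  di_root : exists2 rt : nat -> nat,
     (forall x, dlab c x != 0 -> let r := rt (dlab c x) in
        [/\ dlab c r = dlab c x, reach r x & index x ord <= index r ord]) &
     (dstk c != [::] -> didx c <= index (rt (dcnt c)) ord);
  di_idx : forall j, didx c <= j -> j < size ord -> H (nth 0 ord j) ->
     dlab c (nth 0 ord j) != 0;
  di_le : dcnt c + didx c <= size ord }.

Definition dfs_start (k : nat) : dfs_conf :=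
  DfsConf (fun=> 0) (fun=> [::]) [::] [::] 0 k.

Lemma dfs_inv_start : dfs_inv (dfs_start (size ord)).
Proof.
split=> //=; first by exists id.
by move=> j h1 h2; lia.
Qed.

Definition dfs_skip (c : dfs_conf) : dfs_conf :=
  DfsConf (dlab c) (dptr c) (dstk c) (dfin c) (dcnt c) (didx c).-1.

Lemma dfs_inv_skip c : dfs_inv c -> dstk c = [::] -> didx c != 0 ->
  ~~ (H (nth 0 ord (didx c).-1) && (dlab c (nth 0 ord (didx c).-1) == 0)) ->
  dfs_inv (dfs_skip c).
Proof.
case=> i1 i2 i3 i4 i5 i6 i7 i8 [rt r1 r2] i9 i10 e0 k0 hr.
split=> //=; rewrite ?e0 //; last by lia.
  by exists rt => //; rewrite e0.
move=> j le lt Hj; case: (leqP (didx c) j) => h; first exact: i9.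
have Ej : j = (didx c).-1 by lia.
by move: hr; rewrite -Ej Hj.
Qed.

Definition dfs_visit (c : dfs_conf) (x k : nat) (p : nat -> seq nat) : dfs_conf :=
  DfsConf (upd (dlab c) x k) (upd p x (adj x)) (x :: dstk c) (dfin c) k (didx c).

Definition dfs_root (c : dfs_conf) : dfs_conf :=
  dfs_visit (dfs_skip c) (nth 0 ord (didx c).-1) (dcnt c).+1 (dptr c).

Lemma dfs_inv_root c : dfs_inv c -> dstk c = [::] -> didx c != 0 ->
  H (nth 0 ord (didx c).-1) -> dlab c (nth 0 ord (didx c).-1) = 0 ->
  dfs_inv (dfs_root c).
Proof.
case=> i1 i2 i3 i4 i5 i6 i7 i8 [rt r1 r2] i9 i10 e0 k0.
set r := nth 0 ord _ => Hr lr.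
have ri : (didx c).-1 < size ord by lia.
have rord : r \in ord by rewrite mem_nth.
have ir : index r ord = (didx c).-1 by rewrite index_uniq.
have ne x : dlab c x != 0 -> x == r = false.
  by move=> h; apply/eqP => E; rewrite E lr in h.
rewrite e0 /= in i2 i3 i7.
have rf : r \notin dfin c by rewrite i3 lr.
split; rewrite /dfs_root /= -/r ?e0 ?rf //=.
- move=> x; rewrite /upd; case: (eqVneq x r) => [-> _|_ lx]; first by rewrite Hr ord_lt.
  by have [? ? ?] := i1 _ lx; split=> //; apply: leqW.
- by move=> x; rewrite inE i3 /upd; case: (eqVneq x r).
- move=> x; rewrite {1}/upd; case: (eqVneq x r) => [-> _|nx lx].
    by exists [::] => //; rewrite /upd eqxx.
  have [pre E pl] := i5 x lx; exists pre; first by rewrite /upd ne.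
  move=> y yp Hy; have /andP[h1 h2] := pl y yp Hy.
  by rewrite /upd !ne ?h1 // -lt0n.
- by move=> x xf; rewrite /upd ne ?i6 // -i3.
- by move=> x; rewrite inE => /eqP->; rewrite /upd eqxx.
- move=> x /i8[[g]|[z [h1 h2 h3]]]; first by rewrite e0; case.
  by right; exists z.
- exists (upd rt (dcnt c).+1 r) => /=; last by rewrite updx ir.
  move=> x; case: (eqVneq x r) => [->|nx].
    by rewrite !updx; split=> //; apply: reach_refl.
  rewrite (updN _ _ nx) => lx.
  have [h1 h2 h3] := r1 x lx; have [_ _ h4] := i1 x lx.
  have E : dlab c x != (dcnt c).+1 by lia.
  by rewrite (updN _ _ E); split=> //; rewrite updN ?h1 // ne // h1.
- move=> j le lt Hj; rewrite /upd; case: (eqVneq (nth 0 ord j) r) => // /eqP nj.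
  case: (leqP (didx c) j) => h; first exact: i9.
  by case: nj; congr nth; lia.
- by lia.
Qed.

Lemma path_stack_reach v r x : path (fun a b => hedge b a) v r -> x \in v :: r ->
  reach x v.
Proof.
elim: r v => [|w r IH] v /=; first by rewrite inE => _ /eqP->; apply: reach_refl.
move=> /andP[wv pr]; rewrite inE => /predU1P[->|xr]; first exact: reach_refl.
by apply: reach_trans (IH _ pr xr) _; apply: reach1.
Qed.

Definition dfs_finish (c : dfs_conf) (v : nat) (r : seq nat) : dfs_conf :=
  DfsConf (dlab c) (dptr c) r (rcons (dfin c) v) (dcnt c) (didx c).

Lemma dfs_inv_finish c v r : dfs_inv c -> dstk c = v :: r -> dptr c v = [::] ->
  dfs_inv (dfs_finish c v r).
Proof.
case=> i1 i2 i3 i4 i5 i6 i7 i8 [rt r1 r2] i9 i10 e0 pv.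
rewrite e0 /= in i2 i3 i4 i7 r2.
have vs x : (x \in r ++ rcons (dfin c) v) = (dlab c x != 0).
  by rewrite -i3 !mem_cat mem_rcons !inE mem_cat; do !case: (_ \in _); rewrite ?orbT ?orbF.
have [nv u2] := andP i2.
have vf : v \notin dfin c by move: nv; rewrite mem_cat negb_or => /andP[].
have done' x : x \in rcons (dfin c) v -> dptr c x = [::].
  by rewrite mem_rcons inE => /predU1P[->|/i6].
have srt : sorted (fun a b => hedge b a) r by case: (r) i4 => //= w r' /andP[].
have closed x y : x \in rcons (dfin c) v -> hedge x y -> dlab c y != 0.
  move=> xf /and3P[Hx Hy yx].
  have lx : dlab c x != 0 by rewrite -vs mem_cat xf orbT.
  have [pre E /(_ y)] := i5 x lx; move: yx; rewrite E done' // cats0 => -> /(_ isT Hy).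
  by case/andP; rewrite lt0n.
(* Successors of finished nodes have been visited, so a path leaves the finished nodes only through
   the stack. *)
have gray x y : x \in rcons (dfin c) v -> reach x y -> y \notin rcons (dfin c) v ->
    exists2 g, g \in r & reach x g.
  move=> xf xy yf.
  have [a [b [af bf xa ab _]]] := reach_exit (P := mem (rcons (dfin c) v)) xf yf xy.
  exists b; last by apply: reach_trans xa _; apply: reach1.
  by have := closed _ _ af ab; rewrite -vs mem_cat; case/orP => // h; rewrite /= h in bf.
have gv g : g \in r -> reach g v.
  by move=> gr; apply: path_stack_reach i4 _; rewrite inE gr orbT.
(* Members of the component of [v] find their witness here: a stack node that they reach and that
   reaches [v], or else [v] itself, which finishes last. *)
have sccv x : x \in rcons (dfin c) v -> reach x v -> reach v x ->
    settled_scc (dfs_finish c v r) x.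
  move=> xf xv vx.
  case: (classic (exists2 y, reach x y & y \notin rcons (dfin c) v)) => [[y xy yf]|all].
    have [g gr xg] := gray _ _ xf xy yf.
    left; exists g; split=> //; apply: reach_trans (gv _ gr) vx.
  right; exists v; split=> // y xy /=.
  have yf : y \in rcons (dfin c) v.
    by apply/negPn/negP => yf; apply: all; exists y.
  split=> //; rewrite -cats1 !index_cat (negbTE vf) /= eqxx addn0.
  by case: ifP => [|yf']; rewrite ?index_size // ; move: yf;
    rewrite mem_rcons inE yf' orbF => /eqP->; rewrite eqxx addn0.
split=> //=.
- by rewrite -cats1 catA cats1 rcons_uniq nv.
- by move=> x xr; apply: i7; rewrite inE xr orbT.
- move=> x xf; case: (eqVneq x v) => [->|xv].
    by apply: sccv; rewrite ?mem_rcons ?inE ?eqxx //; apply: reach_refl.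
  have xf0 : x \in dfin c by move: xf; rewrite mem_rcons inE (negbTE xv).
  have [[g []]|[z [h1 h2 h3]]] := i8 x xf0.
    rewrite e0 inE => /predU1P[-> xg gx|gr xg gx]; first exact: sccv.
    by left; exists g.
  right; exists z; split=> // y /[dup] /h3[yf le] xy /=.
  have [zf _] := h3 z h1.
  by rewrite mem_rcons inE yf orbT -cats1 !index_cat yf zf.
- by exists rt => // h; apply: r2.
Qed.

Lemma dfs_adj_step c v y l : dfs_inv c -> v \in dstk c -> dptr c v = y :: l ->
  exists2 pre, adj v = rcons pre y ++ l &
    forall z, z \in pre -> H z -> 0 < dlab c z <= dlab c v.
Proof.
move=> I vs pv; have lv : dlab c v != 0 by rewrite -(di_mem I) mem_cat vs.
have [pre E pl] := di_adj I lv; exists pre => //.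
by rewrite E pv cat_rcons.
Qed.

Definition dfs_next (c : dfs_conf) (v : nat) (l : seq nat) : dfs_conf :=
  DfsConf (dlab c) (upd (dptr c) v l) (dstk c) (dfin c) (dcnt c) (didx c).

Lemma dfs_inv_next c v y r l : dfs_inv c -> dstk c = v :: r -> dptr c v = y :: l ->
  ~~ (H y && (dlab c y == 0)) -> dfs_inv (dfs_next c v l).
Proof.
move=> I e0 pv hy; have vs : v \in dstk c by rewrite e0 inE eqxx.
have [pre E pl] := dfs_adj_step I vs pv.
case: (I) => i1 i2 i3 i4 i5 i6 i7 i8 i9 i10 i11.
split=> //= x; last first.
  move=> xf; case: (eqVneq x v) => [xv|nx]; last by rewrite updN // i6.
  by have := i6 x xf; rewrite xv pv.
move=> lx; case: (eqVneq x v) => [->|nx]; last first.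
  by rewrite updN //; apply: i5.
rewrite updx; exists (rcons pre y) => // z; rewrite mem_rcons inE.
move=> /predU1P[->|/pl//] Hy; move: hy; rewrite Hy /= -lt0n => ly; rewrite ly /=.
by rewrite (i7 v vs); have [] := i1 y; rewrite -?lt0n.
Qed.

Definition dfs_push (c : dfs_conf) (v w : nat) (l : seq nat) : dfs_conf :=
  dfs_visit c w (dcnt c) (upd (dptr c) v l).

Lemma dfs_inv_push c v w r l : dfs_inv c -> dstk c = v :: r -> dptr c v = w :: l ->
  H w -> dlab c w = 0 -> dfs_inv (dfs_push c v w l).
Proof.
move=> I e0 pv Hw lw; have vs : v \in dstk c by rewrite e0 inE eqxx.
have [pre E pl] := dfs_adj_step I vs pv.
case: (I) => i1 i2 i3 i4 i5 i6 i7 i8 [rt r1 r2] i10 i11.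
have wadj : w \in adj v by rewrite E mem_cat mem_rcons inE eqxx.
have lv : dlab c v != 0 by rewrite -i3 mem_cat vs.
have [Hv vn lvc] := i1 v lv.
have vw : hedge v w by rewrite /hedge Hv Hw wadj.
have ne x : dlab c x != 0 -> x != w by apply: contraNneq => ->; rewrite lw.
have wn := adj_lt wadj.
have s0 : dstk c != [::] by rewrite e0.
have c0 : dcnt c != 0 by rewrite -(i7 v vs).
(* All nodes of index at least [didx c] that may be visited have been, so a fresh node precedes the
   current root. *)
have wi : index w ord < didx c.
  rewrite ltnNge; apply/negP => le; have wo := ord_all wn Hw.
  by have := i10 _ le; rewrite index_mem nth_index // lw => /(_ wo Hw).
split; rewrite /dfs_push //=.
- by move=> x; case: (eqVneq x w) => [-> _|nx]; rewrite ?updx ?updN //; apply: i1.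
- by rewrite i2 andbT i3 lw.
- move=> x; rewrite inE i3; case: (eqVneq x w) => [->|nx] /=; rewrite ?updx ?updN //.
- by rewrite e0 /= vw; move: i4; rewrite e0.
- move=> x; case: (eqVneq x w) => [-> _|nx]; first by exists [::]; rewrite // updx.
  rewrite (updN _ _ nx) (updN _ _ nx) => lx.
  case: (eqVneq x v) => [->|nv].
    rewrite updx; exists (rcons pre w) => // z; rewrite mem_rcons inE.
    case: (eqVneq z w) => [-> _ _|nz /= zp Hz]; first by rewrite updx (i7 v vs) lt0n c0 leqnn.
    by rewrite (updN _ _ nz) pl.
  rewrite (updN _ _ nv); have [pre' E' pl'] := i5 x lx; exists pre' => // z zp Hz.
  have /andP[h1 h2] := pl' z zp Hz.
  by rewrite updN ?h1 // ne // -lt0n.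
- move=> x xf; have lx : dlab c x != 0 by rewrite -i3 mem_cat xf orbT.
  rewrite updN ?ne //; case: (eqVneq x v) => [xv|nv]; last by rewrite updN // i6.
  by have := i6 x xf; rewrite xv pv.
- move=> x; rewrite inE; case: (eqVneq x w) => [->|nx] /=; rewrite ?updx ?updN //.
  exact: i7.
- move=> x /i8[[g [h1 h2 h3]]|[z [h1 h2 h3]]].
    by left; exists g; split=> //=; rewrite inE h1 orbT.
  by right; exists z.
- exists rt => [x|_]; last exact: r2.
  case: (eqVneq x w) => [->|nx]; last first.
    rewrite (updN _ _ nx) => lx /=; have [h1 h2 h3] := r1 x lx.
    by split=> //; rewrite updN // ne // h1.
  rewrite updx => _ /=; have [h1 h2 h3] := r1 v lv.
  rewrite (i7 v vs) in h1 h2 h3.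
  split; first by rewrite updN // ne // h1.
    by apply: reach_trans h2 _; apply: reach1.
  by apply: leq_trans (ltnW wi) _; apply: r2.
- move=> j le lt Hj; case: (eqVneq (nth 0 ord j) w) => [->|nw].
    by rewrite updx.
  by rewrite updN // i10.
Qed.

Definition dfs_done (c : dfs_conf) : bool := (didx c == 0) && (dstk c == [::]).

Record dfs_post (lab : nat -> nat) (fin : seq nat) : Prop := DfsPost {
  dp_lab : forall x, lab x != 0 -> [/\ H x, x < n & lab x <= n];
  dp_vis : forall x, x < n -> H x -> lab x != 0;
  dp_uniq : uniq fin;
  dp_mem : forall x, (x \in fin) = (lab x != 0);
  dp_mono : forall x y, x < n -> hedge x y -> lab y <= lab x;
  dp_scc : forall x, x \in fin -> exists z, [/\ reach x z, reach z x &
     forall y, reach x y -> index y fin <= index z fin];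
  dp_root : exists rt : nat -> nat, forall x, lab x != 0 ->
     [/\ lab (rt (lab x)) = lab x, reach (rt (lab x)) x &
         index x ord <= index (rt (lab x)) ord] }.

Lemma dfs_finished c : dfs_inv c -> dfs_done c -> dfs_post (dlab c) (dfin c).
Proof.
move=> I /andP[/eqP c0 /eqP e0].
have cn : dcnt c <= n.
  apply: leq_trans (leq_trans (leq_addr _ _) (di_le I)) _.
  rewrite -(size_iota 0 n); apply: uniq_leq_size => // x /ord_lt.
  by rewrite mem_iota.
case: (I) => i1 i2 i3 i4 i5 i6 i7 i8 [rt r1 r2] i10 i11.
rewrite e0 /= in i2 i3.
have vis x : x < n -> H x -> dlab c x != 0.
  move=> xn Hx; have xo := ord_all xn Hx.
  have := i10 (index x ord); rewrite c0 index_mem nth_index //.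
  exact.
split=> //.
- by move=> x /i1[h1 h2 h3]; split=> //; apply: leq_trans cn.
- move=> x y xn /and3P[Hx Hy yx]; have lx := vis x xn Hx.
  have [pre E pl] := i5 x lx; rewrite i6 ?i3 // cats0 in E.
  by rewrite E in yx; have /andP[] := pl y yx Hy.
- move=> x /i8[[g []]|[z [h1 h2 h3]]]; first by rewrite e0.
  by exists z; split=> // y /h3[].
- by exists rt.
Qed.

End Dfs.

Section DfsPotential.
Variables (n : nat) (adj : nat -> seq nat).

Lemma sum_change (F F' : nat -> nat) v : v < n -> (forall x, x != v -> F' x = F x) ->
  \sum_(x < n) F' x + F v = \sum_(x < n) F x + F' v.
Proof.
move=> vn h; rewrite (bigD1 (Ordinal vn)) // [in RHS](bigD1 (Ordinal vn)) //=.
rewrite (eq_bigr (fun x : 'I_n => F x)); first by lia.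
by move=> i iv; apply: h.
Qed.

(** Decreases in every round of the search. An unvisited node holds 2 beyond its edges: one for its
    visit and one for its removal from the stack. *)
Definition dfs_phi (c : dfs_conf) : nat :=
  didx c + size (dstk c) +
  \sum_(x < n) (if dlab c x != 0 then size (dptr c x) else 2 + size (adj x)).

Lemma dfs_phi_visit (c : dfs_conf) x k p : x < n -> dlab c x = 0 -> k != 0 ->
  dfs_phi (dfs_visit adj c x k p) + 1 =
  dfs_phi (DfsConf (dlab c) p (dstk c) (dfin c) (dcnt c) (didx c)).
Proof.
move=> xn lx k0; rewrite /dfs_phi /=.
set F := fun x => if dlab c x != 0 then size (p x) else 2 + size (adj x).
set F' := fun z => if upd (dlab c) x k z != 0 then size (upd p x (adj x) z)
                   else 2 + size (adj z).
have := @sum_change F F' x xn; rewrite /F /F' !updx lx k0 /= => E.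
by apply: (fun h => (fun e => _) (E h)) => [e|z nz]; rewrite ?updN //; lia.
Qed.

Lemma dfs_phi_next (c : dfs_conf) v l y : v < n -> dlab c v != 0 -> dptr c v = y :: l ->
  dfs_phi (dfs_next c v l) + 1 = dfs_phi c.
Proof.
move=> vn lv pv; rewrite /dfs_phi /=.
set F := fun x => if dlab c x != 0 then size (dptr c x) else 2 + size (adj x).
set F' := fun z => if dlab c z != 0 then size (upd (dptr c) v l z)
                   else 2 + size (adj z).
have := @sum_change F F' v vn; rewrite /F /F' updx lv pv /= => E.
by apply: (fun h => (fun e => _) (E h)) => [e|z nz]; rewrite ?updN //; lia.
Qed.

End DfsPotential.

(* Kosaraju: the second search follows the reversed edges and takes its roots in
   reverse order of the finishing times of the first one. *)
Lemma kosaraju n (H : pred nat) (adj adj' : nat -> seq nat) ord lab1 fin1 lab2 fin2 :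
  (forall x, H x -> x < n) ->
  (forall x y, H x -> H y -> (y \in adj x) = (x \in adj' y)) ->
  dfs_post n H adj ord lab1 fin1 -> dfs_post n H adj' fin1 lab2 fin2 ->
  forall x y, H x -> H y -> lab2 x = lab2 y -> reach (hedge H adj') x y.
Proof.
move=> Hn rev P1 P2; set R := reach (hedge H adj').
have he u v : hedge H adj u v = hedge H adj' v u.
  by rewrite /hedge andbCA; do 2 case: (boolP (H _)) => //= ?; rewrite rev.
have R1 u v : R v u -> reach (hedge H adj) u v by apply: reach_rev => ? ?; rewrite he.
have R2 u v : reach (hedge H adj) u v -> R v u by apply: reach_rev => ? ?; rewrite he.
have RH u v : H u -> R u v -> H v.
  move=> Hu [p]; elim: p u Hu => [|w p IH] u Hu /=; first by move=> _ <-.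
  by case/andP=> /and3P[_ Hw _]; apply: IH.
have mono u v : R u v -> H u -> lab2 v <= lab2 u.
  case=> p; elim: p u => [|w p IH] u /=; first by move=> _ ->.
  case/andP=> uw pw lw Hu; have Hw : H w by case/and3P: uw.
  exact: leq_trans (IH _ pw lw Hw) (dp_mono P2 (Hn _ Hu) uw).
have [rt rtP] := dp_root P2.
(* The root of the tree of [x] is the node [z] of the component of [x] that the first search
   finished last: the root is reachable from [x] and so did not finish later, while [z] lies in the
   tree, where the root has the largest index. *)
have toroot x : H x -> R x (rt (lab2 x)).
  move=> Hx; have xn := Hn x Hx.
  have [lr rx ix] := rtP x (dp_vis P2 xn Hx).
  have xf : x \in fin1 by rewrite (dp_mem P1) (dp_vis P1).
  have [z [xz zx zmax]] := dp_scc P1 xf.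
  have Hz : H z by apply: RH Hx (R2 _ _ zx).
  have lz : lab2 z = lab2 x.
    by apply/eqP; rewrite eqn_leq (mono _ _ (R2 _ _ zx)) // (mono _ _ (R2 _ _ xz)).
  have zf : z \in fin1 by rewrite (dp_mem P1) (dp_vis P1) // Hn.
  have [_ _ iz] := rtP z (dp_vis P2 (Hn _ Hz) Hz).
  rewrite lz in iz.
  have ii : index z fin1 = index (rt (lab2 x)) fin1.
    by apply/eqP; rewrite eqn_leq iz zmax //; apply: R1.
  suff <- : z = rt (lab2 x) by apply: R2.
  have rf : rt (lab2 x) \in fin1 by rewrite -index_mem -ii index_mem.
  by rewrite -(nth_index 0 zf) ii nth_index.
move=> x y Hx Hy lxy; apply: reach_trans (toroot x Hx) _.
by rewrite lxy; have [] := rtP y (dp_vis P2 (Hn _ Hy) Hy).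
Qed.

(* Depth-first search on the machine *)
Declare Scope prog_scope.
Delimit Scope prog_scope with prog.
Notation "a `+ b" := (Op Add a b) (at level 50, left associativity) : prog_scope.
Notation "a `- b" := (Op Defs.Sub a b) (at level 50, left associativity) : prog_scope.
Notation "a `* b" := (Op Mul a b) (at level 40, left associativity) : prog_scope.
Notation "a `/ b" := (Op Div a b) (at level 40, left associativity) : prog_scope.
Notation "a `< b" := (Op Lt a b) (at level 70) : prog_scope.
Notation "a `= b" := (Op Eq a b) (at level 70) : prog_scope.
Notation "a @[ e ]" := (Get a e) (at level 9, e at level 200, format "a @[ e ]") : prog_scope.
Notation "x <-- e" := (Assign x e) (at level 80) : prog_scope.
Notation "c1 ;; c2" := (Seq c1 c2) (at level 90, right associativity) : prog_scope.
Local Open Scope prog_scope.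

(** A linked list whose links are edge numbers plus one, so that 0 can mark the end. *)
Fixpoint chain (nx ep : nat -> nat) (e : nat) (l : seq nat) : Prop :=
  if l is y :: l' then [/\ e != 0, ep e.-1 = y & chain nx ep (nx e.-1) l']
  else e = 0.

(* Register 13 counts the roots in the array ord still to be tried, the last one
   first; the stack of height Reg 15 is in array 18, array 17 holds for each
   node its next arc, and Reg 16 numbers the trees.  Only nodes of priority at
   most Reg 11 are visited, and node x is labelled in cell x * d + Reg 12. *)
Definition dfs_fresh (lab : nat) (x : expr) : expr :=
  (1@[x] `< Reg 11 `+ Cst 1) `* (lab@[x `* Reg 2 `+ Reg 12] `= Cst 0).

Definition dfs_enter (hd lab x : nat) : cmd :=
  Put lab (Reg x `* Reg 2 `+ Reg 12) (Reg 16) ;;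
  Put 17 (Reg x) (hd@[Reg x]) ;;
  Put 18 (Reg 15) (Reg x) ;;
  15 <-- Reg 15 `+ Cst 1.

Definition dfs_body (hd nxt endp lab ord fin : nat) : cmd :=
  If (Reg 15 `= Cst 0)
    (13 <-- Reg 13 `- Cst 1 ;;
     17 <-- ord@[Reg 13] ;;
     If (dfs_fresh lab (Reg 17))
       (16 <-- Reg 16 `+ Cst 1 ;; dfs_enter hd lab 17)
       Skip)
    (17 <-- 18@[Reg 15 `- Cst 1] ;;
     18 <-- 17@[Reg 17] ;;
     If (Reg 18 `= Cst 0)
       (15 <-- Reg 15 `- Cst 1 ;;
        Put fin (Reg 14) (Reg 17) ;;
        14 <-- Reg 14 `+ Cst 1)
       (Put 17 (Reg 17) (nxt@[Reg 18 `- Cst 1]) ;;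
        19 <-- endp@[Reg 18 `- Cst 1] ;;
        If (dfs_fresh lab (Reg 19)) (dfs_enter hd lab 19) Skip)).

Definition dfs_prog (hd nxt endp lab ord fin : nat) : cmd :=
  14 <-- Cst 0 ;; 15 <-- Cst 0 ;; 16 <-- Cst 0 ;;
  While (Reg 13 `+ Reg 15) (dfs_body hd nxt endp lab ord fin).

Section DfsProg.
Variables (W N : nat).
Hypothesis WN : fits W N.
Variables (hd nxt endp lab ord fin : nat).
Hypothesis fresh_arrs :
  all (fun a => a \notin [:: lab; fin; 17; 18]) [:: 1; ord; hd; nxt; endp].
Hypothesis uniq_arrs : uniq [:: lab; fin; 17; 18].
Variables (n d q o : nat) (pr : nat -> nat) (adj : nat -> seq nat) (ordl : seq nat).
Hypothesis (nN : n.+1 < N) (od : o < d).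
Hypothesis adj_lt : forall x y, y \in adj x -> y < n.
Hypothesis ord_uniq : uniq ordl.
Hypothesis ord_lt : forall x, x \in ordl -> x < n.
Definition level_set (n q : nat) (pr : nat -> nat) : pred nat :=
  fun x => (x < n) && (pr x <= q).
Local Notation H := (level_set n q pr).
Hypothesis ord_all : forall x, x < n -> H x -> x \in ordl.

(** A single rewrite rule for the comparisons of array numbers that stores leave behind. *)
Lemma neqs : ((1 == lab = false) * (1 == fin = false)
  * (ord == lab = false) * (ord == fin = false) * (ord == 17 = false) * (ord == 18 = false)
  * (hd == lab = false) * (hd == fin = false) * (hd == 17 = false) * (hd == 18 = false)
  * (nxt == lab = false) * (nxt == fin = false) * (nxt == 17 = false) * (nxt == 18 = false)
  * (endp == lab = false) * (endp == fin = false) * (endp == 17 = false) * (endp == 18 = false)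
  * (lab == fin = false) * (lab == 17 = false) * (lab == 18 = false)
  * (fin == lab = false) * (fin == 17 = false) * (fin == 18 = false)
  * (17 == lab = false) * (17 == fin = false)
  * (18 == lab = false) * (18 == fin = false))%type.
Proof.
have A a b : a \in [:: 1; ord; hd; nxt; endp] -> b \in [:: lab; fin; 17; 18] ->
    (a == b) = false.
  by move=> /(allP fresh_arrs) h1 h2; apply: contraNF h1 => /eqP->.
have := uniq_arrs; rewrite /= !inE !negb_or !andbT.
case/andP=> /and3P[h1 h2 h3] /andP[h4 h5].
do !split; first [by apply: A; rewrite !inE ?eqxx ?orbT | exact/negbTE |
  by rewrite eq_sym; apply/negbTE].
Qed.

Record dfs_static (s : state) : Prop := DfsStatic {
  ds_d : reg s 2 = d; ds_q : reg s 11 = q; ds_o : reg s 12 = o;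
  ds_pr : forall x, x < n -> arr s 1 x = pr x;
  ds_ord : forall k, k < size ordl -> arr s ord k = nth 0 ordl k;
  ds_hd : forall x, x < n -> chain (arr s nxt) (arr s endp) (arr s hd x) (adj x) }.

Record dfs_rep (s : state) (c : dfs_conf) : Prop := DfsRep {
  dr_static : dfs_static s;
  dr_idx : reg s 13 = didx c; dr_nfin : reg s 14 = size (dfin c);
  dr_sp : reg s 15 = size (dstk c); dr_cnt : reg s 16 = dcnt c;
  dr_lab : forall x, x < n -> arr s lab (x * d + o) = dlab c x;
  dr_ptr : forall x, dlab c x != 0 ->
    chain (arr s nxt) (arr s endp) (arr s 17 x) (dptr c x);
  dr_stk : forall k, k < size (dstk c) -> arr s 18 k = nth 0 (rev (dstk c)) k;
  dr_fin : forall k, k < size (dfin c) -> arr s fin k = nth 0 (dfin c) k }.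

Local Notation Inv := (dfs_inv n H adj ordl).

Lemma lab_index x y : (x * d + o == y * d + o) = (x == y).
Proof. by rewrite eqn_add2r eqn_pmul2r //; apply: leq_ltn_trans od. Qed.


Lemma dfs_stk_lt c x : Inv c -> x \in dstk c -> x < n.
Proof.
move=> I xs; have lx : dlab c x != 0 by rewrite -(di_mem I) mem_cat xs.
by have [] := di_lab I lx.
Qed.

Lemma dfs_size_le c : Inv c -> size (dstk c) + size (dfin c) <= n.
Proof.
move=> I; rewrite -size_cat -(size_iota 0 n); apply: uniq_leq_size (di_uniq I) _.
move=> x; rewrite (di_mem I) => lx; have [_ xn _] := di_lab I lx.
by rewrite mem_iota.
Qed.

Lemma dfs_ord_le : size ordl <= n.
Proof.
by rewrite -(size_iota 0 n); apply: uniq_leq_size => // x /ord_lt; rewrite mem_iota.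
Qed.

Lemma dfs_cnt_le c : Inv c -> dcnt c <= n.
Proof.
by move=> I; apply: leq_trans (leq_trans (leq_addr _ _) (di_le I)) dfs_ord_le.
Qed.

Lemma dfs_freshE s c x : dfs_rep s c -> x < n ->
  (arr s 1 x < q + 1) * (arr s lab (x * d + o) == 0) = (H x && (dlab c x == 0)).
Proof.
move=> R xn; rewrite (ds_pr (dr_static R)) // (dr_lab R) // addn1 ltnS.
by rewrite mulnb /level_set xn.
Qed.

(** The array [lab] also holds the columns of other levels, so a search must write to column [o]
    only. *)
Definition dfs_same (s0 s : state) : Prop :=
  forall i, (forall x, x < n -> i != x * d + o) -> arr s lab i = arr s0 lab i.

Lemma dfs_enter_ok s0 s c w xr : bounded N s -> dfs_rep s c -> dfs_same s0 s ->
  w < n -> reg s xr = w -> xr != 15 -> size (dstk c) < n -> dcnt c <= n ->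
  wp W N (dfs_enter hd lab xr) s (fun t s' =>
    [/\ dfs_rep s' (dfs_visit adj c w (dcnt c) (dptr c)), dfs_same s0 s' & t <= 30]).
Proof.
move=> bs R S wn rw xr15 sn cn; have ne := neqs.
have [st ri rf rs rc rl rp rk rfi] := R.
have [sd sq so spr sord shd] := st.
apply: wp_seq; apply: (wp_put WN) => //=; first by rewrite rc; lia.
apply: wp_seq; apply: (wp_put WN) => //=; rewrite ?ne ?eqxx /=; first exact: bs.2.
apply: wp_seq; apply: (wp_put WN) => //=; first by rewrite rw; lia.
apply: (wp_assign WN) => //=; first by rewrite rs; lia.
rewrite rw sd so rc rs addn1; split=> //=.
- split=> //=; rewrite ?ne //.
  + split=> //= x xn; rewrite ?ne ?eqxx //=; first exact: spr.
    * by rewrite ?ne ?eqxx /=; apply: sord.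
    * exact: shd.
  + move=> x xn; rewrite ?ne ?eqxx /= lab_index /upd.
    by case: eqP => // _; apply: rl.
  + move=> x; rewrite /upd ?ne /=; case: (eqVneq x w) => [_|_] lx.
      exact: shd.
    exact: rp.
  + move=> k; rewrite ltnS leq_eqVlt => /predU1P[->|kl].
      by rewrite eqxx rev_cons nth_rcons size_rev ltnn eqxx.
    by rewrite (ltn_eqF kl) ?ne /= rk // rev_cons nth_rcons size_rev kl.
- move=> i hi; rewrite /= ?ne ?eqxx /= (negbTE (hi w wn)); exact: S.
Qed.

Lemma dfs_body_ok s0 s c : bounded N s -> Inv c -> dfs_rep s c -> dfs_same s0 s ->
  didx c + size (dstk c) != 0 ->
  wp W N (dfs_body hd nxt endp lab ord fin) s (fun t s' =>
    exists c', [/\ Inv c', dfs_rep s' c', dfs_same s0 s', t <= 90 &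
      dfs_phi n adj c' < dfs_phi n adj c]).
Proof.
move=> bs I R S nz; have ne := neqs.
have [st ri rf rs rc rl rp rk rfi] := R.
have [sd sq so spr sord shd] := st.
have sz := dfs_size_le I; have cn := dfs_cnt_le I.
rewrite /dfs_body; apply: (wp_if WN) => //=; rewrite rs => E.
  have e0 : dstk c = [::] by case: (dstk c) E => //; rewrite eqb0 eqxx.
  have k0 : didx c != 0 by move: nz; rewrite e0 addn0.
  have ile : (didx c).-1 < size ordl by have := di_le I; lia.
  set r := nth 0 ordl (didx c).-1.
  have rn : r < n by apply: ord_lt; apply: mem_nth.
  apply: wp_seq; apply: (wp_assign WN) => //=; first by have := bs.1 13; lia.
  apply: wp_seq; apply: (wp_assign WN) => //=; rewrite ri subn1 sord // -/r; first by lia.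
  apply: (wp_if WN) => //=; rewrite ?ne ?eqxx /= ?sq ?sd ?so (dfs_freshE R) // ?eqb0 ?negbK => fr.
    have [Hr /eqP lr] := andP fr.
    apply: wp_seq; apply: (wp_assign WN) => //=; first by rewrite rc; lia.
    rewrite rc addn1.
    (* The count is already raised for the tree that [dfs_enter] is about to open, so [c1] itself
       need not satisfy the invariant. *)
    pose c1 := DfsConf (dlab c) (dptr c) [::] (dfin c) (dcnt c).+1 (didx c).-1.
    apply: wp_bounded => bs1.
    apply: wp_mono (@dfs_enter_ok s0 _ c1 r 17 bs1 _ _ rn _ _ _ _) => //=.
    + move=> t s' [R' S' t30]; exists (dfs_root adj ordl c); split=> //.
      * exact: dfs_inv_root.
      * by move: R'; rewrite /dfs_root /dfs_skip /= /c1 /dfs_visit /= e0.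
      * by lia.
      * have := dfs_phi_visit adj (c := c1) (dptr c) rn lr (isT : (dcnt c).+1 != 0).
        rewrite /dfs_root /dfs_skip /dfs_visit /dfs_phi /= e0 /= -/r; lia.
    + split=> //=; rewrite ?e0 //=; first by rewrite rs e0.
    + by lia.
    + by have := di_le I; have := dfs_ord_le; move: k0; clear; lia.
  apply: (wp_skip); exists (dfs_skip c); split=> //=.
  + by apply: dfs_inv_skip => //; move: fr; rewrite -/r; case: (_ && _).
  + by rewrite /dfs_phi /dfs_skip /=; lia.
have s0' : size (dstk c) != 0 by case: (size _) E.
case e0 : (dstk c) => [|v r]; first by rewrite e0 in s0'.
have vs : v \in dstk c by rewrite e0 inE eqxx.
have vn := dfs_stk_lt I vs.
have lv : dlab c v != 0 by rewrite -(di_mem I) mem_cat vs.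
rewrite e0 /= in rs.
have top : arr s 18 (size r) = v.
  by rewrite rk e0 //= rev_cons nth_rcons size_rev ltnn eqxx.
apply: wp_seq; apply: (wp_assign WN) => //=; rewrite rs subn1 top; first by lia.
apply: wp_seq; apply: (wp_assign WN) => //=; first exact: bs.2.
have cv := rp v lv.
apply: (wp_if WN) => //=; set e := arr s 17 v => E2.
  have pv : dptr c v = [::].
    case: (dptr c v) cv => //= y l [] /negbTE; rewrite -/e => h.
    by move: E2; rewrite h.
  apply: wp_seq; apply: (wp_assign WN) => //=; first by have := bs.1 15; lia.
  apply: wp_seq; apply: (wp_put WN) => //=; first by lia.
  apply: (wp_assign WN) => //=; first by rewrite rf; have := sz; lia.
  exists (dfs_finish c v r); split=> //=.
  + exact: dfs_inv_finish.
  + split=> //=; rewrite ?ne ?eqxx //=; rewrite ?rf ?rs ?size_rcons ?addn1 ?subn1 //.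
    * by split=> //= x xn; rewrite ?ne ?eqxx //=; first [exact: spr | exact: sord | exact: shd].
    * by move=> k kr; rewrite ?ne ?eqxx /= rk e0 /= ?rev_cons ?nth_rcons ?size_rev ?kr // ltnW.
    * move=> k; rewrite ltnS nth_rcons leq_eqVlt => /predU1P[->|kl].
        by rewrite !eqxx ltnn.
      by rewrite (ltn_eqF kl) kl; apply: rfi.
  + by move=> i hi; rewrite /= ?ne ?eqxx /=; apply: S.
  + by rewrite /dfs_phi /dfs_finish /= e0 /=; lia.
case pv : (dptr c v) => [|w l].
  by move: cv; rewrite pv /= -/e => h; move: E2; rewrite h.
move: cv; rewrite pv /= -/e => -[e1 ew cl].
have wn : w < n.
  have [pre Ea _] := dfs_adj_step I vs pv; apply: (adj_lt (x := v)).
  by rewrite Ea mem_cat mem_rcons inE eqxx.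
apply: wp_seq; apply: (wp_put WN) => //=; first exact: bs.2.
apply: wp_seq; apply: (wp_assign WN) => //=; rewrite subn1 ?ne /= ew; first by lia.
have R1 : dfs_rep (set_reg (set_arr (set_reg (set_reg s 17 v) 18 e) 17 v
    (arr s nxt e.-1)) 19 w) (dfs_next c v l).
  split=> //=; rewrite ?ne ?eqxx //=; rewrite ?rs ?e0 //=.
  * by split=> //= x xn; rewrite ?ne ?eqxx //=; first [exact: spr | exact: sord | exact: shd].
  * by move=> x lx; rewrite /upd; case: eqP => // _; apply: rp.
have S1 : dfs_same s0 (set_reg (set_arr (set_reg (set_reg s 17 v) 18 e) 17 v
    (arr s nxt e.-1)) 19 w).
  by move=> i hi; rewrite /= ?ne /=; apply: S.
have phi1 := dfs_phi_next adj vn lv pv.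
apply: (wp_if WN) => //=; rewrite ?ne ?eqxx /= ?sq ?sd ?so (dfs_freshE R) // ?eqb0 ?negbK => fr.
  have [Hw /eqP lw] := andP fr.
  apply: wp_bounded => bs1.
  apply: wp_mono (@dfs_enter_ok s0 _ _ w 19 bs1 R1 S1 wn _ _ _ _) => //=.
  + move=> t s' [R' S' t30]; exists (dfs_push adj c v w l); split=> //.
    * exact: dfs_inv_push e0 pv Hw lw.
    * by lia.
    * have c0 : dcnt c != 0 by rewrite -(di_top I vs).
      have := dfs_phi_visit adj (c := dfs_next c v l) (dptr (dfs_next c v l)) wn lw c0.
      rewrite /dfs_push /dfs_visit /dfs_phi /= in phi1 *; lia.
  + have u : uniq (w :: dstk c ++ dfin c) by rewrite /= (di_uniq I) (di_mem I) lw.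
    have : size (w :: dstk c ++ dfin c) <= size (iota 0 n).
      apply: uniq_leq_size u _ => x; rewrite inE mem_iota => /predU1P[->//|].
      by rewrite (di_mem I) => lx; have [] := di_lab I lx.
    by rewrite /= size_cat size_iota; lia.
apply: (wp_skip); exists (dfs_next c v l); split=> //=.
+ by apply: dfs_inv_next e0 pv _; move: fr; case: (_ && _).
+ by lia.
Qed.

Lemma dfs_prog_ok s : bounded N s -> dfs_static s -> reg s 13 = size ordl ->
  (forall x, x < n -> arr s lab (x * d + o) = 0) ->
  wp W N (dfs_prog hd nxt endp lab ord fin) s (fun t s' =>
    exists L F, [/\ dfs_post n H adj ordl L F,
      [/\ forall x, x < n -> arr s' lab (x * d + o) = L x,
          (forall k, k < size F -> arr s' fin k = nth 0 F k) & reg s' 14 = size F],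
      dfs_same s s' & t <= 100 * (1 + 3 * n + \sum_(x < n) size (adj x))]).
Proof.
move=> bs st r13 lab0.
do 3 (apply: wp_seq; apply: (wp_assign WN) => //=).
set s1 := set_reg _ _ _.
pose I k s' := exists c, [/\ Inv c, dfs_rep s' c, dfs_same s s' & k = 100 * dfs_phi n adj c].
apply: (wp_while WN (I := I) (k0 := 100 * dfs_phi n adj (dfs_start (size ordl)))) => //=.
- exists (dfs_start (size ordl)); split=> //.
  + exact: dfs_inv_start.
  + by split=> //; case: st.
- move=> k s2 bs2 [c [Ic R S ->]]; rewrite (dr_idx R) (dr_sp R) => nz.
  apply: wp_mono (dfs_body_ok bs2 Ic R S nz) => t s3 [c' [I' R' S' t90 lt]].
  by exists (100 * dfs_phi n adj c') => //; [exists c' | move: lt t90; clear; lia].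
- move=> t k s2 [c [Ic R S ->]]; rewrite (dr_idx R) (dr_sp R) => z le.
  have [z1 z2] : didx c = 0 /\ size (dstk c) = 0 by move: z; clear; lia.
  have dn : dfs_done c by rewrite /dfs_done z1 -size_eq0 z2.
  exists (dlab c), (dfin c); split=> //.
  + exact: dfs_finished.
  + by split; [exact: dr_lab R | exact: dr_fin R | exact: dr_nfin R].
  + have so := dfs_ord_le.
    have E : dfs_phi n adj (dfs_start (size ordl)) =
        size ordl + (2 * n + \sum_(x < n) size (adj x)).
      by rewrite /dfs_phi /= big_split /= sum_nat_const card_ord addn0 mulnC.
    rewrite E in le; move: le so; clear; move: (\sum_(x < n) _); lia.
Qed.

End DfsProg.

(** * Preparing the input *)

(** Each 4 is the price of one loop test, the last one being the test that fails. *)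
Lemma wp_for W N (WN : fits W N) (J : nat -> state -> Prop) (c : nat -> nat)
    (x b hi : nat) body s (Q : nat -> state -> Prop) :
  J 0 s ->
  (forall i s1, J i s1 -> reg s1 x = i /\ reg s1 b = hi) ->
  (forall i s1, bounded N s1 -> i < hi -> J i s1 ->
     wp W N body s1 (fun t s2 => J i.+1 s2 /\ t <= c i)) ->
  (forall t s1, J hi s1 -> t <= \sum_(i < hi) (c i + 4) + 4 -> Q t s1) ->
  wp W N (While (Reg x `< Reg b) body) s Q.
Proof.
move=> J0 Jr step fin.
pose I k s1 := exists i, [/\ J i s1, i <= hi & k = \sum_(i <= j < hi) (c j + 4)].
apply: (wp_while WN (I := I) (k0 := \sum_(0 <= j < hi) (c j + 4))) => //=.
- by exists 0.
- move=> k s1 bs [i [Ji ihi ->]]; have [-> ->] := Jr _ _ Ji.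
  case: ltnP => // lt _; apply: wp_mono (step _ _ bs lt Ji) => t s2 [J2 le].
  exists (\sum_(i.+1 <= j < hi) (c j + 4)); first by exists i.+1.
  by rewrite [in leqRHS]big_ltn // leq_add2r; move: le; clear; lia.
- move=> t k s1 [i [Ji ihi ->]]; have [-> ->] := Jr _ _ Ji.
  case: ltnP => // ge _ le; have E : i = hi by apply/eqP; rewrite eqn_leq ihi.
  apply: fin; first by rewrite -E.
  by rewrite -(big_mkord xpredT (fun j => c j + 4)); move: le; rewrite E big_geq // addn0.
Qed.

(** Links point to earlier edges only, so a list whose first link is at most [k] ignores the cells
    from [k] on. This lets the lists of several nodes grow inside one array. *)
Lemma chain_eq nx nx' ep ep' k e l : (forall i, i < k -> nx i <= i) -> e <= k ->
  (forall i, i < k -> nx' i = nx i) -> (forall i, i < k -> ep' i = ep i) ->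
  chain nx ep e l -> chain nx' ep' e l.
Proof.
move=> le + nn ee; elim: l e => [|y l IH] e //= ek [e0 <- cl].
have lt : e.-1 < k by move: e0 ek; clear; lia.
rewrite ee // nn //; split=> //; apply: IH => //.
by apply: leq_trans (le _ lt) _; apply: ltnW.
Qed.

Lemma chain_ext nx nx' ep ep' e l : nx =1 nx' -> ep =1 ep' ->
  chain nx ep e l -> chain nx' ep' e l.
Proof.
move=> nn ee; elim: l e => [|y l IH] e //= [e0 <- cl].
by split=> //; rewrite -nn; apply: IH.
Qed.

Definition adj_upto (P : pred nat) (src dst : nat -> nat) (k v : nat) : seq nat :=
  [seq dst e | e <- rev (iota 0 k) & P e && (src e == v)].

Lemma adj_uptoS P src dst k v : adj_upto P src dst k.+1 v =
  if P k && (src k == v) then dst k :: adj_upto P src dst k v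
  else adj_upto P src dst k v.
Proof.
rewrite /adj_upto -addn1 iotaD rev_cat /= add0n.
by case: (P k && _).
Qed.

Lemma mem_adj_upto (P : pred nat) (src dst : nat -> nat) k v y :
  reflect (exists e, [/\ e < k, P e, src e = v & dst e = y]) (y \in adj_upto P src dst k v).
Proof.
apply: (iffP mapP) => [[e]|[e [ek Pe sv dy]]].
  rewrite mem_filter mem_rev mem_iota => /andP[/andP[Pe /eqP sv] /= ek] ->.
  by exists e.
by exists e; rewrite ?dy // mem_filter Pe sv eqxx mem_rev mem_iota.
Qed.

Lemma sum_adj_upto n P src dst k : \sum_(v < n) size (adj_upto P src dst k v) <= k.
Proof.
elim: k => [|k IH]; first by rewrite big1.
under eq_bigr do rewrite adj_uptoS.
have : \sum_(v < n) size (adj_upto P src dst k v) + \sum_(v < n) (src k == v) <= k.+1.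
  rewrite -addn1 leq_add //; case: (ltnP (src k) n) => lt; last first.
    rewrite big1 // => i _; case: eqP => // E.
    by move: lt; rewrite E leqNgt ltn_ord.
  rewrite (bigD1 (Ordinal lt)) //= eqxx big1 // => i /eqP ni.
  by case: eqP => // E; case: ni; apply/val_inj.
apply: leq_trans; rewrite -big_split /=; apply: leq_sum => v _.
by case: ifP => [/andP[_ ->]|_] /=; rewrite ?addn1 // leq_addr.
Qed.

(* From here on, registers 3, 4 and 5 hold d./2, the number of bits of a key and
   bits n, and array 7 holds powers of two. *)
Definition setup_prog : cmd :=
  3 <-- Reg 2 `/ Cst 2 ;;
  5 <-- Cst 0 ;; 6 <-- Cst 1 ;;
  While (Reg 6 `< Reg 0 `+ Cst 1)
    (Put 7 (Reg 5) (Reg 6) ;; 5 <-- Reg 5 `+ Cst 1 ;; 6 <-- Cst 2 `* Reg 6) ;;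
  4 <-- Reg 2 `* Reg 5.

Definition allowed_expr : expr := (0@[Reg 7] `= Cst 0) `+ (2@[Reg 7] `= Reg 8).

(* The list of the arcs into v starts at arc arr 8 v and goes on from arc e to
   arr 9 e.-1: arcs are numbered from 1, and 0 ends a list.  Arrays 10 and 11
   hold the arcs out of v in the same way. *)
Definition adj_prog : cmd :=
  6 <-- Cst 0 ;;
  While (Reg 6 `< Reg 1)
    (7 <-- 4@[Reg 6] ;; 8 <-- 5@[Reg 6] ;;
     If allowed_expr
       (Put 9 (Reg 6) (8@[Reg 8]) ;; Put 8 (Reg 8) (Reg 6 `+ Cst 1) ;;
        Put 11 (Reg 6) (10@[Reg 7]) ;; Put 10 (Reg 7) (Reg 6 `+ Cst 1))
       Skip ;;
     6 <-- Reg 6 `+ Cst 1).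

Definition ident_prog : cmd :=
  6 <-- Cst 0 ;;
  While (Reg 6 `< Reg 0) (Put 21 (Reg 6) (Reg 6) ;; 6 <-- Reg 6 `+ Cst 1).

Definition level_body : cmd :=
  12 <-- Cst 2 `* Reg 10 ;; 11 <-- Reg 2 `- Reg 12 ;; 13 <-- Reg 0 ;;
  dfs_prog 8 9 4 19 21 20 ;;
  13 <-- Reg 14 ;;
  dfs_prog 10 11 5 12 20 22 ;;
  10 <-- Reg 10 `+ Cst 1.

Definition levels_prog : cmd :=
  10 <-- Cst 0 ;; While (Reg 10 `< Reg 3) level_body.

Section Prep.
Variables (W N : nat).
Hypothesis WN : fits W N.
Variables (n m d : nat) (A : nat -> nat -> nat).
(** [N] covers everything stored: powers of two up to twice [n], edge numbers, and levels up to
    [d * bits n + 2], where [bits n <= n]. Addresses are intermediate values and may exceed [N]. *)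
Hypothesis (n_gt0 : 0 < n) (HN : 4 * (n + m + d) + d * n + 8 <= N).
Hypothesis tails : forall e, e < m -> A 4 e < n.
Hypothesis heads : forall e, e < m -> A 5 e < n.

(* The arcs of G_tau. *)
Definition allowed (e : nat) : bool := (A 0 (A 4 e) == 0) || (A 2 (A 4 e) == A 5 e).
Definition in_adj : nat -> nat -> seq nat := adj_upto allowed (A 5) (A 4).
Definition out_adj : nat -> nat -> seq nat := adj_upto allowed (A 4) (A 5).

Definition keeps (s : state) : Prop :=
  [/\ reg s 0 = n, reg s 1 = m, reg s 2 = d & forall a, a <= 5 -> arr s a =1 A a].

Lemma keeps_set_reg s x v : 2 < x -> keeps s -> keeps (set_reg s x v).
Proof. by move=> x2 [? ? ? ?]; split=> //=; rewrite ltn_eqF //; apply: ltn_trans x2. Qed.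

Lemma keeps_set_arr s a i v : 5 < a -> keeps s -> keeps (set_arr s a i v).
Proof.
move=> a5 [? ? ? kA]; split=> //= b b5 j; rewrite ltn_eqF ?kA //.
exact: leq_ltn_trans b5 a5.
Qed.

(** One more than the rounded logarithm: component numbers can equal [n], and [n < 2 ^ bits]. *)
Definition bits : nat := (trunc_log 2 n).+1.

Lemma bits_lt b : (2 ^ b <= n) = (b < bits).
Proof.
rewrite /bits ltnS; apply/idP/idP => [|le]; first exact: trunc_log_max.
by apply: leq_trans (trunc_logP (isT : 1 < 2) n_gt0); rewrite leq_exp2l.
Qed.

Lemma bits_le : bits <= n.
Proof.
exact: leq_trans (ltn_expl _ (isT : 1 < 2)) (trunc_logP (isT : 1 < 2) n_gt0).
Qed.

Lemma setup_ok s : bounded N s -> keeps s ->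
  wp W N setup_prog s (fun t s' => [/\ keeps s',
    [/\ reg s' 3 = d./2, reg s' 4 = d * bits & reg s' 5 = bits],
    forall b, b < bits -> arr s' 7 b = 2 ^ b & t <= 30 * (bits + 1)]).
Proof.
move=> bs [k0 k1 k2 kA].
apply: wp_seq; apply: (wp_assign WN) => //=; first by rewrite k2; lia.
apply: wp_seq; apply: (wp_assign WN) => //=.
apply: wp_seq; apply: (wp_assign WN) => //=; first by lia.
apply: wp_seq.
pose I k s' := exists b, [/\ keeps s', b <= bits,
  [/\ reg s' 3 = d./2, reg s' 5 = b & reg s' 6 = 2 ^ b],
  forall i, i < b -> arr s' 7 i = 2 ^ i & k = 25 * (bits - b)].
apply: (wp_while WN (I := I) (k0 := 25 * bits)) => //=.
- exists 0; split=> //=; rewrite ?subn0 //.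
  by rewrite k2 divn2.
- move=> k s1 bs1 [b [[j0 j1 j2 jA] bb [r3 r5 r6] r7 ->]].
  rewrite j0 r6 addn1 ltnS bits_lt; case: ltnP => // lt _.
  have le := lt; rewrite -bits_lt in le.
  have bn := bits_le.
  apply: wp_seq; apply: (wp_put WN) => //=; first by rewrite r6; lia.
  apply: wp_seq; apply: (wp_assign WN) => //=; first by rewrite r5; lia.
  apply: (wp_assign WN) => //=; first by rewrite r6; lia.
  exists (25 * (bits - b.+1)); last by move: lt; clear; lia.
  exists b.+1; split=> //=.
  + by do ?[apply: keeps_set_arr => // | apply: keeps_set_reg => //].
  + by rewrite r3 r5 r6 expnS; split=> //; lia.
  + move=> i; rewrite ltnS leq_eqVlt r5 => /predU1P[->|ib]; first by rewrite eqxx.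
    by rewrite (ltn_eqF ib); apply: r7.
- move=> t k s1 [b [[j0 j1 j2 jA] bb [r3 r5 r6] r7 ->]].
  rewrite j0 r6 addn1 ltnS bits_lt; case: ltnP => // ge _ le.
  have E : b = bits by apply/eqP; rewrite eqn_leq bb.
  have bn := bits_le.
  apply: (wp_assign WN) => //=; first by rewrite j2 r5; nia.
  split=> //=; last by move: le; rewrite E; clear; lia.
    by rewrite r3 j2 r5 E.
  by rewrite -E.
Qed.

Definition lists_ok (k : nat) (s : state) : Prop :=
  forall v, v < n -> chain (arr s 9) (A 4) (arr s 8 v) (in_adj k v) /\
    chain (arr s 11) (A 5) (arr s 10 v) (out_adj k v).

Definition links_le (k : nat) (s : state) : Prop :=
  [/\ forall v, v < n -> arr s 8 v <= k, forall v, v < n -> arr s 10 v <= k,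
      forall e, arr s 9 e <= e & forall e, arr s 11 e <= e].

Lemma adj_ok s : bounded N s -> keeps s ->
  (forall a v, a \in [:: 8; 9; 10; 11] -> arr s a v = 0) ->
  wp W N adj_prog s (fun t s' => [/\ keeps s', lists_ok m s' & t <= 60 * (m + 1)]).
Proof.
move=> bs [k0 k1 k2 kA] z.
apply: wp_seq; apply: (wp_assign WN) => //=.
pose J i s' := [/\ keeps s', reg s' 6 = i, lists_ok i s' & links_le i s'].
apply: (wp_for WN (J := J) (c := fun=> 50) (hi := m)).
- split=> //; last by split=> //= v; rewrite z.
  by move=> v vn /=; rewrite !z.
- by move=> i s1 [[j0 j1 j2 jA] r6 _ _].
- move=> i s1 bs1 im [[j0 j1 j2 jA] r6 L [B1 B2 B3 B4]].
  have ti := tails im; have hi := heads im.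
  apply: wp_seq; apply: (wp_assign WN) => //=; first exact: bs1.2.
  apply: wp_seq; apply: (wp_assign WN) => //=; first exact: bs1.2.
  apply: wp_seq; rewrite !jA // r6.
  apply: (wp_if WN) => //=; rewrite !jA // => al.
    have {}al : allowed i by move: al; rewrite addn_eq0 !eqb0 negb_and !negbK.
    apply: wp_seq; apply: (wp_put WN) => //=; first exact: bs1.2.
    apply: wp_seq; apply: (wp_put WN) => //=; first by lia.
    apply: wp_seq; apply: (wp_put WN) => //=; first exact: bs1.2.
    apply: (wp_put WN) => //=; first by lia.
    apply: (wp_assign WN) => //=; first by lia.
    rewrite r6; split=> //; split=> //=; rewrite ?addn1 //.
    + by do ?[apply: keeps_set_arr => // | apply: keeps_set_reg => //].
    + move=> v vn /=; have [c1 c2] := L v vn.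
      rewrite /in_adj /out_adj !adj_uptoS al /=; split.
      * rewrite eq_sym; case: eqP => [E|_] /=.
          rewrite eqxx; split=> //; subst v.
          apply: chain_eq (fun e _ => B3 e) (B1 _ hi) _ _ c1 => // e ei; first by rewrite (ltn_eqF ei).
        by apply: chain_eq (fun e _ => B3 e) (B1 _ vn) _ _ c1 => // e ei; rewrite (ltn_eqF ei).
      * rewrite eq_sym; case: eqP => [E|_] /=.
          rewrite eqxx; split=> //; subst v.
          apply: chain_eq (fun e _ => B4 e) (B2 _ ti) _ _ c2 => // e ei; first by rewrite (ltn_eqF ei).
        by apply: chain_eq (fun e _ => B4 e) (B2 _ vn) _ _ c2 => // e ei; rewrite (ltn_eqF ei).
    + split=> /= v => [vn|vn||].
      * by case: eqP => // _; apply: leqW; apply: B1.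
      * by case: eqP => // _; apply: leqW; apply: B2.
      * by case: eqP => [->|_]; [apply: B1 | apply: B3].
      * by case: eqP => [->|_]; [apply: B2 | apply: B4].
  have {}al : allowed i = false.
    by move: al; rewrite addn_eq0 !eqb0 -negb_or => /negbTE.
  apply: wp_skip; apply: (wp_assign WN) => //=; first by lia.
  rewrite r6; split=> //; split=> //=; rewrite ?addn1 //.
  + by move=> v vn /=; rewrite /in_adj /out_adj !adj_uptoS al; apply: L.
  + by split=> //= v vn; apply: leqW; auto.
- move=> t s1 [K r6 L _] le; split=> //=.
  by move: le; rewrite sum_nat_const card_ord; clear; lia.
Qed.

Lemma ident_ok s : bounded N s -> keeps s ->
  wp W N ident_prog s (fun t s' => [/\ keeps s',
    forall v, v < n -> arr s' 21 v = v & t <= 20 * (n + 1)]).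
Proof.
move=> bs [k0 k1 k2 kA].
apply: wp_seq; apply: (wp_assign WN) => //=.
pose J i s' := [/\ keeps s', reg s' 6 = i & forall v, v < i -> arr s' 21 v = v].
apply: (wp_for WN (J := J) (c := fun=> 12) (hi := n)) => //.
- by move=> i s1 [[j0 j1 j2 jA] r6 _].
- move=> i s1 bs1 im [[j0 j1 j2 jA] r6 L].
  apply: wp_seq; apply: (wp_put WN) => //=; first exact: bs1.1.
  apply: (wp_assign WN) => //=; first by lia.
  rewrite r6; split=> //; split=> //=; rewrite ?addn1 //.
  + by do ?[apply: keeps_set_arr => // | apply: keeps_set_reg => //].
  + move=> v; rewrite ltnS leq_eqVlt => /predU1P[->|vi]; first by rewrite eqxx.
    by rewrite (ltn_eqF vi); apply: L.
- move=> t s1 [K r6 L] le; split=> //=.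
  by move: le; rewrite sum_nat_const card_ord; clear; lia.
Qed.
End Prep.

(** * Component numbers for every even priority *)

Lemma cell_inj d a b a' b' : b < d -> b' < d -> a * d + b = a' * d + b' ->
  a = a' /\ b = b'.
Proof.
move=> bd bd' E; have d0 : 0 < d by apply: leq_ltn_trans bd.
have := congr1 (divn^~ d) E; have := congr1 (modn^~ d) E.
by rewrite !modnMDl !divnMDl // !modn_small // !divn_small // !addn0.
Qed.

Section Levels.
Variables (W N : nat).
Hypothesis WN : fits W N.
Variables (n m d : nat) (A : nat -> nat -> nat).
Hypothesis (n_gt0 : 0 < n) (HN : 4 * (n + m + d) + d * n + 8 <= N).
Hypothesis evd : ~~ odd d.
Hypothesis tails : forall e, e < m -> A 4 e < n.
Hypothesis heads : forall e, e < m -> A 5 e < n.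
Local Notation keeps := (keeps n m d A).
Local Notation pr := (A 1).
Local Notation outs := (out_adj A m).

Record prepared (s : state) : Prop := Prepared {
  pp_keeps : keeps s;
  pp_h : reg s 3 = d./2; pp_L : reg s 4 = d * bits n; pp_B : reg s 5 = bits n;
  pp_pow : forall b, b < bits n -> arr s 7 b = 2 ^ b;
  pp_lists : lists_ok n A m s;
  pp_id : forall v, v < n -> arr s 21 v = v }.

(** A syntactic test, decided by computation, that a program spares all that [prepared] speaks
    of. *)
Definition harmless (c : cmd) : bool :=
  all (fun x => 5 < x) (regs_of c) &&
  all (fun a => a \notin [:: 0; 1; 2; 3; 4; 5; 7; 8; 9; 10; 11; 21]) (arrs_of c).

Lemma prepared_frame c s s' : harmless c -> frame c s s' -> prepared s -> prepared s'.
Proof.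
case/andP=> /allP hr /allP ha [fr fa] [[k0 k1 k2 kA] p1 p2 p3 p4 p5 p6].
have er x : x <= 5 -> reg s' x = reg s x.
  by move=> x5; apply: fr; apply/negP => /hr; rewrite ltnNge x5.
have ea a : a \in [:: 0; 1; 2; 3; 4; 5; 7; 8; 9; 10; 11; 21] -> arr s' a =1 arr s a.
  by move=> a5; apply: fa; apply/negP => /ha; rewrite a5.
split; rewrite ?er //.
- split; rewrite ?er // => a a5 j; rewrite ea ?kA //.
  by move: a5; do 6 case: a => [|a] //.
- by move=> b bb; rewrite ea ?p4.
- move=> v vn; have [c1 c2] := p5 v vn.
  by split; rewrite ea //; [move: c1 | move: c2];
    apply: chain_ext => // j; rewrite ea.
- by move=> v vn; rewrite ea // p6.
Qed.

Lemma prepared_set_reg s x v : 5 < x -> prepared s -> prepared (set_reg s x v).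
Proof.
move=> x5; apply: (@prepared_frame (Assign x (Cst 0))); first by rewrite /harmless /= x5.
by split=> // y; rewrite /= inE => /negbTE ->.
Qed.

Lemma prepared_set_arr s a i v : a \notin [:: 0; 1; 2; 3; 4; 5; 7; 8; 9; 10; 11; 21] ->
  prepared s -> prepared (set_arr s a i v).
Proof.
move=> al; apply: (@prepared_frame (Put a (Cst 0) (Cst 0))); first by rewrite /harmless /= al.
by split=> // b; rewrite /= inE => /negbTE na j; rewrite na.
Qed.

(** On the nodes of priority at most [q], equal numbers mean equal components. All other nodes get
    0, so that edges leaving this subgraph lower the number as well. *)
Record comp_ok (q : nat) (c : nat -> nat) : Prop := CompOk {
  co_le : forall x, x < n -> c x <= n;
  co_in : forall x, x < n -> (c x != 0) = (pr x <= q);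
  co_mono : forall x y, hedge (level_set n q pr) outs x y -> c y <= c x;
  co_scc : forall x y, level_set n q pr x -> level_set n q pr y -> c x = c y ->
     reach (hedge (level_set n q pr) outs) x y }.

Lemma comp_ok_ext q c c' : (forall x, x < n -> c x = c' x) ->
  comp_ok q c -> comp_ok q c'.
Proof.
move=> cc [h1 h2 h3 h4]; split.
- by move=> x xn; rewrite -cc ?h1.
- by move=> x xn; rewrite -cc ?h2.
- move=> x y xy; have /and3P[/andP[xn _] /andP[yn _] _] := xy.
  by rewrite -!cc // h3.
- move=> x y Hx Hy; have /andP[xn _] := Hx; have /andP[yn _] := Hy.
  by rewrite -!cc // => /h4; apply.
Qed.

(* Columns 2 i of the rows of array 12, i < k, hold the component numbers. *)
Record comps_upto (k : nat) (s : state) : Prop := CompsUpto {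
  cu_ok : forall i, i < k -> comp_ok (d - 2 * i) (fun x => arr s 12 (x * d + 2 * i));
  cu_zero : forall a j, a \in [:: 12; 19] ->
     (forall x i, x < n -> i < k -> j != x * d + 2 * i) -> arr s a j = 0 }.

Lemma level_ok i s : bounded N s -> prepared s -> i < d./2 -> reg s 10 = i ->
  comps_upto i s ->
  wp W N level_body s (fun t s' => [/\ prepared s', reg s' 10 = i.+1,
    comps_upto i.+1 s' & t <= 400 * (1 + 3 * n + m)]).
Proof.
move=> bs P ih r10 [ok zero]; apply: wp_frame.
apply: (@wp_mono _ _ _ _ (fun t s' => [/\ reg s' 10 = i.+1,
    comps_upto i.+1 s' & t <= 400 * (1 + 3 * n + m)])) => [t s' [? ? ?] fr|].
  by split=> //; apply: prepared_frame fr P.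
have [[k0 k1 k2 kA] p1 p2 p3 p4 p5 p6] := P.
have od : 2 * i < d by move: ih; lia.
apply: wp_seq; apply: (wp_assign WN) => //=; first by rewrite r10; lia.
apply: wp_seq; apply: (wp_assign WN) => //=; first by rewrite k2; lia.
apply: wp_seq; apply: (wp_assign WN) => //=; first by rewrite k0; lia.
rewrite k0 k2 r10; set s1 := set_reg _ _ _.
have P1 : prepared s1 by do ?apply: prepared_set_reg.
have fits1 : n.+1 < N by lia.
have inlt x y : y \in in_adj A m x -> y < n.
  by case/mem_adj_upto => e [em _ _ <-]; apply: tails.
have outlt x y : y \in outs x -> y < n.
  by case/mem_adj_upto => e [em _ _ <-]; apply: heads.
have sum_le : \sum_(x < n) size (in_adj A m x) <= m /\ \sum_(x < n) size (outs x) <= m.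
  by split; apply: sum_adj_upto.
set q := d - 2 * i.
set H := level_set n q pr.
apply: wp_bounded => bs1; apply: wp_seq; apply: wp_frame.
(* The first search runs along incoming edges and the second along outgoing ones, so that the final
   numbers do not increase along an edge. *)
apply: wp_mono (@dfs_prog_ok W N WN 8 9 4 19 21 20 isT isT n d q (2 * i) pr
  (in_adj A m) (iota 0 n) fits1 od inlt (iota_uniq _ _) _ _ s1 bs1 _ _ _) => //=.
- move=> t1 s2 [L1 [F1 [post1 [lab1 fin1 r14] same1 t1le]]] fr1.
  have P2 := prepared_frame (c := dfs_prog 8 9 4 19 21 20) isT fr1 P1.
  have r_same x : x \in [:: 2; 10; 11; 12] -> reg s2 x = reg s1 x.
    by move=> xi; apply: fr1.1; move: x xi; apply/allP.
  apply: wp_seq; apply: (wp_assign WN) => //=.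
    rewrite r14; have := uniq_leq_size (dp_uniq post1) (s2 := iota 0 n).
    rewrite size_iota => le; apply: leq_trans (le _) _ => [x|]; last by lia.
    by rewrite (dp_mem post1) mem_iota => /(dp_lab post1)[].
  rewrite r14; set s3 := set_reg _ _ _.
  have P3 : prepared s3 by do ?apply: prepared_set_reg.
  apply: wp_bounded => bs3; apply: wp_seq; apply: wp_frame.
  have F1n x : x \in F1 -> x < n by rewrite (dp_mem post1) => /(dp_lab post1)[].
  have F1a x : x < n -> H x -> x \in F1 by move=> xn Hx; rewrite (dp_mem post1) (dp_vis post1).
  apply: wp_mono (@dfs_prog_ok W N WN 10 11 5 12 20 22 isT isT n d q (2 * i) pr
    outs F1 fits1 od outlt (dp_uniq post1) F1n F1a s3 bs3 _ _ _) => //=.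
  + move=> t2 s4 [L2 [F2 [post2 [lab2 fin2 _] same2 t2le]]] fr2.
    have r4 : reg s4 10 = i.
      by rewrite fr2.1 //= r_same.
    apply: (wp_assign WN) => //=; first by rewrite r4; lia.
    have a12 : arr s2 12 =1 arr s 12 by move=> j; rewrite fr1.2.
    have a19 : arr s4 19 =1 arr s2 19 by move=> j; rewrite fr2.2.
    have col x k : k < i -> arr s4 12 (x * d + 2 * k) = arr s 12 (x * d + 2 * k).
      move=> ki; rewrite same2 /=; first exact: a12.
      move=> y yn; apply/eqP => /cell_inj E; have [|_ E2] := E _ od; first by lia.
      by move: ki; clear -E2; lia.
    split; first by rewrite r4 addn1.
    + split=> [k|c j ce nj] /=.
        rewrite ltnS leq_eqVlt => /predU1P[->|ki]; last first.
          by apply: comp_ok_ext (ok k ki) => x xn; rewrite col.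
        apply: (@comp_ok_ext q L2) => [x xn|]; first by rewrite lab2.
        split.
        * move=> x xn; case: (eqVneq (L2 x) 0) => [->//|h].
          by have [] := dp_lab post2 h.
        * move=> x xn; apply/idP/idP => [h|xq].
            by have [/andP[]] := dp_lab post2 h.
          by apply: (dp_vis post2) => //; rewrite /H /level_set xn.
        * move=> x y xy; apply: (dp_mono post2) => //.
          by case/and3P: xy => /andP[].
        * apply: kosaraju post1 post2 => [x /andP[]//|x y Hx Hy].
          by apply/mem_adj_upto/mem_adj_upto => -[e [h1 h2 h3 h4]]; exists e.
      have nj' x : x < n -> j != x * d + 2 * i by move=> xn; apply: nj.
      have zj : arr s c j = 0 by apply: zero => // x k xn ki; apply: nj => //; lia.
      move: ce; rewrite !inE => /orP[]/eqP E; rewrite E in zj *.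
        by rewrite same2 //= a12.
      by rewrite a19 same1.
    + by move: t1le t2le sum_le.1 sum_le.2; clear; move: (\sum_(x < n) _) (\sum_(x < n) _); lia.
  + case: (P3) => [[q0 q1 q2 qA] _ _ _ _ q5 _].
    split=> //=.
    * by rewrite r_same.
    * by rewrite r_same.
    * by move=> x xn; rewrite qA.
    * by move=> x xn; have [_ c2] := q5 x xn; apply: chain_ext c2 => // j; rewrite qA.
  + by move=> x xn; rewrite fr1.2 //=; apply: zero => // y k yn ki;
      apply/eqP => /cell_inj E; have [||_ E2] := E; move: ki; lia.
- by move=> x; rewrite mem_iota.
- by move=> x xn _; rewrite mem_iota.
- split=> //=.
  + by move=> x xn; rewrite kA.
  + by move=> k; rewrite size_iota => kn; rewrite p6 // nth_iota.
  + by move=> x xn; have [c1 _] := p5 x xn; apply: chain_ext c1 => // j; rewrite kA.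
- by rewrite size_iota.
- by move=> x xn; apply: zero => // y k yn ki;
    apply/eqP => /cell_inj E; have [||_ E2] := E; move: ki; lia.
Qed.

Lemma levels_ok s : bounded N s -> prepared s ->
  (forall a j, a \in [:: 12; 19] -> arr s a j = 0) ->
  wp W N levels_prog s (fun t s' => [/\ prepared s', comps_upto d./2 s',
    forall a j, a \notin [:: 12; 19] ++ [:: 17; 18; 20; 22] -> arr s' a j = arr s a j
    & t <= 1000 * (d * (n + m)) + 10]).
Proof.
move=> bs P z; apply: wp_frame.
apply: wp_seq; apply: (wp_assign WN) => //=.
pose J i s' := [/\ prepared s', reg s' 10 = i & comps_upto i s'].
apply: (wp_for WN (J := J) (c := fun=> 400 * (1 + 3 * n + m)) (hi := d./2)).
- by split=> //; [apply: prepared_set_reg | split=> // a j aj _; apply: z].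
- by move=> i s1 [P1 r10 _]; rewrite (pp_h P1).
- move=> i s1 bs1 ih [P1 r10 C1].
  by apply: wp_mono (level_ok bs1 P1 ih r10 C1) => t s2 [].
- move=> t s1 [P1 _ C1] le fr; split=> //.
  + by move=> a j aj; apply: fr.2; move: aj; rewrite /= !inE; lia.
  + move: le; rewrite sum_nat_const card_ord.
    have : 2 * d./2 <= d by lia.
    by move: n_gt0; clear; nia.
Qed.

End Levels.

(** * Offers and the radix heap *)

(** The digits before [j] are compared by inequality only, because component numbers may already
    drop along an arc before the deciding cell. *)
Lemma value_lt_at M s t j : size s = size t -> j < size s -> all (gtn M) s ->
  (forall i, i < j -> nth 0 s i <= nth 0 t i) -> nth 0 s j < nth 0 t j ->
  value M s < value M t.
Proof.
elim: s t j => [|x s IH] [|y t] // j [st] js /= /andP[xM sM] le lt.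
case: j js le lt => [|j] /= js le lt; first exact: value_lt_cons.
have := le 0 isT; rewrite /= leq_eqVlt => /predU1P[xy|xy]; last exact: value_lt_cons.
rewrite xy !value_cons st ltn_add2l; apply: (IH t j) => // i ij.
exact: (le i.+1).
Qed.

Lemma value_first_diff M s t : size s = size t -> all (gtn M) t ->
  value M s < value M t ->
  exists j, [/\ j < size s, forall i, i < j -> nth 0 s i = nth 0 t i &
    nth 0 s j < nth 0 t j].
Proof.
elim: s t => [|x s IH] [|y t] //= [st] /andP[yM tM] lt.
case: (ltngtP x y) => xy; first by exists 0.
  by have := value_lt_cons (esym st) tM xy; rewrite ltnNge ltnW.
move: lt; rewrite xy !value_cons st ltn_add2l => /(IH _ st tM)[j [h1 h2 h3]].
by exists j.+1; split=> [||//]; [rewrite ltnS -st | case=> //= i; apply: h2].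
Qed.

Definition digit_cell (r j : expr) : expr := 12@[r `* Reg 2 `+ (Cst 2 `* j `+ Cst 1)].

(* The label in row Reg 21 is lifted into array 16, for the node Reg 20 and from
   the last digit on.  Reg 24 is the carry, which is left over exactly when the
   result is the top element; Reg 25 compares with the present label of the
   node. *)
Definition cand_prog : cmd :=
  23 <-- (Reg 2 `+ Cst 1 `- 1@[Reg 20]) `/ Cst 2 ;;
  24 <-- 1@[Reg 20] `- Cst 2 `* (1@[Reg 20] `/ Cst 2) ;;
  25 <-- Cst 0 ;;
  26 <-- Reg 3 ;;
  While (Reg 26)
    (26 <-- Reg 26 `- Cst 1 ;;
     27 <-- digit_cell (Reg 20) (Reg 26) ;;
     If (Reg 26 `< Reg 23)
       (28 <-- digit_cell (Reg 21) (Reg 26) `+ Reg 24 ;;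
        If (Reg 28 `= Reg 0) (28 <-- Cst 0) (24 <-- Cst 0))
       (28 <-- Cst 0) ;;
     Put 16 (Reg 26) (Reg 28) ;;
     If (Reg 28 `< Reg 27) (25 <-- Cst 1)
       (If (Reg 27 `< Reg 28) (25 <-- Cst 0) Skip)).

Definition tail_value (n h : nat) (f : nat -> nat) (j : nat) : nat :=
  value n [seq f i | i <- iota j (h - j)].

Lemma tail_valueS n h f j : j < h ->
  tail_value n h f j = f j * n ^ (h - j.+1) + tail_value n h f j.+1.
Proof.
by move=> jh; rewrite /tail_value -(subnSK jh) /= value_cons size_map size_iota.
Qed.

Lemma tail_value_h n h f : tail_value n h f h = 0.
Proof. by rewrite /tail_value subnn. Qed.

Lemma tail_value_lt n h f j : (forall i, j <= i < h -> f i < n) -> j <= h ->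
  tail_value n h f j < n ^ (h - j).
Proof.
move=> fn jh; have := @value_lt n [seq f i | i <- iota j (h - j)].
rewrite size_map size_iota; apply; apply/allP => x /mapP[i].
by rewrite mem_iota => /andP[ji ih] -> /=; apply: fn; move: ji ih jh; clear; lia.
Qed.

Lemma tail_value_mod n h f j : (forall i, i < h -> f i < n) -> j <= h ->
  tail_value n h f j = tail_value n h f 0 %% n ^ (h - j).
Proof.
move=> fn; elim: j => [|j IH] jh.
  by rewrite modn_small // tail_value_lt // => i /andP[_]; apply: fn.
rewrite -[LHS](modn_small (m := tail_value n h f j.+1) (d := n ^ (h - j.+1))); last first.
  by apply: tail_value_lt => // i /andP[_]; apply: fn.
have := IH (ltnW jh); rewrite tail_valueS // => E.
rewrite -(modnMDl (f j)) E modn_dvdm // dvdn_exp2l //.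
by rewrite leq_sub2l.
Qed.

(* Row r of array 12 consists of d cells: cell 2 i is the number of the component
   of r in the subgraph of priorities at most d - 2 i, and cell 2 j + 1 is the
   digit j of the label of r.  The rows of the nodes are followed by a row of
   zeros and by the rows n.+1 + w with the digits of mu w. *)
Section Rows.
Variables (n d : nat).
Local Notation h := (d./2).

Definition row_digit (s : state) (r j : nat) : nat := arr s 12 (r * d + (2 * j + 1)).
Definition row_value (s : state) (r : nat) : nat := tail_value n h (row_digit s r) 0.
Definition row_key (s : state) (r : nat) : nat :=
  value (2 ^ bits n) [seq arr s 12 (r * d + j) | j <- iota 0 d].
End Rows.

Section Cand.
Variables (W N : nat).
Hypothesis WN : fits W N.
Variables (n m d : nat) (A : nat -> nat -> nat).
Hypothesis (n_gt0 : 0 < n) (HN : 4 * (n + m + d) + d * n + 8 <= N).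
Hypothesis evd : ~~ odd d.
Hypothesis prd : forall v, v < n -> 0 < A 1 v <= d.
Local Notation keeps := (keeps n m d A).
Local Notation pr := (A 1).
Local Notation h := (d./2).

Lemma cand_ok s v r : bounded N s -> keeps s -> reg s 3 = h -> v < n ->
  reg s 20 = v -> reg s 21 = r ->
  (forall j, j < h -> row_digit d s r j < n) -> (forall j, j < h -> row_digit d s v j < n) ->
  wp W N cand_prog s (fun t s' => [/\ forall j, j < h -> arr s' 16 j < n,
    (reg s' 24 == 0) = (liftl n d (pr v) (row_value n d s r) < n ^ h),
    reg s' 24 == 0 -> tail_value n h (arr s' 16) 0 = liftl n d (pr v) (row_value n d s r),
    reg s' 25 = (tail_value n h (arr s' 16) 0 < row_value n d s v) &
    t <= 100 * (h + 1)]).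
Proof.
move=> bs K r3 vn r20 r21 dr dv.
have [k0 k1 k2 kA] := K; have pv := prd vn.
have nN : n <= N by move: HN; clear; lia.
have arE a x : a <= 5 -> arr s a x = A a x by move=> a5; rewrite kA.
apply: wp_seq; apply: (wp_assign WN) => //=.
  by rewrite r20 k2 arE //; lia.
apply: wp_seq; apply: (wp_assign WN) => //=.
  by rewrite r20 arE //; lia.
apply: wp_seq; apply: (wp_assign WN) => //=.
apply: wp_seq; apply: (wp_assign WN) => //=; first by rewrite r3; lia.
rewrite k2 r20 r3 arE // addn1 divn2 -/(kept d (pr v)).
have -> : pr v - 2 * (pr v %/ 2) = odd (pr v) by lia.
set c := kept d (pr v); set o := odd (pr v); set s1 := set_reg _ _ _.
have ch : c <= h by apply: kept_le; lia.
pose src := row_digit d s r; pose dst := row_digit d s v.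
pose SV f j := tail_value n h f j.
(* At positions from [c] on the candidate is 0 and the carry is still [o]. Before [c], candidate
   suffix plus carry equals the source suffix with the digits from [c] on erased and [o] units
   added, written without subtraction. [lt] compares the suffixes seen so far. *)
pose I k s' := exists j cy lt, [/\ [/\ keeps s', arr s' 12 =1 arr s 12,
   reg s' 20 = v & reg s' 21 = r],
  [/\ j <= h, reg s' 26 = j, reg s' 23 = c, reg s' 24 = nat_of_bool cy &
      reg s' 25 = nat_of_bool lt],
  [/\ forall i, j <= i < h -> arr s' 16 i < n,
      c <= j -> SV (arr s' 16) j = 0 /\ cy = o,
      j <= c -> SV (arr s' 16) j + cy * n ^ (h - j) + SV src c = SV src j + o * n ^ (h - c) &
      lt = (SV (arr s' 16) j < SV dst j)] &
  k = 90 * j].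
apply: (wp_while WN (I := I) (k0 := 90 * h)) => //=.
- exists h, o, false; split=> //.
  + split=> //; first by move=> i; rewrite leqNgt andNb.
    * by rewrite /SV tail_value_h.
    * move=> hc; have -> : c = h by apply/eqP; rewrite eqn_leq ch.
      by rewrite /SV tail_value_h; lia.
    * by rewrite /SV !tail_value_h.
- move=> k s2 bs2 [j [cy [lt [[K2 a12 q20 q21] [jh q26 q23 q24 q25] [t1 t2 t3 t4] ->]]]].
  rewrite q26; case: j jh q26 t1 t2 t3 t4 => [|j] //= jh q26 t1 t2 t3 t4 _.
  have [l0 l1 l2 lA] := K2.
  have sj : src j < n by apply: dr.
  have dj : dst j < n by apply: dv.
  have ar2 x : arr s2 12 x = arr s 12 x by rewrite a12.
  apply: wp_seq; apply: (wp_assign WN) => //=; first by have := bs2.1 26; clear; lia.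
  apply: wp_seq; apply: (wp_assign WN) => //=; first exact: bs2.2.
  rewrite q26 q20 l2 subn1 /= ar2 -[arr s 12 _]/(dst j).
  (* t is the digit of the candidate, cy' the carry handed on *)
  pose t := if j < c then (if src j + cy == n then 0 else src j + cy) else 0.
  pose cy' := if j < c then src j + cy == n else cy.
  set s3 := set_reg _ 27 _.
  apply: wp_seq; apply: (@wp_mono _ _ _ _ (fun t' s4 => [/\ t' <= 30,
      reg s4 28 = t, reg s4 24 = nat_of_bool cy',
      forall x, x \notin [:: 24; 28] -> reg s4 x = reg s3 x & arr s4 =1 arr s3])); last first.
    apply: (wp_if WN) => //=; rewrite q23 /t /cy'; case: ltnP => // jc _; last first.
      by apply: (wp_assign WN) => //=; split=> // x; rewrite !inE => /norP[_ /negbTE->].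
    have E28 : row_digit d s r j + cy <= N.
      by move: sj nN; rewrite /src; case: (cy); clear; lia.
    apply: wp_seq; apply: (wp_assign WN) => //=; rewrite ?q21 ?l2 ?ar2 ?q24 -[arr s 12 _]/(src j) //.
    apply: (wp_if WN) => //=; rewrite l0; case: (eqVneq (src j + cy) n) => // En _.
      apply: (wp_assign WN) => //=; split=> // [|x].
        by rewrite q24; move: En sj; case: (cy) => //; rewrite addn0 => ->; rewrite ltnn.
      by rewrite !inE => /norP[_ /negbTE->].
    by apply: (wp_assign WN) => //=; split=> // x;
        rewrite !inE => /norP[/negbTE-> /negbTE->].
  move=> t' s4 [t30 w28 w24 wr wa].
  have tn : t < n.
    rewrite /t; case: (j < c) => //; case: eqP => // ne; move: ne sj; case: (cy); clear; lia.
  have w26 : reg s4 26 = j by rewrite wr.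
  have w27 : reg s4 27 = dst j by rewrite wr.
  apply: wp_seq; apply: (wp_put WN) => //=; first by rewrite w28; apply: leq_trans (ltnW tn) nN.
  rewrite w26 w28; set s5 := set_arr _ _ _ _.
  pose lt' := if t < dst j then true else if dst j < t then false else lt.
  apply: (@wp_mono _ _ _ _ (fun t' s6 => [/\ t' <= 20, reg s6 25 = nat_of_bool lt',
      forall x, x != 25 -> reg s6 x = reg s5 x & arr s6 =1 arr s5])); last first.
    apply: (wp_if WN) => //=; rewrite w28 w27 /lt'; case: ltnP => // tl _.
      by apply: (wp_assign WN) => //=; [move: nN n_gt0; clear; lia | split=> // x /negbTE->].
    apply: (wp_if WN) => //=; rewrite w28 w27; case: ltnP => // tl' _.
      by apply: (wp_assign WN) => //=; split=> // x /negbTE->.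
    by apply: wp_skip; split=> //=; rewrite wr.
  move=> t6 s6 [t20 v25 vr va].
  have v_r x : x \notin [:: 24; 25; 28] -> x \notin [:: 26; 27] -> reg s6 x = reg s2 x.
    rewrite !inE => /norP[h1 /norP[h2 h3]] /norP[h4 h5].
    by rewrite vr //= wr ?inE ?negb_or ?h1 //= (negbTE h5) (negbTE h4).
  have v_a a x : a != 16 -> arr s6 a x = arr s2 a x by move=> /negbTE a16; rewrite va /= a16 wa.
  have v16 x : arr s6 16 x = if x == j then t else arr s2 16 x by rewrite va /= wa.
  have S16 : SV (arr s6 16) j.+1 = SV (arr s2 16) j.+1.
    rewrite /SV /tail_value; congr value; apply/eq_in_map => i.
    by rewrite mem_iota => /andP[ji _]; rewrite v16 gtn_eqF.
  have SVS f : SV f j = f j * n ^ (h - j.+1) + SV f j.+1 by rewrite /SV tail_valueS.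
  exists (90 * j); last by move: t30 t20; clear; lia.
  exists j, cy', lt'; split=> //.
  + split; rewrite ?v_r //.
      by split; rewrite ?v_r // => a a5 x; rewrite v_a ?lA //; apply: contraTneq a5 => ->.
    by move=> x; rewrite v_a ?a12.
  + split; [exact: ltnW | by rewrite vr | by rewrite v_r | by rewrite vr | exact: v25].
  + split.
    * move=> i /andP[ji ih]; rewrite v16; case: eqP => // /eqP ne.
      by apply: t1; rewrite ih andbT ltn_neqAle eq_sym ne.
    * move=> cj; have [S0 co] := t2 (leqW cj).
      by rewrite SVS S16 S0 v16 eqxx /t /cy' ltnNge cj.
    * rewrite leq_eqVlt => /predU1P[jc|jc].
        have [S0 co] : SV (arr s2 16) j.+1 = 0 /\ cy = o by apply: t2; rewrite -jc.
        by rewrite SVS S16 S0 v16 eqxx /t /cy' -jc ltnn co mul0n !add0n addnC.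
      have E := t3 jc.
      rewrite !SVS S16 v16 eqxx /t /cy' jc.
      have Ep : n ^ (h - j) = n * n ^ (h - j.+1) by rewrite -expnS subnSK.
      rewrite Ep; move: E; move: (SV (arr s2 16) j.+1) (SV src c) (SV src j.+1) (o * _) (n ^ _) => a b e f g.
      case: eqP => [<-|_]; rewrite /= ?mul1n ?mul0n ?mulnDl; clear; lia.
    * rewrite !SVS S16 v16 eqxx /lt'.
      have b1 : SV (arr s2 16) j.+1 < n ^ (h - j.+1) by apply: tail_value_lt.
      have b2 : SV dst j.+1 < n ^ (h - j.+1).
        by apply: tail_value_lt => // i /andP[_]; apply: dv.
      move: b1 b2; rewrite t4; move: (SV (arr s2 16) j.+1) (SV dst j.+1) (n ^ _) => a b g.
      case: (ltngtP t (dst j)) => [tl|tl|->] ag bg; last by rewrite ltn_add2l.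
        have : t.+1 * g <= dst j * g by rewrite leq_mul2r tl orbT.
        by rewrite mulSn; move: ag; clear; lia.
      have : (dst j).+1 * g <= t * g by rewrite leq_mul2r tl orbT.
      by rewrite mulSn; move: bg; clear; lia.
- move=> t k s2 [j [cy [lt [[K2 a12 q20 q21] [jh q26 q23 q24 q25] [t1 t2 t3 t4] ->]]]].
  rewrite q26 => j0 le; rewrite j0 in t1 t2 t3 t4 le.
  have Ec : SV src c = row_value n d s r %% unit_of n d (pr v) by apply: tail_value_mod.
  have := t3 (leq0n c); rewrite Ec subn0 => E.
  have K0 : 0 < unit_of n d (pr v) by apply: unit_gt0.
  have lK : SV (arr s2 16) 0 < n ^ h by rewrite -[h in n ^ h]subn0; apply: tail_value_lt.
  have E2 : SV (arr s2 16) 0 + cy * n ^ h =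
      row_value n d s r %/ unit_of n d (pr v) * unit_of n d (pr v) + o * unit_of n d (pr v).
    have := divn_eq (row_value n d s r) (unit_of n d (pr v)).
    move: E; rewrite -/(unit_of n d (pr v)) -[SV src 0]/(row_value n d s r).
    by move: (_ %/ _ * _) (_ %% _) (o * _) => a b e; clear; lia.
  have xE : liftl n d (pr v) (row_value n d s r) = if o
      then minn (n ^ h) (SV (arr s2 16) 0 + cy * n ^ h)
      else SV (arr s2 16) 0 + cy * n ^ h.
    by rewrite E2 /liftl -/o; case: (o); rewrite ?mul1n ?mul0n ?addn0 // mulSn addnC.
  (* At an even priority rounding down stays below top, so no carry is left over. *)
  have cyo : ~~ o -> cy = false.
    move=> no; have : liftl n d (pr v) (row_value n d s r) < n ^ h.
      rewrite /liftl -/o (negbTE no) (leq_ltn_trans (leq_trunc_div _ _)) //.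
      by rewrite -[h in n ^ h]subn0; apply: tail_value_lt => // i /andP[_]; apply: dr.
    rewrite xE (negbTE no); case: (cy) => //; rewrite mul1n; clear; lia.
  split=> //.
  + rewrite q24 xE eqb0; case: (boolP o) => [_|/cyo->].
      by case: (cy); rewrite ?mul1n ?mul0n ?addn0 gtn_min ?ltnn /= ?lK ?orbT // ltnNge leq_addl.
    by rewrite mul0n addn0 lK.
  + rewrite q24 eqb0 => /negbTE cy0; rewrite xE cy0 mul0n addn0.
    by case: (o) => //; rewrite (minn_idPr _) // ltnW.
  + by rewrite q25 t4.
  + by move: le; clear; lia.
Qed.
End Cand.

(** * Keys and their bits *)

Lemma divn_pow_le x y e f : e <= f -> x %/ 2 ^ e = y %/ 2 ^ e -> x %/ 2 ^ f = y %/ 2 ^ f.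
Proof. by move=> /subnKC <- E; rewrite expnD !divnMA E. Qed.

Section Keys.
Variables (n d : nat).
Local Notation h := (d./2).
Local Notation B := (bits n).
Local Notation L := (d * bits n).

Lemma bits_gt0 : 0 < B. Proof. by []. Qed.

Definition row (s : state) (r : nat) : seq nat := [seq arr s 12 (r * d + j) | j <- iota 0 d].

Lemma keyE s r : row_key n d s r = value (2 ^ B) (row s r). Proof. by []. Qed.

Lemma size_row s r : size (row s r) = d.
Proof. by rewrite size_map size_iota. Qed.

Lemma nth_row s r j : j < d -> nth 0 (row s r) j = arr s 12 (r * d + j).
Proof. by move=> jd; rewrite (nth_map 0) ?size_iota // nth_iota. Qed.

Definition small_row (s : state) (r : nat) : Prop :=
  forall j, j < d -> arr s 12 (r * d + j) < 2 ^ B.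

Lemma all_row s r : small_row s r -> all (gtn (2 ^ B)) (row s r).
Proof.
by move=> h; apply/allP => x /mapP[j]; rewrite mem_iota => jd -> /=; apply: h.
Qed.

Lemma key_lt s r : small_row s r -> row_key n d s r < 2 ^ L.
Proof. by move=> /all_row /value_lt; rewrite size_row -expnM mulnC. Qed.

Lemma key_lt_at s r s' r' j : small_row s r -> j < d ->
  (forall i, i < j -> arr s 12 (r * d + i) <= arr s' 12 (r' * d + i)) ->
  arr s 12 (r * d + j) < arr s' 12 (r' * d + j) -> row_key n d s r < row_key n d s' r'.
Proof.
move=> sm jd le lt; rewrite !keyE; apply: (@value_lt_at _ _ _ j).
- by rewrite !size_row.
- by rewrite size_row.
- exact: all_row.
- by move=> i ij; have id := ltn_trans ij jd; rewrite !nth_row // le.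
- by rewrite !nth_row.
Qed.

(** Bits are counted from the most significant one. Each cell holds [B] of them, so a bit of the key
    is read from one cell by means of the table of powers. *)
Lemma key_bit s r l : small_row s r -> l < L ->
  (row_key n d s r %/ 2 ^ (L - l.+1)) %% 2 =
  (arr s 12 (r * d + l %/ B) %/ 2 ^ (B - 1 - (l - l %/ B * B))) %% 2.
Proof.
move=> sm lL; set j := l %/ B; set t := l - j * B.
have El : l = j * B + t by rewrite /t subnKC // leq_trunc_div.
have tB : t < B by have := ltn_pmod l bits_gt0; rewrite {1}(divn_eq l B) -/j in El *; lia.
have jd : j < d by rewrite /j ltn_divLR.
have -> : L - l.+1 = (B - 1 - t) + (d - j.+1) * B.
  by rewrite El; move: tB jd; clear; nia.
have El2 : 2 ^ (B - 1 - t + (d - j.+1) * B) = (2 ^ B) ^ (d - j.+1) * 2 ^ (B - 1 - t).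
  by rewrite expnD mulnC [_ * B]mulnC expnM.
rewrite El2 divnMA keyE -{1}(cat_take_drop j.+1 (row s r)) value_cat size_drop size_row.
have := all_row sm; rewrite -{1}(cat_take_drop j.+1 (row s r)) all_cat => /andP[_ /value_lt].
rewrite size_drop size_row => lt.
rewrite divnMDl ?expn_gt0 // (divn_small lt) addn0.
rewrite (take_nth 0) ?size_row // -cats1 value_cat /= expn1 nth_row //.
have -> : 2 ^ B = 2 ^ t * 2 * 2 ^ (B - 1 - t).
  by rewrite -expnSr -expnD; congr (2 ^ _); move: tB; clear; lia.
by rewrite mulnA divnMDl ?expn_gt0 // mulnA modnMDl /value /= mul0n add0n.
Qed.
End Keys.

Definition row_bit (r : expr) : expr :=
  let dg := Reg 29 `/ Reg 5 in
  let pw := 7@[Reg 5 `- Cst 1 `- (Reg 29 `- dg `* Reg 5)] in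
  let y := 12@[r `* Reg 2 `+ dg] in
  y `/ pw `- Cst 2 `* (y `/ pw `/ Cst 2).

(* Raises the level Reg 29 while the keys in rows Reg 20 and Reg 22 agree. *)
Definition advance_prog : cmd :=
  While ((Reg 29 `< Reg 4) `* (row_bit (Reg 20) `= row_bit (Reg 22)))
    (29 <-- Reg 29 `+ Cst 1).

Definition push_prog : cmd :=
  Put 14 (Reg 29 `* Reg 0 `+ 15@[Reg 29]) (Reg 20) ;;
  Put 15 (Reg 29) (15@[Reg 29] `+ Cst 1) ;;
  Put 13 (Reg 20) (Reg 29 `+ Cst 1).

(** * The lists of the radix heap *)

Section Lists.
Variables (n L : nat).

Definition lst (q sz : nat -> nat) (l : nat) : seq nat :=
  [seq q (l * n + p) | p <- iota 0 (sz l)].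

(* List l is stored from cell l * n of array q on.  A node that has moved on to a
   higher level may still be listed at its old levels, and the nodes in P may be
   missing from the list of their level. *)
Record lists_wf (P : pred nat) (lv q sz : nat -> nat) : Prop := ListsWf {
  lw_lvl : forall v, v < n -> lv v <= L.+2;
  lw_uniq : forall l, l <= L -> uniq (lst q sz l);
  lw_lst : forall l v, l <= L -> v \in lst q sz l -> v < n /\ l < lv v;
  lw_in : forall v, v < n -> ~~ P v -> 0 < lv v <= L.+1 -> v \in lst q sz (lv v).-1 }.

Lemma lst_size_le P lv q sz l : lists_wf P lv q sz -> l <= L -> sz l <= n.
Proof.
move=> wf lL; have := uniq_leq_size (lw_uniq wf lL) (s2 := iota 0 n).
rewrite size_map !size_iota; apply => v /(lw_lst wf lL)[vn _].
by rewrite mem_iota.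
Qed.

Lemma lists_wf_ext P lv q sz lv' q' sz' : lv =1 lv' -> q =1 q' -> sz =1 sz' ->
  lists_wf P lv q sz -> lists_wf P lv' q' sz'.
Proof.
move=> e1 e2 e3 [h1 h2 h3 h4].
have el l : lst q' sz' l = lst q sz l.
  by rewrite /lst e3; apply: eq_map => p; rewrite e2.
split.
- by move=> v vn; rewrite -e1 h1.
- by move=> l lL; rewrite el h2.
- by move=> l v lL; rewrite el -e1; apply: h3.
- by move=> v vn Pv; rewrite el -e1; apply: h4.
Qed.

Lemma lists_wf_sub (P P' : pred nat) lv q sz : (forall v, P v -> P' v) ->
  lists_wf P lv q sz -> lists_wf P' lv q sz.
Proof.
move=> pp [h1 h2 h3 h4]; split=> // v vn nP'; apply: h4 => //.
by apply: contra nP'; apply: pp.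
Qed.

(** All entries of list [l], stale or not, satisfy [l < lv], so a node with [lv v <= l] is new
    there. Hence no list has repetitions or outgrows its block of [n] cells. *)
Lemma lists_wf_push (P P' : pred nat) lv q sz v l : lists_wf P lv q sz -> v < n ->
  l <= L -> lv v <= l -> (forall u, P u -> (u == v) || P' u) ->
  lists_wf P' (upd lv v l.+1) (upd q (l * n + sz l) v) (upd sz l (sz l).+1).
Proof.
move=> wf vn lL lvl PP.
have vl : v \notin lst q sz l.
  by apply/negP => /(lw_lst wf lL)[_]; rewrite ltnNge lvl.
have szn : sz l < n.
  have := uniq_leq_size (s1 := v :: lst q sz l) (s2 := iota 0 n).
  rewrite /= vl (lw_uniq wf lL) size_map !size_iota; apply=> // u.
  by rewrite inE mem_iota => /predU1P[->//|/(lw_lst wf lL)[]].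
have el : lst (upd q (l * n + sz l) v) (upd sz l (sz l).+1) l = rcons (lst q sz l) v.
  rewrite /lst updx -addn1 iotaD map_cat cats1 /= updx; congr rcons.
  apply/eq_in_map => p; rewrite mem_iota add0n /= => ps; rewrite updN //.
  by rewrite eqn_add2l ltn_eqF.
have eo k : k <= L -> k != l ->
    lst (upd q (l * n + sz l) v) (upd sz l (sz l).+1) k = lst q sz k.
  move=> kL kl; rewrite /lst updN //; apply/eq_in_map => p; rewrite mem_iota => /andP[_ pk].
  rewrite updN //; apply: contraNneq kl => E.
  have pn : p < n by apply: leq_trans pk (lst_size_le wf kL).
  by have [->] := cell_inj pn szn E.
split.
- by move=> u un; case: (eqVneq u v) => [->|uv]; rewrite ?updx ?updN // ?(lw_lvl wf) // ltnS leqW.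
- move=> k kL; case: (eqVneq k l) => [->|kl]; last by rewrite eo // (lw_uniq wf).
  by rewrite el rcons_uniq vl (lw_uniq wf).
- move=> k u kL; case: (eqVneq k l) => [->|kl].
    rewrite el mem_rcons inE => /predU1P[->|ul]; first by rewrite updx.
    have [un lu] := lw_lst wf lL ul; case: (eqVneq u v) => [->|uv].
      by rewrite updx.
    by rewrite updN.
  rewrite eo // => /(lw_lst wf kL)[un lu]; case: (eqVneq u v) => [E|uv].
    rewrite E updx; split=> //; move: lu lvl; rewrite E; clear; lia.
  by rewrite updN.
- move=> u un nP; case: (eqVneq u v) => [->|uv].
    by rewrite updx /= el mem_rcons inE eqxx.
  rewrite updN // => lu; have lu' := lu; have [nPu] : ~~ P u.
    by apply: contra nP => /PP; rewrite (negbTE uv).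
  have uin := lw_in wf un nPu lu'.
  case: (eqVneq (lv u).-1 l) => [E|ne]; first by rewrite E el mem_rcons inE -E uin orbT.
  by rewrite eo //; move: lu; clear; lia.
Qed.

(** The popped entry may be stale. If it is current, its node is the only one missing from the list
    of its level until it is pushed again or settled. *)
Lemma lists_wf_pop lv q sz l : lists_wf pred0 lv q sz -> l <= L -> 0 < sz l ->
  let v := q (l * n + (sz l).-1) in
  [/\ v < n, l < lv v &
      lists_wf (fun u => (u == v) && (lv u == l.+1)) lv q (upd sz l (sz l).-1)].
Proof.
move=> wf lL s0 v.
have el : lst q sz l = rcons (lst q (upd sz l (sz l).-1) l) v.
  rewrite /lst updx -{1}(prednK s0) -addn1 iotaD map_cat /= cats1 -/v.
  by [].
have eo k : k != l -> lst q (upd sz l (sz l).-1) k = lst q sz k.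
  by move=> kl; rewrite /lst updN.
have vl : v \in lst q sz l by rewrite el mem_rcons inE eqxx.
have [vn lv_v] := lw_lst wf lL vl.
split=> //; split; first exact: lw_lvl wf.
- move=> k kL; case: (eqVneq k l) => [->|kl]; last by rewrite eo // (lw_uniq wf).
  by have := lw_uniq wf lL; rewrite el rcons_uniq => /andP[].
- move=> k u kL; case: (eqVneq k l) => [->|kl]; last by rewrite eo //; apply: (lw_lst wf).
  by move=> ul; apply: (lw_lst wf) => //; rewrite el mem_rcons inE ul orbT.
- move=> u un nP lu; have uin := lw_in wf un isT lu.
  case: (eqVneq (lv u).-1 l) => [E|ne]; last by rewrite eo.
  have E2 : lv u = l.+1 by move: lu E; clear; lia.
  move: nP; rewrite E2 eqxx andbT => uv.
  by move: uin; rewrite E el mem_rcons inE (negbTE uv).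
Qed.

End Lists.

(** * Offering a label to a node *)

Definition copy_prog : cmd :=
  26 <-- Cst 0 ;;
  While (Reg 26 `< Reg 3)
    (Put 12 (Reg 20 `* Reg 2 `+ (Cst 2 `* Reg 26 `+ Cst 1)) (16@[Reg 26]) ;;
     26 <-- Reg 26 `+ Cst 1).

(** For an unreached node array 13 holds 0: truncated subtraction starts the scan at level 0, and
    the last test always leads to a push. *)
Definition offer_prog : cmd :=
  cand_prog ;;
  If ((Reg 24 `= Cst 0) `* ((13@[Reg 20] `= Cst 0) `+ Reg 25))
    (copy_prog ;;
     27 <-- 13@[Reg 20] ;;
     29 <-- Reg 27 `- Cst 1 ;;
     advance_prog ;;
     If (Reg 29 `+ Cst 1 `= Reg 27) Skip push_prog)
    Skip.

Section Offer.
Variables (W N : nat).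
Hypothesis WN : fits W N.
Variables (n m d : nat) (A : nat -> nat -> nat).
Hypothesis (n_gt0 : 0 < n) (HN : 4 * (n + m + d) + d * n + 8 <= N).
Hypothesis evd : ~~ odd d.
Hypothesis prd : forall v, v < n -> 0 < A 1 v <= d.
Local Notation prepared := (prepared n m d A).
Local Notation pr := (A 1).
Local Notation h := (d./2).
Local Notation B := (bits n).
Local Notation L := (d * bits n).
Local Notation key := (row_key n d).
Local Notation small_row := (small_row n d).

Lemma row_bitE s (e : expr) r l : prepared s -> evalp s e = r -> reg s 29 = l ->
  small_row s r -> l < L ->
  evalp s (row_bit e) = (key s r %/ 2 ^ (L - l.+1)) %% 2.
Proof.
move=> P er rl sm lL; have [[k0 k1 k2 kA] p1 p2 p3 p4 p5 p6] := P.
rewrite /= er rl k2 p3 key_bit // p4; last first.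
  by have := bits_gt0 n; clear; lia.
by move: (_ %/ 2 ^ _) => y; clear; lia.
Qed.

(** Row [r] stands for [X] in the bits from [l0] on only. A row of zeros can thus replace any [X]
    whose lower bits vanish. *)
Lemma advance_ok s v r X l0 : bounded N s -> prepared s ->
  reg s 20 = v -> reg s 22 = r -> reg s 29 = l0 -> small_row s v -> small_row s r ->
  l0 <= L -> key s v %/ 2 ^ (L - l0) = X %/ 2 ^ (L - l0) ->
  (forall l, l0 <= l < L -> (key s r %/ 2 ^ (L - l.+1)) %% 2 = (X %/ 2 ^ (L - l.+1)) %% 2) ->
  wp W N advance_prog s (fun t s' => exists l, [/\ reg s' 29 = l,
    [/\ l0 <= l <= L, key s v %/ 2 ^ (L - l) = X %/ 2 ^ (L - l) &
        l < L -> key s v %/ 2 ^ (L - l.+1) <> X %/ 2 ^ (L - l.+1)],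
    [/\ forall x, x != 29 -> reg s' x = reg s x & forall a, arr s' a =1 arr s a] &
    t <= 120 * (l - l0) + 120]).
Proof.
move=> bs P r20 r22 r29 sv sr l0L pre bits_r.
apply: wp_frame.
pose I k s' := exists l, [/\ [/\ l0 <= l <= L & k = 120 * (L - l)],
  key s v %/ 2 ^ (L - l) = X %/ 2 ^ (L - l), reg s' 29 = l,
  forall x, x != 29 -> reg s' x = reg s x & forall a, arr s' a = arr s a].
have Ps s' l : reg s' 29 = l -> (forall x, x != 29 -> reg s' x = reg s x) ->
    (forall a, arr s' a = arr s a) -> prepared s'.
  move=> h1 h2 h3; apply: (@prepared_frame _ _ _ _ (29 <-- Cst 0) s s') => //; split=> // x.
    by rewrite inE; apply: h2.
  by move=> _ j; rewrite h3.
have Ec s' l : reg s' 29 = l -> (forall x, x != 29 -> reg s' x = reg s x) ->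
    (forall a, arr s' a = arr s a) -> l0 <= l <= L ->
    key s v %/ 2 ^ (L - l) = X %/ 2 ^ (L - l) ->
    evalp s' ((Reg 29 `< Reg 4) `* (row_bit (Reg 20) `= row_bit (Reg 22))) =
    (l < L) && (key s v %/ 2 ^ (L - l.+1) == X %/ 2 ^ (L - l.+1)) :> nat.
  move=> h1 h2 h3 /andP[l0l lL] prel; have P' := Ps _ _ h1 h2 h3.
  have -> : evalp s' ((Reg 29 `< Reg 4) `* (row_bit (Reg 20) `= row_bit (Reg 22))) =
     (reg s' 29 < reg s' 4) * (evalp s' (row_bit (Reg 20)) == evalp s' (row_bit (Reg 22))) by [].
  rewrite h1 (pp_L P'); case: ltnP => // lt; rewrite mul1n.
  have sm' x : small_row s x -> small_row s' x by move=> sx j jd; rewrite h3; apply: sx.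
  have ek x : key s' x = key s x by rewrite /row_key h3.
  rewrite (@row_bitE s' _ v l) ?(@row_bitE s' _ r l) ?ek //=; try by [rewrite h2 | apply: sm'].
  rewrite bits_r ?l0l //.
  have half x : x %/ 2 ^ (L - l.+1) %/ 2 = x %/ 2 ^ (L - l).
    by rewrite -divnMA -expnSr; congr (_ %/ 2 ^ _); move: lt; clear; lia.
  have := half X; rewrite -prel -half.
  by move: (_ %/ 2 ^ _) (_ %/ 2 ^ _) => a b; clear; lia.
apply: (wp_while WN (I := I) (k0 := 120 * (L - l0))) => //.
- by exists l0; split=> //; rewrite leqnn.
- move=> k s' bs' [l [[/andP[l0l lL] ->] prel h1 h2 h3]].
  rewrite (Ec s' l) ?l0l ?lL //; case: (ltnP l L) => //= lt; rewrite eqb0 negbK => /eqP El.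
  apply: (wp_assign WN) => //=; first by rewrite h1; have := bs'.1 4; rewrite h2 // (pp_L P); move: lt; clear; lia.
  exists (120 * (L - l.+1)); last by move: lt; clear; lia.
  exists l.+1; split=> //=; rewrite ?h1 ?addn1 //.
  + by split=> //; rewrite lt andbT leqW.
  + by move=> x x29; rewrite (negbTE x29) h2.
- move=> t k s' [l [[/andP[l0l lL] ->] prel h1 h2 h3]].
  rewrite (Ec s' l) ?l0l ?lL // => E le _; exists l; split=> //.
  + split=> //; first by rewrite l0l.
    by move=> lt El; move: E; rewrite lt El eqxx.
  + by split=> // a j; rewrite h3.
  + by move: le lL l0l => /=; clear; lia.
Qed.

Variables (rk mu_digit : nat -> nat -> nat).
Hypothesis rk_le : forall i x, i < h -> x < n -> rk i x <= n.
Local Notation rowval := (row_value n d).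
Local Notation digit := (row_digit d).

Record rows_ok (s : state) : Prop := RowsOk {
  ro_prep : prepared s;
  ro_rk : forall v i, v < n -> i < h -> arr s 12 (v * d + 2 * i) = rk i v;
  ro_zero : forall j, j < d -> arr s 12 (n * d + j) = 0;
  ro_mu : forall w j, w < n -> j < h -> digit s (n.+1 + w) j = mu_digit w j;
  ro_dig : forall v j, v < n -> j < h -> digit s v j < n }.

Definition node_value (s : state) (v : nat) : nat :=
  if arr s 13 v == 0 then n ^ h else rowval s v.

(* The heap is addressed relative to X, the key extracted last.  Array 13 holds 0
   for the nodes not reached yet, L + 2 for the settled ones, and l + 1 for the
   queued ones of level l, whose keys have exactly the first l bits of X; they
   are in list l of array 14, of length arr 15 l. *)
Definition placed_at (s : state) (X v : nat) : Prop :=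
  let l := (arr s 13 v).-1 in
  key s v %/ 2 ^ (L - l) = X %/ 2 ^ (L - l) /\
  (l < L -> X %/ 2 ^ (L - l.+1) < key s v %/ 2 ^ (L - l.+1)).

Record queue_ok (s : state) (X : nat) : Prop := QueueOk {
  qo_X : X < 2 ^ L;
  qo_wf : lists_wf n L pred0 (arr s 13) (arr s 14) (arr s 15);
  qo_placed : forall v, v < n -> 0 < arr s 13 v <= L.+1 -> placed_at s X v;
  qo_settled : forall v, v < n -> arr s 13 v = L.+2 -> key s v <= X }.

Lemma n_lt_pow : n < 2 ^ B.
Proof. by rewrite ltnNge bits_lt // ltnn. Qed.

Lemma small_node s v : rows_ok s -> v < n -> small_row s v.
Proof.
move=> R vn j jd; have := odd_double_half j; rewrite -mul2n.
case: (odd j) => /= <-.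
  have jh : j./2 < h by move: jd evd; clear; lia.
  rewrite addnC; apply: leq_ltn_trans n_lt_pow; apply: ltnW.
  by have := ro_dig R vn jh; rewrite /row_digit; congr (arr s 12 _ < n); clear; lia.
have jh : j./2 < h by move: jd evd; clear; lia.
by rewrite add0n (ro_rk R) //; apply: leq_ltn_trans n_lt_pow; apply: rk_le.
Qed.

Lemma small_zero s : rows_ok s -> small_row s n.
Proof. by move=> R j jd; rewrite (ro_zero R) // expn_gt0. Qed.

(* Row v is overwritten at its digits only. *)
Definition other_cells (s s' : state) (v : nat) : Prop :=
  forall x, (forall j, j < h -> x != v * d + (2 * j + 1)) -> arr s' 12 x = arr s 12 x.

Lemma other_rank s s' v u i : other_cells s s' v -> u < n -> i < h ->
  arr s' 12 (u * d + 2 * i) = arr s 12 (u * d + 2 * i).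
Proof.
move=> oc un ih; apply: oc => j jh; apply/eqP => E.
by have [||_] := cell_inj _ _ E; move: ih jh evd; clear; lia.
Qed.

Lemma other_row s s' v u j : other_cells s s' v -> u != v -> j < d ->
  arr s' 12 (u * d + j) = arr s 12 (u * d + j).
Proof.
move=> oc uv jd; apply: oc => k kh; apply/eqP => E.
by have [||E2] := cell_inj _ _ E; move: kh jd uv evd; rewrite ?E2 ?eqxx //; clear; lia.
Qed.

Lemma other_digit s s' v u j : other_cells s s' v -> u != v -> j < h ->
  digit s' u j = digit s u j.
Proof. by move=> oc uv jh; apply: other_row oc uv _; move: jh evd; clear; lia. Qed.

Lemma other_row_value s s' v u : other_cells s s' v -> u != v -> rowval s' u = rowval s u.
Proof.
move=> oc uv; rewrite /row_value /tail_value; congr value; apply/eq_in_map => j.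
by rewrite mem_iota => /andP[_ jh]; apply: other_digit oc uv _; move: jh; clear; lia.
Qed.

Lemma other_key s s' v u : other_cells s s' v -> u != v -> key s' u = key s u.
Proof.
move=> oc uv; rewrite /row_key; congr value; apply/eq_in_map => j.
by rewrite mem_iota => /andP[_ jh]; apply: other_row oc uv _; move: jh; clear; lia.
Qed.

(** Component numbers belong to the node and not to its label, so two keys of one node first differ
    at a digit of the label. *)
Lemma key_mono s s' v : rows_ok s -> rows_ok s' -> v < n ->
  rowval s v < rowval s' v -> key s v < key s' v.
Proof.
move=> R R' vn; rewrite /row_value /tail_value => lt.
have sz (f : nat -> nat) : size [seq f i | i <- iota 0 (h - 0)] = h.
  by rewrite size_map size_iota subn0.
have nthE (f : nat -> nat) i : i < h -> nth 0 [seq f i | i <- iota 0 (h - 0)] i = f i.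
  by move=> ih; rewrite (nth_map 0) ?size_iota ?subn0 // nth_iota.
have al : all (gtn n) [seq digit s' v i | i <- iota 0 (h - 0)].
  apply/allP => x /mapP[i]; rewrite mem_iota subn0 => ih -> /=; exact: (ro_dig R').
have [|j [jh le ltj]] := value_first_diff _ al lt; first by rewrite !sz.
rewrite sz in jh; rewrite !nthE // in ltj.
apply: (@key_lt_at _ _ _ _ _ _ (2 * j + 1)) => //.
- exact: small_node.
- by move: jh evd; clear; lia.
move=> i ij; have := odd_double_half i; rewrite -mul2n; case: (odd i) => /= Ei.
  have ih : i./2 < j by move: ij Ei; clear; lia.
  have := le _ ih; rewrite !nthE; try exact: ltn_trans jh.
  have Ei' : 2 * i./2 + 1 = i by move: Ei; clear; lia.
  by rewrite /row_digit Ei' => ->.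
have ih : i./2 < h by move: ij Ei jh; clear; lia.
by rewrite -Ei add0n !(ro_rk R, ro_rk R').
Qed.

Lemma rows_ok_other s s' v : rows_ok s -> prepared s' -> v < n -> other_cells s s' v ->
  (forall j, j < h -> digit s' v j < n) -> rows_ok s'.
Proof.
move=> R P vn oc dv; split=> //.
- by move=> u i un ih; rewrite (other_rank oc) // (ro_rk R).
- by move=> j jd; rewrite (other_row oc) ?(ro_zero R) //; move: vn; clear; lia.
- by move=> w j wn jh; rewrite (other_digit oc) ?(ro_mu R) //; move: vn; clear; lia.
- move=> u j un jh; case: (eqVneq u v) => [->|uv]; first exact: dv.
  by rewrite (other_digit oc) ?(ro_dig R).
Qed.

Lemma row_value_lt s v : rows_ok s -> v < n -> rowval s v < n ^ h.
Proof.
move=> R vn; rewrite -[h in n ^ h]subn0; apply: tail_value_lt => // i /andP[_].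
exact: ro_dig.
Qed.

Lemma key_zero s : rows_ok s -> key s n = 0.
Proof.
move=> R; rewrite /row_key.
have -> : [seq arr s 12 (n * d + j) | j <- iota 0 d] = nseq d 0.
  apply: (@eq_from_nth _ 0); rewrite size_map size_iota ?size_nseq // => j jd.
  by rewrite (nth_map 0) ?size_iota // nth_iota // nth_nseq jd (ro_zero R).
by elim: d => //= k IH; rewrite /value /= mul0n.
Qed.

Lemma node_value_le s v : rows_ok s -> v < n -> node_value s v <= n ^ h.
Proof. by move=> R vn; rewrite /node_value; case: eqP => // _; apply/ltnW/row_value_lt. Qed.

Lemma nN : n <= N. Proof. by move: HN; clear; lia. Qed.

Lemma levels_le_N : L.+2 <= N.
Proof.
have : d * B <= d * n by rewrite leq_mul2l bits_le ?orbT.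
by move: HN; move: (d * B) => x; clear; lia.
Qed.

Lemma copy_ok s v : bounded N s -> reg s 3 = h -> reg s 2 = d -> reg s 20 = v ->
  wp W N copy_prog s (fun t s' => [/\ forall j, j < h -> digit s' v j = arr s 16 j,
    other_cells s s' v, frame copy_prog s s' & t <= 40 * (h + 1)]).
Proof.
move=> bs r3 r2 r20; apply: wp_frame.
apply: wp_seq; apply: (wp_assign WN) => //=.
pose J i s' := [/\ [/\ reg s' 26 = i, reg s' 3 = h, reg s' 2 = d & reg s' 20 = v],
  forall j, arr s' 16 j = arr s 16 j,
  forall j, j < i -> digit s' v j = arr s 16 j & other_cells s s' v].
apply: (wp_for WN (J := J) (c := fun=> 25) (hi := h)).
- by split.
- by move=> i s1 [[]].
- move=> i s1 bs1 ih [[q26 q3 q2 q20] h1 h2 h3].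
  apply: wp_seq; apply: (wp_put WN) => //=; first exact: bs1.2.
  apply: (wp_assign WN) => //=; first by rewrite q26; have := bs1.1 3; rewrite q3; move: ih; clear; lia.
  rewrite q26 q20 q2 h1; split; last by clear; lia.
  split=> //=; first by rewrite addn1.
    move=> j; rewrite ltnS leq_eqVlt /row_digit /= => /predU1P[->|ji].
      by rewrite eqxx.
    case: eqP => [E|_]; last exact: h2.
    by have : j = i by [move: E; clear; lia]; move: ji; clear; lia.
  move=> x nx /=; rewrite (negbTE (nx i ih)); exact: h3.
- move=> t s1 [[q26 q3 q2 q20] h1 h2 h3] le fr; split=> //.
  by move: le; rewrite sum_nat_const card_ord; clear; lia.
Qed.

Definition sizes (s : state) : nat := \sum_(l < L.+1) arr s 15 l.

Lemma sizes_eq s s' : (forall l, arr s' 15 l = arr s 15 l) -> sizes s' = sizes s.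
Proof. by move=> E; apply: eq_bigr => l _; rewrite E. Qed.

Lemma sizes_upd s s' l k : l <= L -> (forall j, arr s' 15 j = upd (arr s 15) l k j) ->
  sizes s' + arr s 15 l = sizes s + k.
Proof.
move=> lL E; have lt : l < L.+1 by [].
have nl j : j != l -> upd (arr s 15) l k j = arr s 15 j by apply: updN.
have := @sum_change L.+1 (arr s 15) (upd (arr s 15) l k) l lt nl.
by rewrite updx => <-; congr (_ + _); apply: eq_bigr => j _; rewrite E.
Qed.

(** An improving offer must neither reach a settled node nor give a key below [X]. The latter is
    demanded of every state in which [v] has label [y], since the state after the copy is not yet at
    hand. *)
Lemma offer_ok s v r ref X : bounded N s -> rows_ok s -> queue_ok s X -> v < n ->
  reg s 20 = v -> reg s 21 = r -> reg s 22 = ref ->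
  (forall j, j < h -> digit s r j < n) -> small_row s ref ->
  (forall l, l < L -> (key s ref %/ 2 ^ (L - l.+1)) %% 2 = (X %/ 2 ^ (L - l.+1)) %% 2) ->
  let y := liftl n d (pr v) (rowval s r) in
  (y < node_value s v -> [/\ v != ref, arr s 13 v <= L.+1 &
     forall s', rows_ok s' -> rowval s' v = y -> X <= key s' v]) ->
  wp W N offer_prog s (fun t s' => [/\ rows_ok s', queue_ok s' X,
    [/\ other_cells s s' v, forall u, u != v -> arr s' 13 u = arr s 13 u &
        node_value s' v = minn (node_value s v) y],
    (if y < node_value s v then arr s 13 v <= arr s' 13 v <= L.+1 /\ 0 < arr s' 13 v
     else arr s' 13 v = arr s 13 v /\ arr s' 12 =1 arr s 12) &
    sizes s' <= sizes s + (arr s' 13 v - arr s 13 v) /\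
    t <= 400 * (h + 1) + 200 * (arr s' 13 v - arr s 13 v)]).
Proof.
move=> bs R Q vn r20 r21 r22 dr sref refX y up; apply: wp_frame.
have P := ro_prep R; have [K p1 p2 p3 p4 p5 p6] := P.
have k2 : reg s 2 = d by case: K.
apply: wp_seq; apply: wp_frame.
apply: wp_mono (cand_ok WN n_gt0 HN evd prd bs K p1 vn r20 r21 dr (fun j => ro_dig R vn)).
move=> t1 s1 [c16 c24 cy c25 t1le] fr1.
rewrite -/y in c24 cy.
have a1 a x : a != 16 -> arr s1 a x = arr s a x by move=> a16; rewrite fr1.2 //= inE.
have g1 x : x \notin regs_of cand_prog -> reg s1 x = reg s x by apply: fr1.1.
apply: wp_bounded => bs1.
have yh : y <= n ^ h.
  apply: lift_le_top; apply: ltnW; rewrite -[h in n ^ h]subn0.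
  by apply: tail_value_lt => // i /andP[_]; apply: dr.
apply: (wp_if WN) => //=; rewrite (g1 20) // r20 a1 // c25 => cnd; last first.
  apply: wp_skip => fr.
  have ny : (y < node_value s v) = false.
    apply/negbTE; rewrite -leqNgt; case: (boolP (reg s1 24 == 0)) => r24.
      move: cnd; rewrite r24 mul1n addn_eq0 eqb0 => /andP[nl].
      by rewrite eqb0 -leqNgt cy // /node_value (negbTE nl).
    by apply: leq_trans (node_value_le R vn) _; rewrite leqNgt -c24.
  have es a x : a != 16 -> arr s1 a x = arr s a x by apply: a1.
  have ek x : key s1 x = key s x.
    by rewrite /row_key; congr value; apply: eq_map => j; rewrite es.
  have erv x : rowval s1 x = rowval s x.
    by rewrite /row_value /tail_value; congr value; apply: eq_map => j; rewrite /row_digit es.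
  rewrite ny; split=> //.
  + apply: (rows_ok_other R _ vn _ _) => [|x _|j jh].
    * exact: prepared_frame (isT : harmless cand_prog) fr1 P.
    * by rewrite es.
    * by rewrite /row_digit es //; apply: (ro_dig R).
  + split.
    * exact: qo_X Q.
    * by apply: lists_wf_ext (qo_wf Q) => j; rewrite es.
    * move=> u un; rewrite es // => lu; rewrite /placed_at es // ek.
      exact: (qo_placed Q un lu).
    * by move=> u un; rewrite es // ek; apply: (qo_settled Q un).
  + split=> [x _|u _|]; rewrite ?es //.
    rewrite /node_value es // erv (minn_idPl _) //.
    by move: ny; rewrite /node_value => /negbT; rewrite -leqNgt.
  + by rewrite es; split=> // x; rewrite es.
  + split; first by rewrite (sizes_eq (s' := s1) (s := s)) ?leq_addr // => l; rewrite es.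
    by move: t1le; clear; lia.
have r24 : reg s1 24 == 0 by move: cnd; case: (reg s1 24 == 0).
have yn : y < n ^ h by rewrite -c24.
have yE := cy r24.
have yx : y < node_value s v.
  move: cnd; rewrite r24 mul1n addn_eq0 eqb0 negb_and negbK eqb0 negbK yE /node_value.
  by case: eqP.
have [vref lvL upX] := up yx.
rewrite yx.
apply: wp_seq.
have q3 : reg s1 3 = h by rewrite g1.
have q2 : reg s1 2 = d by rewrite g1.
have q20 : reg s1 20 = v by rewrite g1.
apply: wp_mono (copy_ok bs1 q3 q2 q20) => t2 s2 [cp oc fr2 t2le].
have P1 := prepared_frame (isT : harmless cand_prog) fr1 P.
have P2 := prepared_frame (isT : harmless copy_prog) fr2 P1.
have ec x : arr s1 12 x = arr s 12 x by rewrite a1.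
have oc' : other_cells s s2 v by move=> x /oc ->.
have R2 : rows_ok s2.
  by apply: (rows_ok_other R P2 vn oc' _) => j jh; rewrite cp ?c16.
have rv2 : rowval s2 v = y.
  rewrite -yE /row_value /tail_value; congr value; apply/eq_in_map => j.
  by rewrite mem_iota subn0 => jh; rewrite cp.
have a2 a x : a != 16 -> a != 12 -> arr s2 a x = arr s a x.
  by move=> h1 h2; rewrite fr2.2 ?a1 //= !inE.
have g2 x : x \notin regs_of cand_prog -> x != 26 -> reg s2 x = reg s x.
  by move=> h1 h2; rewrite fr2.1 ?g1 //= !inE !negb_or h2.
apply: wp_bounded => bs2.
apply: wp_seq; apply: (wp_assign WN) => //=; first exact: bs2.2.
apply: wp_seq; apply: (wp_assign WN) => //=.
  by rewrite g2 // r20; have := bs2.2 13 v; clear; lia.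
rewrite g2 // r20 a2 //; set lv := arr s 13 v in lvL *; set s3 := set_reg _ _ _.
have P3 : prepared s3 by do ?apply: prepared_set_reg.
have R3 : rows_ok s3 by case: R2 => *; split.
have kX : X <= key s2 v by apply: upX.
have k2L : key s2 v < 2 ^ L by apply/key_lt/small_node.
(* The new key lies between [X] and the old key, so it shares with [X] the prefix that the old one
   did. The scan resumes at the old level. *)
have pre : key s2 v %/ 2 ^ (L - lv.-1) = X %/ 2 ^ (L - lv.-1).
  case: (posnP lv) => [->|l0].
    by rewrite subn0 !divn_small ?(qo_X Q).
  have [E _] := qo_placed Q vn (introT andP (conj l0 lvL)).
  apply/eqP; rewrite eqn_leq [X in _ && X]leq_div2r // andbT -E leq_div2r //.
  apply: ltnW; apply: (key_mono R2 R vn); rewrite rv2; move: yx.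
  by rewrite /node_value -/lv eqn0Ngt l0.
apply: wp_bounded => bs3; apply: wp_seq.
apply: wp_mono (@advance_ok s3 v ref X lv.-1 bs3 P3 _ _ _ _ _ _ pre _) => //=.
- move=> t3 s4 [l [r29 [/andP[l0l lL] prel ne] [gr ar] t3le]].
  have r27 : reg s4 27 = lv by rewrite gr.
  have ar4 a x : a != 16 -> a != 12 -> arr s4 a x = arr s a x.
    by move=> h1 h2; rewrite ar /= a2.
  have a12 x : arr s4 12 x = arr s2 12 x by rewrite ar.
  have ek x : key s4 x = key s2 x.
    by rewrite /row_key; congr value; apply: eq_map => j; rewrite a12.
  have erv x : rowval s4 x = rowval s2 x.
    by rewrite /row_value /tail_value; congr value; apply: eq_map => j; rewrite /row_digit a12.
  have dl : l < L -> X %/ 2 ^ (L - l.+1) < key s2 v %/ 2 ^ (L - l.+1).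
    by move=> lt; rewrite ltn_neqAle leq_div2r // andbT; apply/eqP => E; apply: ne.
  have fin s5 t5 : prepared s5 -> (forall x, arr s5 12 x = arr s2 12 x) ->
      (forall u, arr s5 13 u = if u == v then l.+1 else arr s 13 u) ->
      lists_wf n L pred0 (arr s5 13) (arr s5 14) (arr s5 15) -> t5 <= 30 ->
      sizes s5 <= sizes s + (l.+1 - lv) ->
      [/\ rows_ok s5, queue_ok s5 X,
        [/\ other_cells s s5 v, forall u, u != v -> arr s5 13 u = arr s 13 u &
            node_value s5 v = minn (node_value s v) y],
        lv <= arr s5 13 v <= L.+1 /\ 0 < arr s5 13 v &
        sizes s5 <= sizes s + (arr s5 13 v - lv) /\
        t1 + (cost ((Reg 24 `= Cst 0) `* ((13@[Reg 20] `= Cst 0) `+ Reg 25)) +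
          (t2 + (3 + (4 + (t3 + t5))))).+1 <=
        400 * (h + 1) + 200 * (arr s5 13 v - lv)].
    move=> P5 h12 h13 wf5 t5le szle.
    have ek5 x : key s5 x = key s2 x.
      by rewrite /row_key; congr value; apply: eq_map => j; rewrite h12.
    have erv5 x : rowval s5 x = rowval s2 x.
      by rewrite /row_value /tail_value; congr value; apply: eq_map => j; rewrite /row_digit h12.
    have vv : arr s5 13 v = l.+1 by rewrite h13 eqxx.
    split.
    + apply: (rows_ok_other R P5 vn _ _) => [x nx|j jh]; first by rewrite h12 oc'.
      by rewrite /row_digit h12; apply: (ro_dig R2).
    + split=> //; first exact: qo_X Q.
        move=> u un; case: (eqVneq u v) => [->|uv].
          by rewrite vv /placed_at vv ek5.
        rewrite h13 (negbTE uv) => lu; rewrite /placed_at h13 (negbTE uv) ek5 (other_key oc' uv).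
        exact: (qo_placed Q un lu).
      move=> u un; rewrite h13 ek5; case: (eqVneq u v) => [_ E|uv].
        by move: lL E; clear; lia.
      by rewrite (other_key oc' uv); apply: (qo_settled Q un).
    + split.
      * by move=> x nx; rewrite h12 oc'.
      * by move=> u /negbTE uv; rewrite h13 uv.
      * rewrite (minn_idPr (ltnW yx)) /node_value vv /= erv5; exact: rv2.
    + by rewrite vv; split=> //; move: l0l lL; clear; lia.
    + rewrite vv; split=> //; move: t1le t2le t3le l0l t5le; clear; simpl cost; lia.
  have P4 : prepared s4.
    apply: (@prepared_frame _ _ _ _ (29 <-- Cst 0) s3) => //; split=> // x.
    by rewrite inE; apply: gr.
  apply: (wp_if WN) => //=; rewrite r29 r27 addn1 eqb0 ?negbK => /eqP El.
    apply: wp_skip => fr; apply: fin => //.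
    + by move=> u; rewrite ar4 //; case: eqP => [->|//]; rewrite El.
    + by apply: lists_wf_ext (qo_wf Q) => j; rewrite ar4.
    + by rewrite (sizes_eq (s' := s4) (s := s)) ?leq_addr // => j; rewrite ar4.
  apply: wp_seq; apply: (wp_put WN) => //=; first by rewrite gr //= g2 // r20; move: vn nN; clear; lia.
  apply: wp_seq; apply: (wp_put WN) => //=.
    rewrite r29 ar4 //; have := lst_size_le (qo_wf Q) lL; move: nN HN n_gt0; clear; nia.
  apply: (wp_put WN) => //=.
    by rewrite r29; have := levels_le_N; move: lL; clear; lia.
  have r20' : reg s4 20 = v by rewrite gr //= g2.
  have r0' : reg s4 0 = n by case: (pp_keeps P4).
  rewrite r20' r29 r0' addn1 (ar4 15) //= => _.
  apply: (fin (set_arr (set_arr (set_arr s4 14 (l * n + arr s 15 l) v) 15 l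
    (arr s 15 l).+1) 13 v (l + 1))) => //=.
  + by do ?apply: prepared_set_arr.
  + by move=> u; rewrite addn1; case: eqP => // _; rewrite ar4.
  + have lvl : arr s 13 v <= l by move: l0l El; rewrite -/lv; clear; lia.
    apply: lists_wf_ext (lists_wf_push (P' := pred0) (qo_wf Q) vn lL lvl _) => // u.
    * by rewrite /upd ar4 // addn1.
    * by rewrite /upd ar4.
    * by rewrite /upd ar4.
  + have := @sizes_upd s (set_arr (set_arr (set_arr s4 14 (l * n + arr s 15 l) v) 15 l
      (arr s 15 l).+1) 13 v (l + 1)) l (arr s 15 l).+1 lL.
    move=> /(_ _)/wrap[j|]; first by rewrite /= /upd ar4.
    by move: l0l El; rewrite -/lv; clear; lia.
- by rewrite g2.
- by rewrite g2.
- by rewrite subn1.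
- exact: (small_node R3 vn).
- by move=> j jd; rewrite (other_row oc') 1?eq_sym // sref.
- by move: lvL; clear; lia.
- move=> l /andP[_ lL]; have -> : key s3 ref = key s2 ref by [].
  by rewrite (other_key oc') 1?eq_sym // refX.
Qed.
End Offer.

(** * The main loop *)

Section ArcKeys.
Variables (n m d : nat) (A : nat -> nat -> nat) (rk mu_digit : nat -> nat -> nat).
Hypothesis (n_gt0 : 0 < n).
Hypothesis evd : ~~ odd d.
Hypothesis prd : forall v, v < n -> 0 < A 1 v <= d.
Hypothesis tails : forall e, e < m -> A 4 e < n.
Hypothesis heads : forall e, e < m -> A 5 e < n.
Local Notation pr := (A 1).
Local Notation h := (d./2).
Local Notation outs := (out_adj A m).
Local Notation key := (row_key n d).
Local Notation rowval := (row_value n d).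
Local Notation digit := (row_digit d).
Local Notation rows_ok := (rows_ok n m d A rk mu_digit).

Hypothesis rk_ok : forall i, i < h -> comp_ok n m A (d - 2 * i) (rk i).

Definition skipped (v w : nat) : bool :=
  [&& ~~ odd (pr v), pr w <= pr v & rk (d - pr v)./2 v == rk (d - pr v)./2 w].

Lemma rk_le i x : i < h -> x < n -> rk i x <= n.
Proof. by move=> ih; apply: (co_le (rk_ok ih)). Qed.

Lemma outs_lt v w : w \in outs v -> v < n /\ w < n.
Proof. by case/mem_adj_upto => e [em _ <- <-]; split; [apply: tails | apply: heads]. Qed.

Lemma rank_arc i v w : w \in outs v -> i < h -> pr v <= d - 2 * i -> rk i w <= rk i v.
Proof.
move=> vw ih pv; have [vn wn] := outs_lt vw.
case: (leqP (pr w) (d - 2 * i)) => pw.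
  by apply: (co_mono (rk_ok ih)); rewrite /hedge /level_set vn wn pv pw.
suff /eqP-> : rk i w == 0 by [].
by rewrite -[_ == _]negbK (co_in (rk_ok ih) wn) -ltnNge.
Qed.

Lemma rank_arc_lt v w : w \in outs v -> ~~ odd (pr v) -> ~~ skipped v w ->
  rk (d - pr v)./2 w < rk (d - pr v)./2 v.
Proof.
move=> vw ev nsk; have [vn wn] := outs_lt vw; have pv := prd vn.
have ih : (d - pr v)./2 < h by move: pv ev evd; clear; lia.
have Ed : d - 2 * (d - pr v)./2 = pr v by move: pv ev evd; clear; lia.
have le : rk (d - pr v)./2 w <= rk (d - pr v)./2 v by apply: rank_arc; rewrite ?Ed.
rewrite ltn_neqAle le andbT.
case: (leqP (pr w) (pr v)) => pw.
  by move: nsk; rewrite /skipped ev pw /= eq_sym.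
have /eqP-> : rk (d - pr v)./2 w == 0.
  by rewrite -[_ == _]negbK (co_in (rk_ok ih) wn) Ed -ltnNge.
by rewrite eq_sym (co_in (rk_ok ih) vn) Ed.
Qed.

Definition digits (s : state) (r : nat) : seq nat := [seq digit s r i | i <- iota 0 (h - 0)].

Lemma size_digits s r : size (digits s r) = h.
Proof. by rewrite size_map size_iota subn0. Qed.

Lemma nth_digits s r i : i < h -> nth 0 (digits s r) i = digit s r i.
Proof. by move=> ih; rewrite (nth_map 0) ?size_iota ?subn0 // nth_iota. Qed.

Lemma all_digits s v : rows_ok s -> v < n -> all (gtn n) (digits s v).
Proof.
move=> R vn; apply/allP => x /mapP[i]; rewrite mem_iota subn0 => ih -> /=.
exact: (ro_dig R).
Qed.

(** If the kept digits differ, the first difference decides, since the component numbers before it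
    belong to subgraphs containing [v] and do not grow towards [w]. If they agree, the priority is
    even, and the next cell is the component number for priorities at most [pr v], which is smaller
    at [w] because the arc is not skipped. With an inequality as hypothesis, this applies to any
    label of [v] at or above the offer. *)
Lemma key_arc_lt s s' v w : rows_ok s -> rows_ok s' -> w \in outs v -> ~~ skipped v w ->
  liftl n d (pr v) (rowval s w) <= rowval s' v -> key s w < key s' v.
Proof.
move=> R R' vw nsk Ev; have [vn wn] := outs_lt vw; have pv := prd vn.
set c := kept d (pr v).
have ch : c <= h by apply: kept_le; move: pv; clear; lia.
have K0 := unit_gt0 d n_gt0 (pr v).
have dv : value n (take c (digits s' v)) = rowval s' v %/ unit_of n d (pr v).
  by rewrite value_take ?all_digits ?size_digits.
have dw : value n (take c (digits s w)) = rowval s w %/ unit_of n d (pr v).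
  by rewrite value_take ?all_digits ?size_digits.
have sm : small_row n d s w by exact: (small_node n_gt0 evd rk_le R wn).
have ev i : i < h -> pr v <= d - 2 * i ->
    arr s 12 (w * d + 2 * i) <= arr s' 12 (v * d + 2 * i).
  by move=> ih pi; rewrite (ro_rk R) // (ro_rk R') // rank_arc.
have tk (t : seq nat) : all (gtn n) t -> all (gtn n) (take c t).
  by move=> al; apply/allP => x /mem_take; apply: (allP al).
have sz : size (take c (digits s w)) = size (take c (digits s' v)).
  by rewrite !size_takel ?size_digits.
have even_cell i : odd i = false -> i = 2 * i./2.
  by move=> oi; have := odd_double_half i; rewrite oi -mul2n; clear; lia.
have odd_cell i : odd i -> 2 * i./2 + 1 = i.
  by move=> oi; have := odd_double_half i; rewrite oi -mul2n; clear; lia.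
have top := row_value_lt R' vn.
have dle : value n (take c (digits s w)) + odd (pr v) <= value n (take c (digits s' v)).
  rewrite dv dw leq_divRL //; apply: (leq_trans _ Ev).
  rewrite /liftl; case: (boolP (odd _)) => op; last by rewrite addn0.
  rewrite addn1 leq_min leqnn andbT; move: Ev; rewrite /liftl op geq_min.
  by rewrite leqNgt top /= => le; apply: ltnW; apply: leq_ltn_trans le top.
case: (ltnP (value n (take c (digits s w))) (value n (take c (digits s' v)))) => [lt|ge].
  have [j [jc le ltj]] := value_first_diff sz (tk _ (all_digits R' vn)) lt.
  rewrite size_takel ?size_digits // in jc.
  have jh : j < h by apply: leq_trans ch.
  rewrite !nth_take // !nth_digits // in ltj.
  apply: (key_lt_at sm (j := 2 * j + 1)) => //; first by move: jh evd; clear; lia.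
  move=> i ij; case: (boolP (odd i)) => [oi|/negbTE oi].
    have ij2 : i./2 < j by move: ij (odd_cell _ oi); clear; lia.
    have ic : i./2 < c by apply: ltn_trans jc.
    have := le _ ij2; rewrite !nth_take // !nth_digits; try exact: leq_trans ch.
    by rewrite /row_digit odd_cell // => ->.
  rewrite (even_cell _ oi); apply: ev; first by move: ij jh; clear; lia.
  by move: ij jc pv evd; rewrite /c /kept; clear; lia.
have op : odd (pr v) = false by move: dle ge; clear; lia.
have Ec : c = (d - pr v)./2 by move: pv op evd; rewrite /c /kept; clear; lia.
have cd : c < h by rewrite Ec; move: pv op evd; clear; lia.
have Et : take c (digits s w) = take c (digits s' v).
  apply: (@value_inj n); rewrite ?tk ?all_digits //.
  by apply/eqP; rewrite eqn_leq ge andbT; apply: leq_trans dle; apply: leq_addr.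
apply: (key_lt_at sm (j := 2 * c)); first by move: cd evd; clear; lia.
  move=> i ic; case: (boolP (odd i)) => [oi|/negbTE oi].
    have ic2 : i./2 < c by move: ic (odd_cell _ oi); clear; lia.
    have := congr1 (fun t => nth 0 t i./2) Et; rewrite !nth_take // !nth_digits; try exact: leq_trans ch.
    by rewrite /row_digit odd_cell // => ->.
  rewrite (even_cell _ oi); apply: ev; first by move: ic ch; clear; lia.
  by move: ic Ec pv op evd; clear; lia.
rewrite (ro_rk R) // (ro_rk R') // Ec.
by apply: rank_arc_lt => //; rewrite op.
Qed.
End ArcKeys.

(* The arc from u to w is skipped if it closes a cycle through nodes of priority
   at most that of u, which is even: then u only receives the label of w in mu. *)
Definition skip_expr (u w : expr) : expr :=
  (1@[u] `= Cst 2 `* (1@[u] `/ Cst 2)) `* (1@[w] `< 1@[u] `+ Cst 1) `*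
  (12@[u `* Reg 2 `+ (Reg 2 `- 1@[u])] `= 12@[w `* Reg 2 `+ (Reg 2 `- 1@[u])]).

Definition relax_body : cmd :=
  20 <-- 4@[Reg 33 `- Cst 1] ;;
  If (skip_expr (Reg 20) (Reg 32)) Skip
     (21 <-- Reg 32 ;; 22 <-- Reg 32 ;; offer_prog) ;;
  33 <-- 9@[Reg 33 `- Cst 1].

Definition relax_prog : cmd :=
  33 <-- 8@[Reg 32] ;; While (Reg 33) relax_body.

(* When list Reg 31 is the deepest nonempty one, X is raised to the least value
   that exceeds it in the bit of that level; its lower bits being zero, the row n
   can stand for X. *)
Definition move_body : cmd :=
  Put 15 (Reg 31) (15@[Reg 31] `- Cst 1) ;;
  20 <-- 14@[Reg 31 `* Reg 0 `+ 15@[Reg 31]] ;;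
  If (13@[Reg 20] `= Reg 30)
    (29 <-- Reg 30 ;; 22 <-- Reg 0 ;; advance_prog ;; push_prog ;;
     If (Reg 34 `< Reg 29 `+ Cst 1) (34 <-- Reg 29 `+ Cst 1) Skip)
    Skip.

Definition move_prog : cmd :=
  34 <-- Reg 30 ;; While (15@[Reg 31]) move_body ;; 30 <-- Reg 34.

Definition settle_prog : cmd :=
  Put 15 (Reg 31) (15@[Reg 31] `- Cst 1) ;;
  32 <-- 14@[Reg 31 `* Reg 0 `+ 15@[Reg 31]] ;;
  If (13@[Reg 32] `= Reg 4 `+ Cst 1)
     (Put 13 (Reg 32) (Reg 4 `+ Cst 2) ;; relax_prog)
     Skip.

(** Register 30 is one above the deepest list that may be nonempty. Current entries of list [L] have
    key [X] and are settled; any other list is redistributed. *)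
Definition main_body : cmd :=
  31 <-- Reg 30 `- Cst 1 ;;
  If (15@[Reg 31] `= Cst 0) (30 <-- Reg 30 `- Cst 1)
    (If (Reg 31 `= Reg 4) settle_prog move_prog).

Definition main_prog : cmd :=
  30 <-- Reg 4 `+ Cst 1 ;; While (Reg 30) main_body.

Section Main.
Variables (W N : nat).
Hypothesis WN : fits W N.
Variables (n m d : nat) (A : nat -> nat -> nat) (rk mu_digit : nat -> nat -> nat).
Hypothesis (n_gt0 : 0 < n) (HN : 4 * (n + m + d) + d * n + 8 <= N).
Hypothesis evd : ~~ odd d.
Hypothesis prd : forall v, v < n -> 0 < A 1 v <= d.
Hypothesis tails : forall e, e < m -> A 4 e < n.
Hypothesis heads : forall e, e < m -> A 5 e < n.
Local Notation pr := (A 1).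
Local Notation h := (d./2).
Local Notation L := (d * bits n).
Local Notation outs := (out_adj A m).
Local Notation ins := (in_adj A m).
Local Notation key := (row_key n d).
Local Notation rowval := (row_value n d).
Local Notation xval := (node_value n d).
Local Notation rows_ok := (rows_ok n m d A rk mu_digit).
Local Notation queue_ok := (queue_ok n d).
Local Notation sizes := (sizes n d).
Local Notation skipped := (skipped d A rk).
Local Notation lift v x := (liftl n d (pr v) x).

Hypothesis rk_ok : forall i, i < h -> comp_ok n m A (d - 2 * i) (rk i).
Variable mu_value : nat -> nat.
Hypothesis mu_arc : forall v w, w \in outs v -> mu_value v <= lift v (mu_value w).

(* pend v w: the arc from v to the settled node w is still to be relaxed. *)
Record dijkstra (pend : nat -> nat -> bool) (s : state) : Prop := Dijkstra {
  dj_rows : rows_ok s;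
  dj_mu : forall v, v < n -> mu_value v <= xval s v;
  dj_skip : forall v w, w \in outs v -> skipped v w -> xval s v <= lift v (mu_value w);
  dj_arc : forall v w, w \in outs v -> ~~ skipped v w -> arr s 13 w = L.+2 ->
     ~~ pend v w -> xval s v <= lift v (xval s w);
  dj_att : forall v, v < n -> arr s 13 v != 0 ->
     (exists2 w, w \in outs v /\ skipped v w & xval s v = lift v (mu_value w)) \/
     (exists2 w, w \in outs v /\ ~~ skipped v w &
        arr s 13 w = L.+2 /\ xval s v = lift v (xval s w)) }.

Definition unlevelled (s : state) : nat := \sum_(v < n) (L.+2 - arr s 13 v).

Definition unsettled (s : state) : nat :=
  \sum_(v < n) (if arr s 13 v == L.+2 then 0 else 1 + size (ins v)).

Lemma unlevelled_upd s s' v k : v < n -> (forall u, arr s' 13 u = upd (arr s 13) v k u) ->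
  unlevelled s' + (L.+2 - arr s 13 v) = unlevelled s + (L.+2 - k).
Proof.
move=> vn E.
have := @sum_change n (fun u => L.+2 - arr s 13 u) (fun u => L.+2 - upd (arr s 13) v k u) v vn.
rewrite updx => <- => [|u uv]; last by rewrite updN.
by congr (_ + _); apply: eq_bigr => u _; rewrite E.
Qed.

Lemma unsettled_upd s s' v k : v < n -> (forall u, arr s' 13 u = upd (arr s 13) v k u) ->
  arr s 13 v != L.+2 ->
  unsettled s' + (if k == L.+2 then 1 + size (ins v) else 0) = unsettled s.
Proof.
move=> vn E nv.
pose F u := if arr s 13 u == L.+2 then 0 else 1 + size (ins u).
pose F' u := if upd (arr s 13) v k u == L.+2 then 0 else 1 + size (ins u).
have nF u : u != v -> F' u = F u by move=> uv; rewrite /F' /F updN.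
have Fv : F v = 1 + size (ins v) by rewrite /F (negbTE nv).
have F'v : F' v = if k == L.+2 then 0 else 1 + size (ins v) by rewrite /F' updx.
have := sum_change vn nF; rewrite Fv F'v.
have -> : \sum_(u < n) F' u = unsettled s' by apply: eq_bigr => u _; rewrite /F' E.
have -> : \sum_(u < n) F u = unsettled s by [].
case: ifP => _ H; first by rewrite H addn0.
by rewrite addn0; apply: addIn H.
Qed.

Lemma skip_exprE s u w : rows_ok s -> u < n -> w < n ->
  reg s 20 = u -> reg s 32 = w -> w \in outs u ->
  (evalp s (skip_expr (Reg 20) (Reg 32)) != 0) = skipped u w.
Proof.
move=> R un wn ru rw uw; have [k0 k1 k2 kA] := pp_keeps (ro_prep R).
rewrite /= ru rw k2 !(kA 1) //; have pu := prd un.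
have -> : (pr u == 2 * (pr u %/ 2)) = ~~ odd (pr u) by clear; lia.
rewrite addn1 ltnS /skipped; case: (boolP (odd (pr u))) => //= op.
(* For an even priority, its distance to [d] is itself the column of the component number. *)
have E : d - pr u = 2 * (d - pr u)./2 by move: pu op evd; clear; lia.
have ih : (d - pr u)./2 < h by move: pu op evd; clear; lia.
rewrite {1 2}E !(ro_rk R) //.
by case: (_ <= _); case: (rk _ _ == _).
Qed.

Lemma dijkstra_pend (p p' : nat -> nat -> bool) s :
  (forall v w, w \in outs v -> ~~ skipped v w -> p v w -> p' v w) ->
  dijkstra p s -> dijkstra p' s.
Proof.
move=> pp [h1 h2 h3 h4 h5]; split=> // v w vw sk sw np.
by apply: h4 => //; apply: contra np; apply: pp.
Qed.

Lemma other_node_value s s' v u : other_cells d s s' v -> arr s' 13 u = arr s 13 u -> u != v ->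
  xval s' u = xval s u.
Proof.
by move=> oc E uv; rewrite /node_value E; case: ifP => // _; apply: (other_row_value n evd oc).
Qed.

Lemma dijkstra_relax (pend pend' : nat -> nat -> bool) s s' v w :
  (forall u x, pend u x -> pend' u x || ((u == v) && (x == w))) ->
  dijkstra pend s -> rows_ok s' -> w \in outs v -> ~~ skipped v w ->
  arr s 13 w = L.+2 -> other_cells d s s' v -> (forall u, u != v -> arr s' 13 u = arr s 13 u) ->
  xval s' v = minn (xval s v) (lift v (xval s w)) ->
  (if lift v (xval s w) < xval s v then arr s 13 v <= arr s' 13 v <= L.+1 /\ 0 < arr s' 13 v
   else arr s' 13 v = arr s 13 v) ->
  dijkstra pend' s'.
Proof.
move=> pp D R' vw nsk sw oc o13 xv; have [R dmu dsk darc datt] := D.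
have [vn wn] := outs_lt tails heads vw.
case: (ltnP (lift v (xval s w)) (xval s v)) => [lt [/andP[le1 le2] pos]|ge E13].
  have xv' : xval s' v = lift v (xval s w) by rewrite xv (minn_idPr (ltnW lt)).
  have wv : w != v by apply/eqP => E; move: sw le1 le2; rewrite E; clear; lia.
  have xo u : u != v -> xval s' u = xval s u by move=> uv; apply: (other_node_value oc) => //; apply: o13.
  have xle u : xval s' u <= xval s u.
    by case: (eqVneq u v) => [->|uv]; [rewrite xv'; apply: ltnW | rewrite xo].
  split=> //.
  - move=> u un; case: (eqVneq u v) => [->|uv]; last by rewrite xo ?dmu.
    (* The absence of loose arcs enters: an offer made from a label above [mu] is again above
       [mu]. *)
    rewrite xv'; apply: leq_trans (mu_arc vw) _; apply: lift_mono => //.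
    exact: dmu.
  - by move=> u x ux sk; apply: leq_trans (xle u) (dsk _ _ ux sk).
  - move=> u x ux sk sx np; have [un xn] := outs_lt tails heads ux.
    have xnv : x != v by apply/eqP => E; move: sx le2; rewrite E; clear; lia.
    rewrite (xo x) //; case: (boolP ((u == v) && (x == w))) => [/andP[/eqP-> /eqP->]|ne].
      by rewrite xv'.
    apply: leq_trans (xle u) (darc _ _ ux sk _ _); first by rewrite -o13.
    by apply: contra np => /pp; rewrite (negbTE ne) orbF.
  - move=> u un; case: (eqVneq u v) => [-> _|uv].
      by right; exists w => //; rewrite o13 // xv' (xo w).
    rewrite o13 // => lu; rewrite (xo u) //.
    case: (datt u un lu) => [|[x [ux sk] [sx Ex]]]; first by left.
    right; exists x => //; have xnv : x != v.
      by apply/eqP => E; move: sx le1 le2; rewrite E; clear; lia.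
    by rewrite o13 // xo.
have e13 u : arr s' 13 u = arr s 13 u by case: (eqVneq u v) => [->|/o13].
have xo u : xval s' u = xval s u.
  by case: (eqVneq u v) => [->|uv]; [rewrite xv (minn_idPl ge) | apply: (other_node_value oc)].
split=> //.
- by move=> u un; rewrite xo dmu.
- by move=> u x ux sk; rewrite xo dsk.
- move=> u x ux sk; rewrite e13 => sx np; rewrite !xo.
  case: (boolP ((u == v) && (x == w))) => [/andP[/eqP-> /eqP->] //|ne].
  apply: darc => //; apply: contra np => /pp; by rewrite (negbTE ne) orbF.
- move=> u un; rewrite e13 => /(datt u un)[[x h1 h2]|[x h1 [h2 h3]]].
    by left; exists x; rewrite ?xo.
  by right; exists x => //; rewrite e13 !xo.
Qed.


Lemma ins_outs v w : (v \in ins w) = (w \in outs v).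
Proof. by apply/mem_adj_upto/mem_adj_upto => -[e [h1 h2 h3 h4]]; exists e. Qed.

(* Pays for raising the levels of nodes and for emptying the lists. *)
Definition potential (s : state) : nat := 300 * unlevelled s + 100 * sizes s.

Lemma potential_eq s s' : (forall u, arr s' 13 u = arr s 13 u) ->
  (forall l, arr s' 15 l = arr s 15 l) -> potential s' = potential s.
Proof.
move=> e1 e2; rewrite /potential (sizes_eq n d e2); congr (300 * _ + _).
by apply: eq_bigr => u _; rewrite e1.
Qed.

(** Of the 300 units freed per level, up to 100 pay for a new list entry; the other 200 go to the
    comparison of bits. *)
Lemma potential_raise s s' v : v < n -> (forall u, u != v -> arr s' 13 u = arr s 13 u) ->
  arr s 13 v <= arr s' 13 v <= L.+2 -> sizes s' <= sizes s + (arr s' 13 v - arr s 13 v) ->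
  potential s' + 200 * (arr s' 13 v - arr s 13 v) <= potential s.
Proof.
move=> vn o13 lvl sz.
have E : forall u, arr s' 13 u = upd (arr s 13) v (arr s' 13 v) u.
  by move=> u; rewrite /upd; case: eqP => [->|/eqP/o13].
have := unlevelled_upd vn E; rewrite /potential; move: sz lvl; clear; lia.
Qed.

Lemma unsettled_eq s s' : (forall u, arr s' 13 u = arr s 13 u) -> unsettled s' = unsettled s.
Proof. by move=> e; apply: eq_bigr => u _; rewrite e. Qed.

Lemma rows_ok_eq s s' : prepared n m d A s' -> (forall j, arr s' 12 j = arr s 12 j) ->
  rows_ok s -> rows_ok s'.
Proof.
move=> P e [r1 r2 r3 r4 r5]; split=> //.
- by move=> v i vn ih; rewrite e r2.
- by move=> j jd; rewrite e r3.
- by move=> w j wn jh; rewrite /row_digit e; apply: r4.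
- by move=> v j vn jh; rewrite /row_digit e; apply: r5.
Qed.

Lemma key_eq s s' r : (forall j, arr s' 12 j = arr s 12 j) -> key s' r = key s r.
Proof. by move=> e; rewrite /row_key; congr value; apply: eq_map => j; rewrite e. Qed.

Lemma node_value_eq s s' r : (forall j, arr s' 12 j = arr s 12 j) ->
  arr s' 13 r = arr s 13 r -> xval s' r = xval s r.
Proof.
move=> e e13; rewrite /node_value e13; case: ifP => // _.
by rewrite /row_value /tail_value; congr value; apply: eq_map => j; rewrite /row_digit e.
Qed.

Lemma dijkstra_eq p s s' : prepared n m d A s' -> (forall j, arr s' 12 j = arr s 12 j) ->
  (forall u, arr s' 13 u = arr s 13 u) -> dijkstra p s -> dijkstra p s'.
Proof.
move=> P e12 e13 [h1 h2 h3 h4 h5].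
have xe u : xval s' u = xval s u by apply: node_value_eq.
split; first exact: rows_ok_eq h1.
- by move=> v vn; rewrite xe h2.
- by move=> v w vw sk; rewrite xe h3.
- by move=> v w vw sk; rewrite e13 !xe; apply: h4.
- move=> v vn; rewrite e13 xe => /(h5 v vn)[[w ? ?]|[w h6 [h7 h8]]].
    by left; exists w.
  by right; exists w => //; rewrite e13 xe.
Qed.

Lemma queue_eq s s' X : (forall j, arr s' 12 j = arr s 12 j) ->
  (forall u, arr s' 13 u = arr s 13 u) -> (forall u, arr s' 14 u = arr s 14 u) ->
  (forall u, arr s' 15 u = arr s 15 u) -> queue_ok s X -> queue_ok s' X.
Proof.
move=> e12 e13 e14 e15 [q1 q2 q3 q4]; split=> //.
- by apply: lists_wf_ext q2.
- by move=> v vn; rewrite e13 /placed_at e13 (@key_eq s) //; apply: q3.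
- by move=> v vn; rewrite e13 (@key_eq s) //; apply: q4.
Qed.

Lemma relax_ok s w X : bounded N s -> w < n -> reg s 32 = w -> arr s 13 w = L.+2 ->
  dijkstra (fun _ x => x == w) s -> queue_ok s X -> key s w = X ->
  wp W N relax_prog s (fun t s' => [/\ dijkstra (fun _ _ => false) s', queue_ok s' X,
    unsettled s' = unsettled s & t + potential s' <= potential s + 500 * (h + 1) * size (ins w) + 10]).
Proof.
move=> bs wn r32 lw D Q kw.
have P := ro_prep (dj_rows D).
apply: wp_seq; apply: (wp_assign WN) => //=; first exact: bs.2.
rewrite r32; set s1 := set_reg _ _ _.
have P1 : prepared n m d A s1 by do ?apply: prepared_set_reg.
pose I k s' := exists l, [/\ [/\ chain (arr s' 9) (A 4) (reg s' 33) l, reg s' 32 = w,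
    arr s' 13 w = L.+2 & forall u, u \in l -> w \in outs u],
  dijkstra (fun u x => (x == w) && (u \in l)) s',
  queue_ok s' X, key s' w = X /\ unsettled s' = unsettled s &
  k = potential s' + 500 * (h + 1) * size l].
apply: (wp_while WN (I := I) (k0 := potential s1 + 500 * (h + 1) * size (ins w))) => //=.
- exists (ins w); split=> //.
  + split=> //; first by have [] := pp_lists P wn.
    by move=> u; rewrite ins_outs.
  + apply: (@dijkstra_pend (fun _ x => x == w)) => [u x ux _ /eqP E|].
      by rewrite E eqxx ins_outs -E.
    exact: (@dijkstra_eq _ s).
  + exact: queue_eq Q.
- move=> k s2 bs2 [l [[ch q32 lw2 lo] D2 Q2 [kw2 us2] ->]] e0.
  case: l ch lo D2 => [|v l] /= ch lo D2; first by rewrite ch in e0.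
  have [_ ev cl] := ch; set e := reg s2 33 in e0 ev cl *.
  have vw : w \in outs v by apply: lo; rewrite inE eqxx.
  have [vn _] := outs_lt tails heads vw.
  have R2 := dj_rows D2; have P2 := ro_prep R2.
  have [[k0 k1 k2 kA] _ _ _ _ _ _] := P2.
  have h4 x : arr s2 4 x = A 4 x by rewrite kA.
  apply: wp_seq; apply: (wp_assign WN) => //=; first exact: bs2.2.
  rewrite subn1 -/e h4 ev; set s3 := set_reg _ _ _.
  have P3 : prepared n m d A s3 by do ?apply: prepared_set_reg.
  have D3 : dijkstra (fun u x => (x == w) && (u \in v :: l)) s3 by apply: dijkstra_eq D2.
  have Q3 : queue_ok s3 X by apply: queue_eq Q2.
  have R3 := dj_rows D3.
  apply: wp_bounded => bs3; apply: wp_seq.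
  apply: (@wp_mono _ _ _ _ (fun t s4 => [/\
      [/\ reg s4 32 = w, reg s4 33 = e, arr s4 13 w = L.+2 & arr s4 9 =1 arr s2 9],
      dijkstra (fun u x => (x == w) && (u \in l)) s4, queue_ok s4 X,
      key s4 w = X /\ unsettled s4 = unsettled s &
      t + potential s4 <= potential s2 + 400 * (h + 1) + 60])).
    move=> t4 s4 [[g32 g33 lw4 g9] D4 Q4 [kw4 us4] t4le].
    apply: wp_bounded => bs4; apply: (wp_assign WN) => //=; first exact: bs4.2.
    rewrite g33 subn1 g9; set s5 := set_reg _ _ _.
    have P5 : prepared n m d A s5 by apply: prepared_set_reg (ro_prep (dj_rows D4)).
    exists (potential s4 + 500 * (h + 1) * size l); last first.
      by rewrite -/e; move: t4le; clear; nia.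
    exists l; split=> //.
    + split=> //=; last by move=> u ul; apply: lo; rewrite inE ul orbT.
      by apply: chain_ext cl.
    + exact: dijkstra_eq D4.
    + exact: queue_eq Q4.
  apply: (wp_if WN) => // [sk|nsk].
    rewrite (skip_exprE R3 vn wn _ q32 vw) // in sk.
    apply: wp_skip; split=> //.
    + apply: (dijkstra_pend _ D3) => u x ux nsk /andP[/eqP xw].
      rewrite inE => /predU1P[uv|->]; last by rewrite xw eqxx.
      by move: nsk; rewrite uv xw sk.
    + by rewrite (@potential_eq s2 s3) // /cost /=; clear; lia.
  have {}nsk : ~~ skipped v w.
    by move: nsk; rewrite -(skip_exprE R3 vn wn _ q32 vw) // negbK.
  apply: wp_seq; apply: (wp_assign WN) => //=; first by rewrite q32; move: wn HN; clear; lia.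
  apply: wp_seq; apply: (wp_assign WN) => //=; first by rewrite q32; move: wn HN; clear; lia.
  rewrite q32; set s4 := set_reg _ _ _.
  have P4 : prepared n m d A s4 by do ?apply: prepared_set_reg.
  have D4 : dijkstra (fun u x => (x == w) && (u \in v :: l)) s4 by apply: dijkstra_eq D3.
  have Q4 : queue_ok s4 X by apply: queue_eq Q3.
  have R4 := dj_rows D4.
  have kw4 : key s4 w = X by [].
  have xw : rowval s4 w = xval s4 w by rewrite /node_value lw2.
  have rle : forall i x, i < h -> x < n -> rk i x <= n by move=> i x; apply: (rk_le rk_ok).
  have up : lift v (rowval s4 w) < xval s4 v ->
      [/\ v != w, arr s4 13 v <= L.+1 &
        forall s', rows_ok s' -> rowval s' v = lift v (rowval s4 w) -> X <= key s' v].
    move=> lt.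
    (* A settled [v] has a key of at most [X], but a label above the offer would make its key exceed
       that of [w], which is [X]. *)
    have lvv : arr s4 13 v <= L.+1.
      have := lw_lvl (qo_wf Q4) vn; rewrite leq_eqVlt => /predU1P[E|//].
      have xv : xval s4 v = rowval s4 v by rewrite /node_value E.
      have := key_arc_lt n_gt0 evd prd tails heads rk_ok R4 R4 vw nsk.
      rewrite -xv (ltnW lt) kw4 => /(_ isT).
      by have := qo_settled Q4 vn E; move: (key s4 v) => a; clear; lia.
    split=> //.
      by apply/eqP => E; move: lvv; rewrite E lw2; clear; lia.
    move=> s' R' E; rewrite -kw4; apply: ltnW.
    by apply: (key_arc_lt n_gt0 evd prd tails heads rk_ok R4 R' vw nsk); rewrite E.
  apply: wp_bounded => bs4; apply: wp_frame.
  apply: wp_mono (@offer_ok W N WN n m d A n_gt0 HN evd prd rk mu_digit rle s4 v w w X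
    bs4 R4 Q4 vn _ _ _ _ _ _ up) => //=.
  + move=> t s5 [R5 Q5 [oc o13 xv] cs [sz tle]] fr.
    rewrite -[arr s2 13 v]/(arr s4 13 v) in sz tle.
    have D5 : dijkstra (fun u x => (x == w) && (u \in l)) s5.
      apply: (dijkstra_relax _ D4 R5 vw nsk lw2 oc o13 _ _) => [u x /andP[xe]||].
      * by rewrite inE xe => /orP[->|->]; rewrite ?orbT.
      * by rewrite -xw.
      * by move: cs; rewrite -xw; case: ifP => // _ [].
    have wv : lift v (rowval s4 w) < xval s4 v -> w != v by case/up; rewrite eq_sym.
    have [keyw lv5] : key s5 w = X /\ arr s5 13 w = L.+2.
      move: cs; case: ifP => [/wv nv _|_ [cs e12]].
        by rewrite (other_key n evd oc nv) o13.
      rewrite (@key_eq s4 s5) //; split=> //.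
      by case: (eqVneq w v) => [E|nv]; [rewrite E cs -E | rewrite o13].
    have g x : x \notin regs_of offer_prog -> reg s5 x = reg s4 x by apply: fr.1.
    split=> //.
    + by split; rewrite ?g //; apply: fr.2.
    + split=> //; rewrite -us2; move: cs; case: ifP => [lt [/andP[c1 c2] c3]|_ [cs _]].
        have [_ vL _] := up lt.
        have := @unsettled_upd s4 s5 v (arr s5 13 v) vn _ _.
        rewrite (ltn_eqF (c2 : arr s5 13 v < L.+2)) addn0 (@unsettled_eq s2 s4) //; apply.
          by move=> u; rewrite /upd; case: eqP => [->|/eqP/o13].
        by rewrite ltn_eqF.
      by apply: unsettled_eq => u; case: (eqVneq u v) => [->|/o13].
    + have E : potential s5 + 200 * (arr s5 13 v - arr s4 13 v) <= potential s4.
        have lvl : arr s4 13 v <= arr s5 13 v <= L.+2.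
          move: cs; case: ifP => [_ [/andP[c1 c2] _]|_ [-> _]].
            by rewrite c1 ltnW.
          by rewrite leqnn (lw_lvl (qo_wf Q4)).
        exact: potential_raise.
      have : potential s4 = potential s2 by apply: potential_eq.
      by move: tle E; rewrite /skip_expr /=; clear; lia.
  + by move=> j jh; apply: (ro_dig R4).
  + exact: (small_node n_gt0 evd rle R4 wn).
  + by move=> j jL; rewrite kw4.
- move=> t k s2 [l [[ch q32 lw2 lo] D2 Q2 [kw2 us2] ->]] e0.
  case: l ch lo D2 => [|v l] /= ch lo D2; last by case: ch; rewrite e0.
  rewrite muln0 addn0 => le; split=> //.
  + by apply: dijkstra_pend D2 => u x _ _; rewrite andbF.
  + by move: le; rewrite (@potential_eq s s1) //; clear; lia.
Qed.

End Main.

(** * Raising the last key and settling nodes *)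

Section Loop.
Variables (W N : nat).
Hypothesis WN : fits W N.
Variables (n m d : nat) (A : nat -> nat -> nat) (rk mu_digit : nat -> nat -> nat).
Hypothesis (n_gt0 : 0 < n) (HN : 4 * (n + m + d) + d * n + 8 <= N).
Hypothesis evd : ~~ odd d.
Hypothesis prd : forall v, v < n -> 0 < A 1 v <= d.
Hypothesis tails : forall e, e < m -> A 4 e < n.
Hypothesis heads : forall e, e < m -> A 5 e < n.
Local Notation pr := (A 1).
Local Notation h := (d./2).
Local Notation L := (d * bits n).
Local Notation outs := (out_adj A m).
Local Notation ins := (in_adj A m).
Local Notation key := (row_key n d).
Local Notation xval := (node_value n d).
Local Notation rows_ok := (rows_ok n m d A rk mu_digit).
Local Notation queue_ok := (queue_ok n d).
Local Notation placed := (placed_at n d).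
Local Notation sizes := (sizes n d).
Local Notation lift v x := (liftl n d (pr v) x).

Hypothesis rk_ok : forall i, i < h -> comp_ok n m A (d - 2 * i) (rk i).
Variable mu_value : nat -> nat.
Hypothesis mu_arc : forall v w, w \in outs v -> mu_value v <= lift v (mu_value w).
Local Notation dijkstra := (dijkstra n m d A rk mu_digit mu_value).
Local Notation unlevelled := (unlevelled n d).
Local Notation unsettled := (unsettled n m d A).
Local Notation credit := (potential n d).

Lemma dijkstra_levels pend s s' : prepared n m d A s' ->
  (forall j, arr s' 12 j = arr s 12 j) ->
  (forall u, u < n -> (arr s' 13 u == 0) = (arr s 13 u == 0)) ->
  (forall u, u < n -> (arr s' 13 u == L.+2) = (arr s 13 u == L.+2)) ->
  dijkstra pend s -> dijkstra pend s'.
Proof.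
move=> P e12 e0 e2 [h1 h2 h3 h4 h5].
have xe u : u < n -> xval s' u = xval s u.
  move=> un; rewrite /node_value e0 //; case: ifP => // _.
  by rewrite /row_value /tail_value; congr value; apply: eq_map => j; rewrite /row_digit e12.
have ol v w : w \in outs v -> v < n /\ w < n by apply: (outs_lt tails heads).
split; first by apply: rows_ok_eq h1.
- by move=> v vn; rewrite xe // h2.
- by move=> v w vw sk; have [vn wn] := ol _ _ vw; rewrite xe // h3.
- move=> v w vw sk /eqP; have [vn wn] := ol _ _ vw; rewrite e2 // => /eqP lw.
  by rewrite !xe //; apply: h4.
- move=> v vn; rewrite e0 // xe // => /(h5 v vn)[[w ? ?]|[w h6 [/eqP h7 h8]]].
    by left; exists w.
  right; exists w => //; have [_ wn] := ol _ _ h6.1.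
  by split; [apply/eqP; rewrite e2 | rewrite xe].
Qed.

(** List [l] may consist of stale entries only; then no queued key first differs from [X] at bit
    [l], and [X] stays. *)
Definition moved (s : state) (l X : nat) : nat :=
  if [exists v : 'I_n, arr s 13 v == l.+1] then (X %/ 2 ^ (L - l.+1)).+1 * 2 ^ (L - l.+1)
  else X.

Lemma moved_spec s l X : queue_ok s X -> rows_ok s -> l < L ->
  [/\ X <= moved s l X, moved s l X < 2 ^ L,
    moved s l X %/ 2 ^ (L - l) = X %/ 2 ^ (L - l) &
    forall v, v < n -> arr s 13 v = l.+1 -> [/\ moved s l X <= key s v,
      key s v %/ 2 ^ (L - l.+1) = moved s l X %/ 2 ^ (L - l.+1) &
      forall j, l < j < L -> (moved s l X %/ 2 ^ (L - j.+1)) %% 2 = 0]].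
Proof.
move=> Q R lL; rewrite /moved; case: ifP => [/existsP[v /eqP lv]|/existsP ne]; last first.
  split=> //; first exact: qo_X Q.
  by move=> v vn lv; case: ne; exists (Ordinal vn); apply/eqP.
set K := 2 ^ (L - l.+1); have K0 : 0 < K by rewrite expn_gt0.
have half x : x %/ 2 ^ (L - l) = x %/ K %/ 2.
  by rewrite /K -divnMA -expnSr; congr (_ %/ 2 ^ _); move: lL; clear; lia.
have lt1 : 0 < l.+1 <= L.+1 by rewrite /= ltnS ltnW.
(* These keys agree with [X] on the first [l] bits and exceed it on the first [l.+1], so the longer
   prefix is exactly one more than that of [X]. *)
have kE u : u < n -> arr s 13 u = l.+1 -> key s u %/ K = (X %/ K).+1.
  move=> un lu; have := qo_placed Q un; rewrite lu lt1 => /(_ isT).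
  rewrite /placed_at lu /= half half => -[e /(_ lL)].
  by rewrite -/K; move: e; clear; lia.
have kv := kE v (ltn_ord v) lv.
have X2 : (X %/ K).+1 %/ 2 = X %/ K %/ 2.
  have := qo_placed Q (ltn_ord v); rewrite lv lt1 => /(_ isT).
  by rewrite /placed_at lv /= half half kv => -[].
split.
- by apply: ltnW; apply: ltn_ceil.
- rewrite -kv; apply: leq_ltn_trans (leq_trunc_div _ _) _; apply/key_lt.
  have rle : forall i x, i < h -> x < n -> rk i x <= n by move=> i x; apply: (rk_le rk_ok).
  exact: (small_node n_gt0 evd rle R).
- by rewrite !half mulnK.
- move=> u un lu; rewrite mulnK // -(kE u) //; split=> //; first exact: leq_trunc_div.
  move=> j /andP[lj jL].
  have -> : K = 2 ^ (j - l).-1 * 2 * 2 ^ (L - j.+1).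
    by rewrite -expnSr -expnD; congr (2 ^ _); move: lj jL; clear; lia.
  by rewrite !mulnA mulnK ?expn_gt0 // modnMl.
Qed.

Lemma sizes_set_pop s s' l : l <= L -> 0 < arr s 15 l ->
  (forall j, arr s' 15 j = upd (arr s 15) l (arr s 15 l).-1 j) -> sizes s' + 1 = sizes s.
Proof. by move=> lL s0 E; have := sizes_upd lL E; move: s0; clear; lia. Qed.

Lemma lists_wf_settle L' (P : pred nat) lv q sz v : lists_wf n L' P lv q sz ->
  (forall u, P u -> u = v) -> lists_wf n L' pred0 (upd lv v L'.+2) q sz.
Proof.
move=> [h1 h2 h3 h4] Pv; split=> //.
- by move=> u un; rewrite /upd; case: eqP => // _; apply: h1.
- move=> l u lL ul; have [un lu] := h3 _ _ lL ul; split=> //.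
  by rewrite /upd; case: eqP => // _; move: lL; clear; lia.
- move=> u un _; rewrite /upd; case: eqP => [_|ne]; first by rewrite ltnn andbF.
  by apply: h4 => //; apply/negP => /Pv.
Qed.
Lemma move_ok s X l : bounded N s -> dijkstra (fun _ _ => false) s -> queue_ok s X ->
  reg s 30 = l.+1 -> reg s 31 = l -> l < L -> 0 < arr s 15 l ->
  (forall k, l < k <= L -> arr s 15 k = 0) ->
  wp W N move_prog s (fun t s' => exists X', [/\ dijkstra (fun _ _ => false) s',
    queue_ok s' X', reg s' 30 <= L.+1, forall k, reg s' 30 <= k <= L -> arr s' 15 k = 0 &
    unsettled s' = unsettled s /\
    t + 30 * reg s' 30 + credit s' + 30 <= 30 * l.+1 + credit s]).
Proof.
move=> bs D Q r30 r31 lL sz0 deep; have R := dj_rows D; have P := ro_prep R.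
have rle : forall i x, i < h -> x < n -> rk i x <= n by move=> i x; apply: (rk_le rk_ok).
set X' := moved s l X; have [XX' X'L preX fr] := moved_spec Q R lL.
rewrite -/X' in XX' X'L preX fr.
apply: wp_seq; apply: (wp_assign WN) => //=; first exact: bs.1.
rewrite r30; set s1 := set_reg _ _ _.
have P1 : prepared n m d A s1 by do ?apply: prepared_set_reg.
(* A node of level [l] is either still there or placed deeper relative to [X']. The 30 per level
   prepay the later descent of the main loop through empty lists. Of the 100 units freed by the
   entry that empties list [l], 40 are set aside to finish this round. *)
pose I k s' := [/\ prepared n m d A s', [/\ reg s' 30 = l.+1, reg s' 31 = l & l < reg s' 34 <= L.+1],
   [/\ forall j, arr s' 12 j = arr s 12 j,
       lists_wf n L pred0 (arr s' 13) (arr s' 14) (arr s' 15) &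
       forall k, reg s' 34 <= k <= L -> arr s' 15 k = 0],
   forall u, u < n -> if arr s 13 u == l.+1
     then arr s' 13 u = l.+1 \/ (l.+1 < arr s' 13 u <= L.+1 /\ placed s' X' u)
     else arr s' 13 u = arr s 13 u &
   k = 30 * reg s' 34 + credit s' + 40 * (arr s' 15 l == 0)].
apply: wp_seq; apply: (wp_while WN (I := I) (k0 := 30 * l.+1 + credit s1)) => //=.
- split=> //.
  + by split=> //=; rewrite leqnn ltnS ltnW.
  + by split=> //; exact: qo_wf Q.
  + by move=> u un; case: ifP => // /eqP ->; left.
  + by rewrite eqn0Ngt sz0 muln0 addn0.
- move=> k s2 bs2 [P2 [q30 q31 /andP[l34 L34]] [e12 wf2 deep2] lv2 ->]; rewrite q31 => z0.
  rewrite (negbTE z0) muln0 addn0.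
  have [[k0 k1 k2 kA] _ _ _ _ _ _] := P2.
  have szp : 0 < arr s2 15 l by rewrite lt0n.
  set v := arr s2 14 (l * n + (arr s2 15 l).-1).
  have [vn lvv wfP] := lists_wf_pop wf2 (ltnW lL) szp; rewrite -/v in vn lvv wfP.
  apply: wp_seq; apply: (wp_put WN) => //=.
    by rewrite q31; have := bs2.2 15 l; clear; lia.
  rewrite q31 subn1; set s3 := set_arr _ _ _ _.
  have P3 : prepared n m d A s3 by do ?apply: prepared_set_arr.
  have h15 j : arr s3 15 j = upd (arr s2 15) l (arr s2 15 l).-1 j by [].
  have sz3 : sizes s3 + 1 = sizes s2.
    by apply: (sizes_set_pop (ltnW lL) szp) => j; rewrite h15.
  apply: wp_bounded => bs3.
  apply: wp_seq; apply: (wp_assign WN) => //=; first exact: bs2.2.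
  rewrite q31 k0 eqxx -/v; set s4 := set_reg _ _ _.
  have P4 : prepared n m d A s4 by do ?apply: prepared_set_reg.
  apply: wp_bounded => bs4.
  apply: (wp_if WN) => //=; rewrite q30 eqb0 ?negbK => lvE; last first.
    apply: wp_skip; exists (30 * reg s4 34 + credit s4 + 40 * (arr s4 15 l == 0)).
      split=> //=.
      + by rewrite l34 L34.
      + split=> //.
          apply: lists_wf_sub (wfP) => u /andP[/eqP -> E]; by rewrite E in lvE.
        move=> j /andP[k34 kL]; have jl : j != l by move: l34 k34; clear; lia.
        by rewrite (negbTE jl) deep2 ?k34.
    have : credit s4 + 100 = credit s2.
      rewrite /potential; have -> : sizes s4 = sizes s3 by [].
      have -> : unlevelled s4 = unlevelled s2 by [].
      by move: sz3; clear; lia.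
    by case: (arr s4 15 l == 0) => /=; clear; lia.
  have {}lvE : arr s2 13 v = l.+1 by apply/eqP.
  apply: wp_seq; apply: (wp_assign WN) => //=; first by rewrite q30; have := bs2.1 30; rewrite q30.
  apply: wp_seq; apply: (wp_assign WN) => //=; first exact: bs2.1.
  rewrite q30 k0; set s5 := set_reg _ _ _.
  have P5 : prepared n m d A s5 by do ?apply: prepared_set_reg.
  have R5 : rows_ok s5 by apply: (rows_ok_eq P5 _ R).
  have e5 r : key s5 r = key s r by apply: key_eq.
  have olv : arr s 13 v = l.+1 by have := lv2 v vn; case: eqP => // _; rewrite lvE.
  have [kX kv low] := fr v vn olv.
  have kn : key s5 n = 0 by apply: key_zero R5.
  apply: wp_bounded => bs5; apply: wp_seq.
  apply: wp_mono (@advance_ok W N WN n m d A s5 v n X' l.+1 bs5 P5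
    _ _ _ _ _ _ _ _) => //=.
  - move=> t6 s6 [j [r29 [/andP[lj jL] prej ne] [gr ar] t6le]].
    have a6 a x : arr s6 a x = arr s3 a x by rewrite ar.
    have q20 : reg s6 20 = v by rewrite gr.
    have q0 : reg s6 0 = n by rewrite gr.
    have q34 : reg s6 34 = reg s2 34 by rewrite gr.
    apply: wp_seq; apply: wp_seq; apply: (wp_put WN) => //=; first by rewrite q20; have := nN HN; move: vn; clear; lia.
    have szj : arr s3 15 j <= n by apply: lst_size_le wfP jL.
    apply: wp_seq; apply: (wp_put WN) => //=.
      by rewrite r29 a6; have := nN HN; move: szj HN n_gt0; clear; nia.
    apply: (wp_put WN) => //=; first by rewrite r29; have := levels_le_N n_gt0 HN; move: jL; clear; lia.
    rewrite q20 r29 q0 !a6; set s7 := set_arr _ 13 _ _.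
    have wf7 : lists_wf n L pred0 (arr s7 13) (arr s7 14) (arr s7 15).
      have lvj : arr s2 13 v <= j by rewrite lvE.
      apply: lists_wf_ext (lists_wf_push (P' := pred0) wfP vn jL lvj _) => // u.
      + by rewrite /= a6 /upd addn1.
      + by rewrite /= a6 /upd.
      + by rewrite /= a6 /upd addn1 /upd.
      + by case/andP => -> _.
    have g7 x : reg s7 x = reg s6 x by [].
    have P7 : prepared n m d A s7.
      apply: (@prepared_frame _ _ _ _ (29 <-- Cst 0 ;; push_prog) s5) => //; split=> [x|a].
        by rewrite !inE => x29; exact: gr.
      by rewrite !inE => /norP[/negbTE h1 /norP[/negbTE h2 /negbTE h3]] x; rewrite /= h1 h2 h3 /= a6 /= h2.
    have E7 u : arr s7 13 u = if u == v then j.+1 else arr s2 13 u by rewrite /= a6 addn1.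
    have cr : credit s7 + 300 * (j - l) = credit s2.
      have h1 : unlevelled s7 + (L.+2 - arr s2 13 v) = unlevelled s2 + (L.+2 - j.+1).
        by apply: unlevelled_upd => // u; rewrite E7.
      have h2 : sizes s7 + arr s3 15 j = sizes s3 + (arr s3 15 j).+1.
        by apply: (sizes_upd jL) => u; rewrite /= a6 /upd addn1.
      by move: h1 h2 sz3 lj jL; rewrite lvE /potential; clear; lia.
    have I8 s8 : reg s8 34 = maxn (reg s2 34) j.+1 -> (forall x, x != 34 -> reg s8 x = reg s7 x) ->
        (forall a, arr s8 a = arr s7 a) ->
        I (30 * maxn (reg s2 34) j.+1 + credit s7 + 40 * (arr s8 15 l == 0)) s8.
      move=> m34 g8 e8; split.
      + apply: (@prepared_frame _ _ _ _ (34 <-- Cst 0) s7) => //; split=> // x.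
          by rewrite inE; apply: g8.
        by move=> _ y; rewrite e8.
      + by rewrite (g8 30) // (g8 31) // !g7 !gr // m34; split=> //; move: l34 L34 jL; clear; lia.
      + split; rewrite ?e8 //; first by move=> x; rewrite /= a6 /= e12.
        rewrite m34 => x /andP[k34 kL]; rewrite geq_max in k34.
        case/andP: k34 => c1 c2; rewrite /= a6 (gtn_eqF c2) /= (_ : x == l = false) ?deep2 ?c1 //.
        by move: c1 l34; clear; lia.
      + move=> u un; rewrite e8 E7; case: (eqVneq u v) => [->|uv].
          rewrite olv eqxx; right; split; first by rewrite !ltnS jL andbT; move: lj; clear; lia.
          rewrite /placed_at e8 E7 eqxx /=.
          have -> : key s8 v = key s5 v by apply: key_eq => x; rewrite e8 /= a6.
          split=> // jL'; rewrite ltn_neqAle eq_sym leq_div2r ?e5 // andbT.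
          by apply/eqP; rewrite -e5; apply: ne.
        have := lv2 u un; case: ifP => // _ [->|[h1 h2]]; [by left|right; split=> //].
        rewrite /placed_at e8 E7 (negbTE uv).
        have -> // : key s8 u = key s2 u by apply: key_eq => x; rewrite e8 /= a6.
      + by rewrite m34; congr (_ + _ + _); apply: potential_eq => x; rewrite e8.
    have dz : 40 * (arr s7 15 l == 0) <= 40 by case: (_ == 0).
    have g34 : reg s7 34 = reg s2 34 by rewrite g7 gr.
    have g29 : reg s7 29 = j by [].
    apply: (wp_if WN) => //=; rewrite q34 r29 addn1 eqb0 ?negbK => cmp.
      apply: (wp_assign WN) => //=; first by rewrite r29; have := levels_le_N n_gt0 HN; move: jL; clear; lia.
      have I9 : I (30 * j.+1 + credit s7 + 40 * (arr s7 15 l == 0)) (set_reg s7 34 j.+1).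
        have := I8 (set_reg s7 34 j.+1); rewrite (maxn_idPr (ltnW cmp)); apply=> // x nx.
        by rewrite /= (negbTE nx).
      have -> : reg s6 29 + 1 = j.+1 by rewrite r29 addn1.
      eexists; first exact: I9.
      move: cr t6le dz cmp lj jL l34; clear; lia.
    rewrite -leqNgt in cmp; apply: wp_skip.
    have I9 : I (30 * reg s2 34 + credit s7 + 40 * (arr s7 15 l == 0)) s7.
      by have := I8 s7; rewrite (maxn_idPl cmp); apply.
    eexists; first exact: I9.
    move: cr t6le dz cmp lj jL l34; clear; lia.
  - exact: (small_node n_gt0 evd rle R5).
  - exact: (small_zero R5).
  - by rewrite e5.
  - by move=> j jL; rewrite kn div0n mod0n low.
- move=> t k s2 [P2 [q30 q31 /andP[l34 L34]] [e12 wf2 deep2] lv2 ->]; rewrite q31 => z0.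
  rewrite z0 eqxx muln1 => tle; apply: wp_bounded => bs2.
  apply: (wp_assign WN) => //=; first exact: bs2.1.
  set s3 := set_reg _ _ _; exists X'.
  have P3 : prepared n m d A s3 by do ?apply: prepared_set_reg.
  have gone u : u < n -> arr s2 13 u <> l.+1.
    move=> un E; have := lw_in wf2 un isT; rewrite E /= => /(_ (ltnW lL)).
    by rewrite /lst z0.
  have lvs u : u < n -> arr s 13 u = l.+1 /\ l.+1 < arr s2 13 u <= L.+1 /\ placed s2 X' u \/
      arr s 13 u <> l.+1 /\ arr s2 13 u = arr s 13 u.
    move=> un; have := lv2 u un; case: eqP => [E [/(gone u un)//|h1]|ne h1]; first by left.
    by right.
  have lv_set u : u < n -> (arr s2 13 u == L.+2) = (arr s 13 u == L.+2).
    move=> un; case: (lvs u un) => [[E [/andP[h1 h2] _]]|[_ ->] //].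
    by rewrite E (ltn_eqF (h2 : _ < L.+2)) ltn_eqF // !ltnS ltnW.
  split.
  + apply: (@dijkstra_levels _ s s3) => // u un /=.
    case: (lvs u un) => [[E [/andP[h1 h2] _]]|[_ ->] //].
    by rewrite E !gtn_eqF // (leq_trans _ h1).
  + split=> //.
    * move=> u un /= lu; case: (lvs u un) => [[E [h1 h2]]//|[ne E]].
      have lu' : 0 < arr s 13 u <= L.+1 by rewrite -E.
      have [p1 p2] := qo_placed Q un lu'.
      (* All lists beyond [l] were empty before, so the remaining queued nodes have levels below
         [l], where [X'] and [X] agree. *)
      have ul : (arr s 13 u).-1 < l.
        have := lw_in (qo_wf Q) un isT lu'; case: (ltnP l (arr s 13 u).-1) => [lt|].
          by rewrite /lst deep // lt /=; move: lu'; clear; lia.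
        by move: ne lu'; clear; lia.
      have up e : L - l <= e -> X' %/ 2 ^ e = X %/ 2 ^ e by move=> le; apply: divn_pow_le le preX.
      rewrite /placed_at /= E (@key_eq n d s s3) // !up //.
        by move: ul lL; clear; lia.
      by move: ul lL; clear; lia.
    * move=> u un /= /eqP; rewrite lv_set // => /eqP lu.
      by rewrite (@key_eq n d s s3) //; apply: leq_trans (qo_settled Q un lu) XX'.
  + by [].
  + by [].
  + split; first by apply: eq_bigr => u _; rewrite /= lv_set.
    move: tle; have -> : credit s3 = credit s2 by []; have -> : credit s1 = credit s by [].
    by clear; lia.
Qed.

Lemma settle_ok s X : bounded N s -> dijkstra (fun _ _ => false) s -> queue_ok s X ->
  reg s 31 = L -> 0 < arr s 15 L ->
  wp W N settle_prog s (fun t s' => [/\ dijkstra (fun _ _ => false) s', queue_ok s' X &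
    t + credit s' + 600 * (h + 1) * unsettled s' + 20 <= credit s + 600 * (h + 1) * unsettled s]).
Proof.
move=> bs D Q r31 szp; have R := dj_rows D; have P := ro_prep R.
have [[k0 k1 k2 kA] _ _ _ _ _ _] := P; have pL := pp_L P.
have rle : forall i x, i < h -> x < n -> rk i x <= n by move=> i x; apply: (rk_le rk_ok).
set v := arr s 14 (L * n + (arr s 15 L).-1).
have [vn lvv wfP] := lists_wf_pop (qo_wf Q) (leqnn L) szp; rewrite -/v in vn lvv wfP.
apply: wp_seq; apply: (wp_put WN) => //=.
  by rewrite r31; have := bs.2 15 L; clear; lia.
rewrite r31 subn1; set s1 := set_arr _ _ _ _.
have P1 : prepared n m d A s1 by do ?apply: prepared_set_arr.
have sz1 : sizes s1 + 1 = sizes s by apply: (sizes_set_pop (leqnn L) szp) => j.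
apply: wp_bounded => bs1.
apply: wp_seq; apply: (wp_assign WN) => //=; first exact: bs.2.
rewrite r31 k0 eqxx -/v; set s2 := set_reg _ _ _.
have P2 : prepared n m d A s2 by do ?apply: prepared_set_reg.
have cr2 : credit s2 + 100 = credit s.
  rewrite /potential; have -> : sizes s2 = sizes s1 by [].
  have -> : unlevelled s2 = unlevelled s by [].
  by move: sz1; clear; lia.
apply: wp_bounded => bs2.
apply: (wp_if WN) => //=; rewrite pL addn1 eqb0 ?negbK => lvE; last first.
  apply: wp_skip; split.
  - exact: (@dijkstra_eq _ _ _ _ _ _ _ _ s).
  - split=> //; first exact: qo_X Q.
    + apply: lists_wf_sub (wfP) => u /andP[/eqP -> E]; by rewrite E in lvE.
    + exact: (qo_placed Q).
    + exact: (qo_settled Q).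
  - have -> : unsettled s2 = unsettled s by [].
    by move: cr2; clear; lia.
have {}lvE : arr s 13 v = L.+1 by apply/eqP.
apply: wp_seq; apply: (wp_put WN) => //=.
  by rewrite pL; have := levels_le_N n_gt0 HN; clear; lia.
rewrite pL addn2; set s3 := set_arr _ _ _ _.
have P3 : prepared n m d A s3 by do ?apply: prepared_set_arr.
have E3 u : arr s3 13 u = upd (arr s 13) v L.+2 u by [].
have ov u : u <> v -> arr s3 13 u = arr s 13 u by move=> uv; rewrite E3 updN //; apply/eqP.
have vv : arr s3 13 v = L.+2 by rewrite E3 updx.
(* At level [L] the common prefix is the whole key. *)
have kv : key s v = X.
  have := qo_placed Q vn; rewrite /placed_at lvE /= leqnn subnn !divn1.
  by move=> /(_ isT)[].
have D3 : dijkstra (fun _ x => x == v) s3.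
  have xe u : u < n -> xval s3 u = xval s u.
    move=> un; case: (eqVneq u v) => [->|/eqP uv]; last by apply: node_value_eq => //; apply: ov.
    by rewrite /node_value vv lvE.
  have ol u w : w \in outs u -> u < n /\ w < n by apply: (outs_lt tails heads).
  case: D => h1 h2 h3 h4 h5; split.
  - exact: (@rows_ok_eq _ _ _ _ _ _ s).
  - by move=> u un; rewrite xe // h2.
  - by move=> u w uw sk; have [un _] := ol _ _ uw; rewrite xe // h3.
  - move=> u w uw sk lw /eqP wv; have [un wn] := ol _ _ uw.
    by rewrite !xe // h4 // -lw ov.
  - move=> u un lu; have lu' : arr s 13 u != 0.
      by case: (eqVneq u v) => [->|/eqP uv]; [rewrite lvE | rewrite -ov].
    rewrite xe //; case: (h5 u un lu') => [[w ? ?]|[w h6 [h7 h8]]]; first by left; exists w.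
    right; exists w => //; have [_ wn] := ol _ _ h6.1.
    rewrite xe // ov //; move=> wv; move: h7; rewrite wv lvE; clear; lia.
have Q3 : queue_ok s3 X.
  split=> //; first exact: qo_X Q.
  - apply: lists_wf_ext (lists_wf_settle wfP (v := v) _) => // u; by case/andP => /eqP.
  - move=> u un; case: (eqVneq u v) => [->|/eqP uv]; first by rewrite vv ltnn andbF.
    by rewrite ov // => lu; rewrite /placed_at ov //; apply: (qo_placed Q).
  - move=> u un; case: (eqVneq u v) => [-> _|/eqP uv]; first by rewrite -kv.
    by rewrite ov //; apply: (qo_settled Q).
have us3 : unsettled s3 + (1 + size (ins v)) = unsettled s.
  have := @unsettled_upd n m d A s s3 v L.+2 vn E3; rewrite eqxx; apply.
  by rewrite lvE; clear; lia.
have cr3 : credit s3 <= credit s2.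
  have := @unlevelled_upd n d s s3 v L.+2 vn E3; rewrite lvE /potential.
  have -> : unlevelled s2 = unlevelled s by []; have -> : sizes s3 = sizes s2 by [].
  by clear; lia.
apply: wp_bounded => bs3.
apply: wp_mono (@relax_ok W N WN n m d A rk mu_digit n_gt0 HN evd prd tails heads rk_ok mu_value mu_arc
  s3 v X bs3 vn _ vv D3 Q3 _) => //.
move=> t s4 [D4 Q4 u4 tle]; split=> //; rewrite u4 -us3.
move: tle cr2 cr3; clear; move: (unsettled s3) (size _) => a b.
rewrite -addn1 !mulnDr; clear; nia.
Qed.

Lemma main_ok s X : bounded N s -> dijkstra (fun _ _ => false) s -> queue_ok s X ->
  wp W N main_prog s (fun t s' => [/\ dijkstra (fun _ _ => false) s',
    forall v, v < n -> arr s' 13 v = 0 \/ arr s' 13 v = L.+2 &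
    t <= 30 * (L + 1) + credit s + 600 * (h + 1) * unsettled s + 20]).
Proof.
move=> bs D Q; have P := ro_prep (dj_rows D); have pL := pp_L P.
apply: wp_seq; apply: (wp_assign WN) => //=.
  by rewrite pL; have := levels_le_N n_gt0 HN; clear; lia.
rewrite pL; set s1 := set_reg _ _ _.
have P1 : prepared n m d A s1 by do ?apply: prepared_set_reg.
pose I k s' := exists X', [/\ dijkstra (fun _ _ => false) s', queue_ok s' X', reg s' 30 <= L.+1,
  forall l, reg s' 30 <= l <= L -> arr s' 15 l = 0 &
  k = 30 * reg s' 30 + credit s' + 600 * (h + 1) * unsettled s'].
apply: (wp_while WN (I := I)
  (k0 := 30 * L.+1 + credit s + 600 * (h + 1) * unsettled s)) => //=.
- exists X; split=> //=.
  + exact: (@dijkstra_eq _ _ _ _ _ _ _ _ s).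
  + exact: queue_eq Q.
  + by rewrite addn1.
  + by move=> l; rewrite addn1 leqNgt ltnS; case: leqP.
  + have -> : L + 1 = L.+1 by rewrite addn1.
    by [].
- move=> k s2 bs2 [X2 [D2 Q2 l30 deep ->]] e0.
  have P2 := ro_prep (dj_rows D2).
  case El : (reg s2 30) (e0) l30 deep => [//|l] _ l30 deep.
  apply: wp_seq; apply: (wp_assign WN) => //=; first by have := bs2.1 30; clear; lia.
  rewrite El subn1 /=; set s3 := set_reg _ _ _.
  have P3 : prepared n m d A s3 by do ?apply: prepared_set_reg.
  have D3 : dijkstra (fun _ _ => false) s3 by apply: (@dijkstra_eq _ _ _ _ _ _ _ _ s2).
  have Q3 : queue_ok s3 X2 by apply: queue_eq Q2.
  have c3 : credit s3 = credit s2 by [].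
  have u3 : unsettled s3 = unsettled s2 by [].
  apply: wp_bounded => bs3.
  apply: (wp_if WN) => //=; rewrite eqb0 ?negbK => z.
    apply: (wp_assign WN) => //=; first by have := bs2.1 30; clear; lia.
    rewrite El subn1 /=; set s4 := set_reg _ _ _.
    have P4 : prepared n m d A s4 by do ?apply: prepared_set_reg.
    exists (30 * l + credit s4 + 600 * (h + 1) * unsettled s4).
      exists X2; split=> //=.
      + exact: (@dijkstra_eq _ _ _ _ _ _ _ _ s2).
      + exact: queue_eq Q2.
      + exact: ltnW.
      + move=> j /andP[]; rewrite leq_eqVlt => /predU1P[<- _|lj jL]; first exact/eqP.
        by rewrite deep // lj.
    have -> : credit s4 = credit s2 by []; have -> : unsettled s4 = unsettled s2 by [].
    by clear; lia.
  rewrite -lt0n in z.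
  apply: (wp_if WN) => //=; rewrite (pp_L P2) eqb0 ?negbK => lL.
    apply: wp_frame; have r31 : reg s3 31 = L by apply/eqP.
    apply: wp_mono (@settle_ok s3 X2 bs3 D3 Q3 r31 _) => [t s4 [D4 Q4 tle] fr|]; last first.
      by rewrite -(eqP lL).
    have q30 : reg s4 30 = l.+1 by rewrite fr.1.
    exists (30 * l.+1 + credit s4 + 600 * (h + 1) * unsettled s4).
      exists X2; split; rewrite ?q30 //.
      by move=> j; rewrite (eqP lL) leqNgt ltnS; case: leqP.
    by move: tle; rewrite c3 u3; clear; lia.
  have {}lL : l < L by move: lL l30; clear; lia.
  apply: wp_mono (@move_ok s3 X2 l bs3 D3 Q3 _ _ lL z _) => //.
  move=> t s4 [X4 [D4 Q4 q30 deep4 [u4 tle]]].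
  exists (30 * reg s4 30 + credit s4 + 600 * (h + 1) * unsettled s4); first by exists X4.
  by move: tle; rewrite u4 c3 u3; clear; lia.
- move=> t k s2 [X2 [D2 Q2 l30 deep ->]] e0 tle; split=> //.
    (* A queued node would be listed at its level, but all lists are empty by now. *)
    move=> v vn; case: (posnP (arr s2 13 v)) => [|lv]; first by left.
    have := lw_lvl (qo_wf Q2) vn; rewrite leq_eqVlt => /predU1P[|lt]; first by right.
    have := lw_in (qo_wf Q2) vn isT (introT andP (conj lv (lt : arr s2 13 v <= L.+1))).
    by rewrite /lst deep // e0 /=; move: lv lt; clear; lia.
  by move: tle; clear; lia.
Qed.
End Loop.

(** * The whole program *)

Definition mu_prog : cmd :=
  40 <-- Cst 0 ;;
  While (Reg 40 `< Reg 0)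
    (41 <-- Cst 0 ;;
     While (Reg 41 `< Reg 3)
       (Put 12 ((Reg 0 `+ Cst 1 `+ Reg 40) `* Reg 2 `+ (Cst 2 `* Reg 41 `+ Cst 1))
               (3@[Reg 40 `* (Reg 3 `+ Cst 1) `+ (Reg 41 `+ Cst 1)]) ;;
        41 <-- Reg 41 `+ Cst 1) ;;
     40 <-- Reg 40 `+ Cst 1).

(** Skipped arcs offer the label of their head in [mu] once and for all. A head labelled top is left
    out: its code has zero digits, which would read as label 0. *)
Definition base_body : cmd :=
  7 <-- 4@[Reg 40] ;; 8 <-- 5@[Reg 40] ;; 20 <-- Reg 7 ;; 32 <-- Reg 8 ;;
  If allowed_expr
    (If (3@[Reg 32 `* (Reg 3 `+ Cst 1)])
       Skip
       (If (skip_expr (Reg 20) (Reg 32))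
          (21 <-- Reg 0 `+ Cst 1 `+ Reg 32 ;; 22 <-- Reg 0 ;; offer_prog)
          Skip))
    Skip ;;
  40 <-- Reg 40 `+ Cst 1.

Definition base_prog : cmd :=
  40 <-- Cst 0 ;; While (Reg 40 `< Reg 1) base_body.

Definition output_prog : cmd :=
  40 <-- Cst 0 ;;
  While (Reg 40 `< Reg 0)
    (If (13@[Reg 40])
       (41 <-- Cst 0 ;;
        While (Reg 41 `< Reg 3)
          (Put 6 (Reg 40 `* (Reg 3 `+ Cst 1) `+ (Reg 41 `+ Cst 1))
                 (12@[Reg 40 `* Reg 2 `+ (Cst 2 `* Reg 41 `+ Cst 1)]) ;;
           41 <-- Reg 41 `+ Cst 1))
       (Put 6 (Reg 40 `* (Reg 3 `+ Cst 1)) (Cst 1)) ;;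
     40 <-- Reg 40 `+ Cst 1).

Section Final.
Variables (W N : nat).
Hypothesis WN : fits W N.
Variables (n m d : nat) (A : nat -> nat -> nat).
Hypothesis (n_gt0 : 0 < n) (HN : 4 * (n + m + d) + d * n + 8 <= N).
Hypothesis evd : ~~ odd d.
Hypothesis prd : forall v, v < n -> 0 < A 1 v <= d.
Hypothesis tails : forall e, e < m -> A 4 e < n.
Hypothesis heads : forall e, e < m -> A 5 e < n.
Local Notation pr := (A 1).
Local Notation h := (d./2).
Local Notation L := (d * bits n).
Local Notation outs := (out_adj A m).
Local Notation key := (row_key n d).
Local Notation rowval := (row_value n d).
Local Notation xval := (node_value n d).
Local Notation queue_ok := (queue_ok n d).
Local Notation credit := (potential n d).
Local Notation lift v x := (liftl n d (pr v) x).

Definition mu_digit (w j : nat) : nat := A 3 (w * (h + 1) + (j + 1)).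

Definition mu_value (w : nat) : nat :=
  if A 3 (w * (h + 1)) == 0 then tail_value n h (mu_digit w) 0 else n ^ h.

Hypothesis mu_digit_lt : forall w j, w < n -> j < h -> mu_digit w j < n.

Lemma mu_ok s : bounded N s -> prepared n m d A s ->
  wp W N mu_prog s (fun t s' => [/\ prepared n m d A s',
    forall w j, w < n -> j < h -> row_digit d s' (n.+1 + w) j = mu_digit w j,
    forall x, (forall w j, w < n -> j < h -> x != (n.+1 + w) * d + (2 * j + 1)) ->
      arr s' 12 x = arr s 12 x &
    t <= 50 * (n * (h + 1)) + 10]).
Proof.
move=> bs P; apply: wp_frame.
apply: (@wp_mono _ _ _ _ (fun t s' => [/\
    forall w j, w < n -> j < h -> row_digit d s' (n.+1 + w) j = mu_digit w j,
    forall x, (forall w j, w < n -> j < h -> x != (n.+1 + w) * d + (2 * j + 1)) ->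
      arr s' 12 x = arr s 12 x &
    t <= 50 * (n * (h + 1)) + 10])) => [t s' [h1 h2 h3] fr|].
  by split=> //; apply: prepared_frame fr P.
have [[k0 k1 k2 kA] p1 p2 p3 p4 p5 p6] := P; have p3' := pp_h P.
have odj j : j < h -> 2 * j + 1 < d by move: evd; clear; lia.
apply: wp_seq; apply: (wp_assign WN) => //=.
pose base s' := [/\ reg s' 0 = n, reg s' 2 = d, reg s' 3 = h & forall j, arr s' 3 j = A 3 j].
pose keep s' := forall x, (forall w j, w < n -> j < h -> x != (n.+1 + w) * d + (2 * j + 1)) ->
      arr s' 12 x = arr s 12 x.
pose J i s' := [/\ base s', reg s' 40 = i, keep s' &
  forall w j, w < i -> j < h -> row_digit d s' (n.+1 + w) j = mu_digit w j].
apply: (wp_for WN (J := J) (c := fun=> 40 * h + 30) (hi := n)) => //.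
- by split=> //; split=> //= j; rewrite kA.
- by move=> i s1 [[q0 _ _ _] r40 _ _].
- move=> i s1 bs1 lin [[q0 q2 q3 qA] r40 ke di].
  apply: wp_seq; apply: (wp_assign WN) => //=.
  pose J2 k s' := [/\ base s', reg s' 40 = i /\ reg s' 41 = k, keep s' &
    forall w j, j < h -> (w < i) || (w == i) && (j < k) -> row_digit d s' (n.+1 + w) j = mu_digit w j].
  apply: wp_seq; apply: (wp_for WN (J := J2) (c := fun=> 30) (hi := h)) => //.
  + by split=> // w j jh; rewrite ltn0 andbF orbF => wi; apply: di.
  + by move=> k s2 [[_ _ q3' _] [_ r41] _ _].
  + move=> k s2 bs2 kh [[u0 u2 u3 uA] [u40 u41] ke2 di2].
    apply: wp_seq; apply: (wp_put WN) => //=; first exact: bs2.2.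
    apply: (wp_assign WN) => //=; first by rewrite u41; have := odj _ kh; move: HN; clear; lia.
    rewrite u0 u2 u3 u40 u41 uA; split=> //; split=> //=; rewrite ?addn1 //.
    * move=> x nx /=; rewrite ifN ?ke2 //.
      by move: (nx _ _ lin kh); rewrite addn1 addSn.
    * move=> w j jh wj; rewrite /row_digit /=.
      case: eqP => [E|ne].
        have [||E1 E2] := cell_inj _ _ E; [exact: odj | by rewrite -addn1; exact: odj |].
        have -> : w = i by move: E1; clear; lia.
        rewrite (_ : j = k); last by move: E2; clear; lia.
        by rewrite /mu_digit !addn1.
      apply: di2 => //; case: (ltnP w i) wj => //= iw; rewrite ltnS.
      case/andP=> /eqP wi; rewrite leq_eqVlt => /orP[/eqP jk|->]; last by rewrite wi eqxx.
      by case: ne; rewrite wi jk addn1.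
  + move=> t s2 [[u0 u2 u3 uA] [u40 u41] ke2 di2] tle.
    apply: (wp_assign WN) => //=; first by rewrite u40; move: HN lin; clear; lia.
    rewrite u40; split; last by move: tle; rewrite sum_nat_const card_ord; clear; lia.
    split=> //=; rewrite ?addn1 // => w j; rewrite ltnS leq_eqVlt => wi jh.
    by apply: di2 => //; rewrite jh andbT orbC.
- move=> t s1 [_ _ ke di] tle; split=> //.
  by move: tle; rewrite sum_nat_const card_ord; clear; lia.
Qed.

Variable rk : nat -> nat -> nat.
Hypothesis rk_ok : forall i, i < h -> comp_ok n m A (d - 2 * i) (rk i).
Hypothesis mu_arc : forall v w, w \in outs v -> mu_value v <= lift v (mu_value w).
Local Notation rows_ok := (rows_ok n m d A rk mu_digit).
Local Notation skipped := (skipped d A rk).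
Local Notation dijkstra := (dijkstra n m d A rk mu_digit mu_value).

Lemma mu_row_value s w : rows_ok s -> w < n -> A 3 (w * (h + 1)) = 0 ->
  rowval s (n.+1 + w) = mu_value w.
Proof.
move=> R wn z; rewrite /mu_value z eqxx /row_value /tail_value; congr value.
by apply/eq_in_map => j; rewrite mem_iota subn0 => jh; apply: (ro_mu R).
Qed.

Lemma mu_value_le w : w < n -> mu_value w <= n ^ h.
Proof.
move=> wn; rewrite /mu_value; case: eqP => // _; apply: ltnW.
by rewrite -[in leqRHS](subn0 h); apply: tail_value_lt => // i /andP[_]; apply: mu_digit_lt.
Qed.

(** No node is settled yet and [X] is 0, so the row [n] of zeros supplies the bits of [X]. *)
Record based (i : nat) (s : state) : Prop := Based {
  ba_rows : rows_ok s;
  ba_queue : queue_ok s 0;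
  ba_lvl : forall v, v < n -> arr s 13 v <= L.+1;
  ba_mu : forall v, v < n -> mu_value v <= xval s v;
  ba_skip : forall e, e < i -> e < m -> allowed A e -> skipped (A 4 e) (A 5 e) ->
    xval s (A 4 e) <= lift (A 4 e) (mu_value (A 5 e));
  ba_att : forall v, v < n -> arr s 13 v != 0 ->
    exists2 w, w \in outs v /\ skipped v w & xval s v = lift v (mu_value w) }.

Lemma based_eq i s s' : prepared n m d A s' -> (forall j, arr s' 12 j = arr s 12 j) ->
  (forall u, arr s' 13 u = arr s 13 u) -> (forall u, arr s' 14 u = arr s 14 u) ->
  (forall u, arr s' 15 u = arr s 15 u) -> based i s -> based i s'.
Proof.
move=> P e12 e13 e14 e15 [h1 h2 h3 h4 h5 h6].
have xe u : xval s' u = xval s u by apply: node_value_eq.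
split.
- exact: rows_ok_eq h1.
- exact: queue_eq h2.
- by move=> v vn; rewrite e13 h3.
- by move=> v vn; rewrite xe h4.
- by move=> e ei em al sk; rewrite xe h5.
- by move=> v vn; rewrite e13 xe; apply: h6.
Qed.

Lemma based_dijkstra s : based m s -> dijkstra (fun _ _ => false) s.
Proof.
move=> [h1 h2 h3 h4 h5 h6]; split=> //.
- move=> v w vw sk; have [e [em al ev ew]] := mem_adj_upto _ _ _ _ _ _ vw.
  by rewrite -ev -ew; apply: h5 => //; rewrite ev ew.
- move=> v w vw _ lw; have [_ wn] := outs_lt tails heads vw.
  by have := h3 w wn; rewrite lw ltnn.
- by move=> v vn lv; left; apply: h6.
Qed.

Lemma based0 s : rows_ok s -> (forall v, arr s 13 v = 0) -> (forall l, arr s 15 l = 0) ->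
  based 0 s.
Proof.
move=> R z13 z15; split=> //.
- split=> //.
  + by rewrite expn_gt0.
  + split.
    * by move=> v vn; rewrite z13.
    * by move=> l lL; rewrite /lst z15.
    * by move=> l v lL; rewrite /lst z15.
    * by move=> v vn _; rewrite z13.
  + by move=> v vn; rewrite z13.
  + by move=> v vn; rewrite z13.
- by move=> v vn; rewrite z13.
- by move=> v vn; rewrite /node_value z13 mu_value_le.
- by move=> v vn; rewrite z13.
Qed.

Lemma base_ok s : bounded N s -> based 0 s ->
  wp W N base_prog s (fun t s' => based m s' /\
    t + credit s' <= credit s + (400 * (h + 1) + 150) * m + 10).
Proof.
move=> bs D0.
apply: wp_seq; apply: (wp_assign WN) => //=; set s1 := set_reg _ _ _.
have D1 : based 0 s1 by apply: (@based_eq _ s) => //; apply: prepared_set_reg (ro_prep (ba_rows D0)).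
pose I k s' := exists i, [/\ based i s', reg s' 40 = i, i <= m &
  k = credit s' + (400 * (h + 1) + 150) * (m - i)].
have cr1 : credit s1 = credit s by [].
apply: (wp_while WN (I := I) (k0 := credit s + (400 * (h + 1) + 150) * m)) => //=.
- by exists 0; rewrite subn0.
- move=> k s2 bs2 [i [D2 r40 im ->]]; have P2 := ro_prep (ba_rows D2).
  have [[k0 k1 k2 kA] _ _ _ _ _ _] := P2.
  rewrite r40 k1; case: ltnP => // {}im _.
  have un := tails im; have wn := heads im.
  set u := A 4 i in un; set w := A 5 i in wn.
  apply: wp_seq; apply: (wp_assign WN) => //=; first exact: bs2.2.
  apply: wp_seq; apply: (wp_assign WN) => //=; first exact: bs2.2.
  rewrite r40 !kA // -/u -/w.
  apply: wp_seq; apply: (wp_assign WN) => //=; first by move: un HN; clear; lia.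
  apply: wp_seq; apply: (wp_assign WN) => //=; first by move: wn HN; clear; lia.
  set s3 := set_reg _ _ _.
  have P3 : prepared n m d A s3 by do ?apply: prepared_set_reg.
  have D3 : based i s3 by apply: based_eq D2.
  have cr3 : credit s3 = credit s2 by [].
  have q40 : reg s3 40 = i by [].
  apply: wp_bounded => bs3; apply: wp_seq.
  apply: (@wp_mono _ _ _ _ (fun t s4 => [/\ based i.+1 s4, reg s4 40 = i &
    t + credit s4 <= credit s2 + 400 * (h + 1) + 100])).
    move=> t4 s4 [D4 r4 tle]; apply: (wp_assign WN) => //=.
      by rewrite r4; move: im HN; clear; lia.
    rewrite r4; set s5 := set_reg _ _ _.
    exists (credit s4 + (400 * (h + 1) + 150) * (m - i.+1)).
      exists i.+1; split=> //; last by rewrite /s5 /= addn1.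
      by apply: (@based_eq _ s4) => //; apply: prepared_set_reg (ro_prep (ba_rows D4)).
    have -> : m - i = (m - i.+1).+1 by move: im; clear; lia.
    by move: tle; rewrite (mulnS _ (m - i.+1)); clear; lia.
  have skip t : t <= 100 -> ~~ (allowed A i && skipped u w && (A 3 (w * (h + 1)) == 0)) ->
      [/\ based i.+1 s3, reg s3 40 = i & t + credit s3 <= credit s2 + 400 * (h + 1) + 100].
    move=> tle no; split=> //; last by rewrite cr3; move: tle; clear; lia.
    case: D3 => h1 h2 h3 h4 h5 h6; split=> // e.
    rewrite ltnS leq_eqVlt => /predU1P[-> _ al sk|]; last exact: h5.
    move: no; rewrite al -/u -/w sk /= => nz.
    by rewrite /mu_value (negbTE nz) lift_top // (node_value_le h1).
  have A3 x : arr s3 3 x = A 3 x by rewrite -kA.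
  apply: (wp_if WN) => //=; rewrite !kA // -/u -/w => al; last first.
    apply: wp_skip; apply: skip => //.
    by move: al; rewrite addn_eq0 !eqb0 -negb_or => /negbTE al; rewrite /allowed al.
  have {}al : allowed A i.
    by move: al; rewrite addn_eq0 !eqb0 negb_and !negbK.
  have uw : w \in outs u by apply/mem_adj_upto; exists i.
  have R3 := ba_rows D3.
  apply: (wp_if WN) => //=; rewrite (pp_h P2) kA // => nz.
    by apply: wp_skip; apply: skip => //; rewrite (negbTE nz) !andbF.
  apply: (wp_if WN) => // sk; last first.
    apply: wp_skip; apply: skip => //.
    by rewrite -(skip_exprE evd prd R3 un wn erefl erefl uw) sk andbF.
  rewrite (skip_exprE evd prd R3 un wn _ _ uw) // in sk.
  apply: wp_seq; apply: (wp_assign WN) => //=; first by rewrite k0; move: wn HN; clear; lia.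
  apply: wp_seq; apply: (wp_assign WN) => //=; first by rewrite k0; move: HN; clear; lia.
  rewrite k0 addn1; set s4 := set_reg _ _ _.
  have P4 : prepared n m d A s4 by do ?apply: prepared_set_reg.
  have D4 : based i s4 by apply: based_eq D3.
  have [R4 Q4 lv4 mu4 sk4 att4] := D4.
  have rle : forall i x, i < h -> x < n -> rk i x <= n by move=> j x; apply: (rk_le rk_ok).
  have kn : key s4 n = 0 by apply: key_zero R4.
  have mw : rowval s4 (n.+1 + w) = mu_value w by apply: mu_row_value (eqP nz).
  apply: wp_bounded => bs4; apply: wp_frame.
  apply: wp_mono (@offer_ok W N WN n m d A n_gt0 HN evd prd rk mu_digit rle s4 u (n.+1 + w) n 0
    bs4 R4 Q4 un _ _ _ _ _ _ _) => //=.
  + rewrite mw => t s5 [R5 Q5 [oc o13 xv] cs [sz tle]] fr.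
    have xo z : z != u -> xval s5 z = xval s4 z.
      by move=> zu; apply: (other_node_value n evd oc) => //; apply: o13.
    have xle z : xval s5 z <= xval s4 z.
      by case: (eqVneq z u) => [->|zu]; [rewrite xv geq_minl | rewrite xo].
    have lvu : arr s4 13 u <= arr s5 13 u <= L.+1.
      by move: cs; case: ifP => [_ []//|_ [-> _]]; rewrite leqnn lv4.
    split.
    * split=> //.
      - move=> z zn; case: (eqVneq z u) => [->|zu]; last by rewrite o13 ?lv4.
        by case/andP: lvu.
      - move=> z zn; case: (eqVneq z u) => [->|zu]; last by rewrite xo ?mu4.
        by rewrite xv leq_min mu4 // mu_arc.
      - move=> e; rewrite ltnS leq_eqVlt => /predU1P[-> _ _ _|ei em ale ske].
          by rewrite -/u -/w xv geq_minr.
        by apply: leq_trans (xle _) (sk4 e ei em ale ske).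
      - move=> z zn; case: (eqVneq z u) => [->|zu]; last by rewrite o13 // xo //; apply: att4.
        move: cs; rewrite xv; case: ifP => [lt _ _|/negbT]; first by exists w; rewrite ?(minn_idPr (ltnW lt)).
        by rewrite -leqNgt => ge [-> _] lz; rewrite (minn_idPl ge); apply: att4.
    * by rewrite fr.1.
    * have E : credit s5 + 200 * (arr s5 13 u - arr s4 13 u) <= credit s4.
        apply: potential_raise => //.
        by case/andP: lvu => -> le /=; apply: leqW.
      have : credit s4 = credit s2 by [].
      rewrite -[arr s2 13 u]/(arr s4 13 u) in tle.
      by move: tle E; rewrite /skip_expr /=; clear; lia.
  + by move=> j jh; have := ro_mu R4 wn jh; rewrite /row_digit /= => ->; apply: mu_digit_lt.
  + exact: (small_zero R4).
  + by move=> l lL; rewrite kn.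
  + by move=> _; split=> //; [rewrite ltn_eqF | apply: lv4].
- move=> t k s2 [i [D2 r40 im ->]]; have P2 := ro_prep (ba_rows D2).
  have [[k0 k1 k2 kA] _ _ _ _ _ _] := P2.
  rewrite r40 k1; case: ltnP => // mi _; have E : i = m by apply/eqP; rewrite eqn_leq im.
  rewrite E subnn muln0 addn0 => tle; split; first by rewrite -E.
  by move: tle; clear; lia.
Qed.

Lemma output_ok s : bounded N s -> reg s 0 = n -> reg s 2 = d -> reg s 3 = h ->
  (forall x, arr s 6 x = 0) ->
  wp W N output_prog s (fun t s' => [/\
    forall v, v < n -> arr s' 6 (v * (h + 1)) = (arr s 13 v == 0),
    forall v j, v < n -> j < h ->
      arr s' 6 (v * (h + 1) + (j + 1)) = if arr s 13 v == 0 then 0 else row_digit d s v j &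
    t <= 60 * (n * (h + 1)) + 10]).
Proof.
move=> bs k0 k2 k3 z6.
apply: wp_seq; apply: (wp_assign WN) => //=.
pose base s' := [/\ reg s' 0 = n, reg s' 2 = d, reg s' 3 = h, arr s' 12 = arr s 12 &
  arr s' 13 = arr s 13].
pose out k v j := if v < k then (if j == 0 then (arr s 13 v == 0) : nat
   else if arr s 13 v == 0 then 0 else row_digit d s v j.-1) else 0.
have cell v j v' j' : j <= h -> j' <= h -> (v * (h + 1) + j == v' * (h + 1) + j') = (v == v') && (j == j').
  move=> jh jh'; apply/eqP/andP => [E|[/eqP-> /eqP->] //].
  by have [||-> ->] := cell_inj _ _ E; rewrite ?addn1.
pose J i s' := [/\ base s', reg s' 40 = i &
  forall v j, j <= h -> arr s' 6 (v * (h + 1) + j) = out i v j].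
apply: (wp_for WN (J := J) (c := fun=> 40 * h + 40) (hi := n)) => //.
- by split=> // v j jh /=; rewrite z6.
- by move=> i s1 [[q0 _ _ _ _] r40 _].
- move=> i s1 bs1 lin [[q0 q2 q3 q12 q13] r40 o1].
  apply: wp_seq; apply: (@wp_mono _ _ _ _ (fun t s2 => [/\ base s2, reg s2 40 = i,
     forall v j, j <= h -> arr s2 6 (v * (h + 1) + j) = out i.+1 v j & t <= 40 * h + 30])).
    move=> t s2 [b2 r2 o2 tle]; apply: (wp_assign WN) => //=; first by rewrite r2; move: lin HN; clear; lia.
    rewrite r2 addn1; split; last by move: tle; clear; lia.
    by split.
  apply: (wp_if WN) => //=; rewrite r40 q13 => lv.
    apply: wp_seq; apply: (wp_assign WN) => //=.
    pose J2 k s' := [/\ base s', reg s' 40 = i /\ reg s' 41 = k &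
      forall v j, j <= h -> arr s' 6 (v * (h + 1) + j) =
        if (v == i) && (j <= k) then out i.+1 v j else out i v j].
    apply: (wp_for WN (J := J2) (c := fun=> 30) (hi := h)) => //.
    + split=> // v j jh /=; rewrite o1 // leqn0; case: eqP => // ->; case: eqP => // ->.
      by rewrite /out ltnn ltnSn eqxx (negbTE lv).
    + by move=> k s2 [[_ _ q3' _ _] [_ r41] _].
    + move=> k s2 bs2 kh [[u0 u2 u3 u12 u13] [u40 u41] o2].
      apply: wp_seq; apply: (wp_put WN) => //=; first exact: bs2.2.
      apply: (wp_assign WN) => //=; first by rewrite u41; move: kh HN; clear; lia.
      rewrite u2 u3 u40 u41 u12; split=> //; split=> //=; first by rewrite addn1.
      move=> v j jh /=; rewrite cell // ?(addn1 k) //.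
      case: (eqVneq v i) => [->|] /=; last by move=> vi; rewrite o2 // (negbTE vi).
      rewrite [j <= k.+1]leq_eqVlt; case: eqP => [->|jk] /=.
        by rewrite /out ltnSn /= (negbTE lv) /row_digit addn1.
      by rewrite o2 // eqxx ltnS.
    + move=> t s2 [b2 [u40 u41] o2] tle; split=> //.
      * move=> v j jh; rewrite o2 // jh andbT; case: eqP => // vi.
        by rewrite /out (_ : (v < i.+1) = (v < i)) //; move: vi; clear; lia.
      * by move: tle; rewrite sum_nat_const card_ord; clear; lia.
  apply: (wp_put WN) => //=; first by move: HN; clear; lia.
  rewrite r40 q3; split=> //=; last by clear; lia.
  move=> v j jh /=; rewrite -[i * (h + 1)]addn0 cell // ?addn0.
  case: (eqVneq v i) => [->|vi] /=.
    case: eqP => [->|j0]; first by rewrite /out ltnSn /= lv.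
    by rewrite o1 // /out ltnSn ltnn (negbTE (introN eqP j0)) lv.
  by rewrite o1 // /out (_ : (v < i.+1) = (v < i)) //; move: vi; clear; lia.
- move=> t s1 [_ _ o1] tle; split.
  + by move=> v vn; have := o1 v 0 isT; rewrite addn0 /out vn.
  + by move=> v j vn jh; rewrite o1 ?addn1 // /out vn.
  + by move: tle; rewrite sum_nat_const card_ord; clear; lia.
Qed.
End Final.

(** * Correctness and running time of the whole program *)

Definition solve_prog : cmd :=
  setup_prog ;; adj_prog ;; ident_prog ;; levels_prog ;; mu_prog ;; base_prog ;;
  main_prog ;; output_prog.

Section Solve.
Variables (W N : nat).
Hypothesis WN : fits W N.
Variables (n m d : nat) (A : nat -> nat -> nat).
Hypothesis (n_gt0 : 0 < n) (HN : 4 * (n + m + d) + d * n + 8 <= N).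
Hypothesis evd : ~~ odd d.
Hypothesis prd : forall v, v < n -> 0 < A 1 v <= d.
Hypothesis tails : forall e, e < m -> A 4 e < n.
Hypothesis heads : forall e, e < m -> A 5 e < n.
Local Notation h := (d./2).
Local Notation L := (d * bits n).
Local Notation outs := (out_adj A m).
Local Notation lift v x := (liftl n d (A 1 v) x).
Local Notation mu_digit := (mu_digit d A).
Local Notation mu_value := (mu_value n d A).
Hypothesis mu_digit_lt : forall w j, w < n -> j < h -> mu_digit w j < n.
Hypothesis mu_arc : forall v w, w \in outs v -> mu_value v <= lift v (mu_value w).

Record solution (rk : nat -> nat -> nat) (x : nat -> nat) : Prop := Solution {
  so_rk : forall i, i < h -> comp_ok n m A (d - 2 * i) (rk i);
  so_mu : forall v, v < n -> mu_value v <= x v;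
  so_skip : forall v w, w \in outs v -> skipped d A rk v w -> x v <= lift v (mu_value w);
  so_arc : forall v w, w \in outs v -> ~~ skipped d A rk v w -> x v <= lift v (x w);
  so_att : forall v, v < n -> x v != n ^ h ->
    (exists2 w, w \in outs v /\ skipped d A rk v w & x v = lift v (mu_value w)) \/
    (exists2 w, w \in outs v & x v = lift v (x w)) }.

Definition delivered (s : state) (x : nat -> nat) : Prop :=
  forall v, v < n -> exists ds, [/\ size ds = h, all (gtn n) ds,
    (forall j, j < h -> arr s 6 (v * (h + 1) + (j + 1)) = nth 0 ds j),
    arr s 6 (v * (h + 1)) = (x v == n ^ h) &
    if x v == n ^ h then ds = nseq h 0 else value n ds = x v].

Lemma solve_ok s : bounded N s -> keeps n m d A s ->
  (forall a x, 5 < a -> arr s a x = 0) ->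
  wp W N solve_prog s (fun t s' => exists rk x, [/\ solution rk x, delivered s' x &
    t <= 4000 * (d * (m + n * bits n))]).
Proof.
move=> bs K z.
apply: wp_seq; apply: wp_frame.
apply: wp_mono (setup_ok WN n_gt0 HN bs K) => t1 s1 [K1 [r3 r4 r5] p7 t1le] fr1.
apply: wp_bounded => bs1; apply: wp_seq; apply: wp_frame.
have z1 a x : 5 < a -> a != 7 -> arr s1 a x = 0.
  by move=> a5 a7; rewrite fr1.2 ?z //= inE.
apply: wp_mono (adj_ok WN n_gt0 HN tails heads bs1 K1 _) => [t2 s2 [K2 l2 t2le] fr2|]; last first.
  by move=> a v; rewrite !inE => /or4P[]/eqP->; rewrite z1.
have z2 a x : 11 < a -> arr s2 a x = 0.
  move=> a11; rewrite fr2.2 ?z1 //=; try by move: a11; clear; lia.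
  by rewrite !inE; move: a11; clear; lia.
apply: wp_bounded => bs2; apply: wp_seq; apply: wp_frame.
apply: wp_mono (ident_ok WN n_gt0 HN bs2 K2) => t3 s3 [K3 i3 t3le] fr3.
have P3 : prepared n m d A s3.
  split=> //.
  - by rewrite fr3.1 // fr2.1.
  - by rewrite fr3.1 // fr2.1.
  - by rewrite fr3.1 // fr2.1.
  - by move=> b bb; rewrite fr3.2 // fr2.2 // p7.
  - move=> v vn; have [c1 c2] := l2 v vn.
    by split; rewrite fr3.2 //; [move: c1 | move: c2]; apply: chain_ext => // j; rewrite fr3.2.
have z3 a x : 11 < a -> a != 21 -> arr s3 a x = 0.
  by move=> a11 a21; rewrite fr3.2 ?z2 //= !inE.
apply: wp_bounded => bs3; apply: wp_seq; apply: wp_frame.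
apply: wp_mono (levels_ok WN n_gt0 HN evd tails heads bs3 P3 _) => [t4 s4 [P4 C4 same4 t4le] fr4|];
  last by move=> a j; rewrite !inE => /orP[]/eqP->; rewrite z3.
pose rk i v := arr s4 12 (v * d + 2 * i).
have rk_ok i : i < h -> comp_ok n m A (d - 2 * i) (rk i) by move=> ih; apply: (cu_ok C4).
have odj j : j < h -> 2 * j + 1 < d by move: evd; clear; lia.
have zc a b : b < d -> odd b || (n <= a) -> arr s4 12 (a * d + b) = 0.
  move=> bd ob; apply: (cu_zero C4) => // x i xn ih; apply/eqP => /cell_inj[//||E1 E2].
    by have := odj i ih; clear; lia.
  by move: ob; rewrite E1 E2; move: xn; clear; lia.
apply: wp_bounded => bs4; apply: wp_seq; apply: wp_frame.
apply: wp_mono (mu_ok WN HN evd bs4 P4) => t5 s5 [P5 mu5 same5 t5le] fr5.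
have c5 v j : v <= n -> j < d -> arr s5 12 (v * d + j) = arr s4 12 (v * d + j).
  move=> vn jd; apply: same5 => w k wn kh; apply/eqP => /cell_inj[//||E1 E2]; first exact: odj.
  by move: vn; rewrite E1; clear; lia.
have R5 : rows_ok n m d A rk mu_digit s5.
  split=> //.
  - by move=> v i vn ih; rewrite c5 ?(ltnW vn) //; have := odj i ih; clear; lia.
  - by move=> j jd; rewrite c5 // zc // leqnn orbT.
  - move=> v j vn jh; rewrite /row_digit c5 ?(ltnW vn) ?odj // zc ?odj // oddD oddM.
    by [].
have z5 a x : a \in [:: 6; 13; 15] -> arr s5 a x = 0.
  move=> a6; rewrite fr5.2; last by move: a6; rewrite !inE => /or3P[]/eqP->.
  rewrite fr4.2; last by move: a6; rewrite !inE => /or3P[]/eqP->.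
  rewrite fr3.2; last by move: a6; rewrite !inE => /or3P[]/eqP->.
  rewrite fr2.2; last by move: a6; rewrite !inE => /or3P[]/eqP->.
  by rewrite z1 //; move: a6; rewrite !inE => /or3P[]/eqP->.
have D5 : based n m d A rk 0 s5.
  by apply: based0 => // x; rewrite z5.
apply: wp_bounded => bs5; apply: wp_seq; apply: wp_frame.
apply: wp_mono (base_ok WN n_gt0 HN evd prd tails heads mu_digit_lt rk_ok mu_arc bs5 D5).
move=> t6 s6 [D6 t6le] fr6.
apply: wp_bounded => bs6; apply: wp_seq; apply: wp_frame.
apply: wp_mono (main_ok WN n_gt0 HN evd prd tails heads rk_ok mu_arc bs6
  (based_dijkstra tails heads D6) (ba_queue D6)) => t7 s7 [D7 all7 t7le] fr7.
have P7 := ro_prep (dj_rows D7); have [[k0 k1 k2 kA] _ _ _ _ _ _] := P7.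
apply: wp_bounded => bs7.
apply: wp_mono (output_ok WN HN bs7 k0 k2 (pp_h P7) _) => [t8 s8 [o1 o2 t8le]|]; last first.
  by move=> x; rewrite fr7.2 // fr6.2 // z5.
have [R7 mu7 sk7 arc7 att7] := D7.
have xE v : v < n -> (node_value n d s7 v == n ^ h) = (arr s7 13 v == 0).
  move=> vn; rewrite /node_value; case: (arr s7 13 v == 0); first exact: eqxx.
  by rewrite ltn_eqF // (row_value_lt R7).
exists rk, (node_value n d s7); split.
- split=> //.
  + move=> v w vw sk; have [vn wn] := outs_lt tails heads vw.
    (* A head that was never reached has label top, which the lift preserves, so its incoming arcs
       satisfy their inequality without being relaxed. *)
    case: (all7 w wn) => lw; last exact: arc7.
    by rewrite [in leqRHS]/node_value lw eqxx lift_top (node_value_le R7).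
  + move=> v vn; rewrite xE // => /(att7 v vn)[|[w [h1 _] [_ h2]]]; first by left.
    by right; exists w.
- move=> v vn; rewrite xE //.
  exists [seq if arr s7 13 v == 0 then 0 else row_digit d s7 v j | j <- iota 0 (h - 0)].
  split.
  + by rewrite size_map size_iota subn0.
  + apply/allP => x /mapP[j]; rewrite mem_iota subn0 => jh ->; case: ifP => //= _.
    exact: (ro_dig R7).
  + by move=> j jh; rewrite o2 // (nth_map 0) ?size_iota ?subn0 // nth_iota.
  + by rewrite o1.
  + case: ifP => lv; last by rewrite /node_value lv.
    rewrite subn0; apply: (@eq_from_nth _ 0); rewrite size_map size_iota ?size_nseq // => j jh.
    by rewrite (nth_map 0) ?size_iota // lv nth_nseq jh.
have un0 : unlevelled n d s5 = n * (L + 2).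
  rewrite /unlevelled (eq_bigr (fun _ => L + 2)); first by rewrite sum_nat_const card_ord.
  by move=> v _; rewrite z5 // subn0 addn2.
have sz0 : sizes n d s5 = 0 by apply: big1 => l _; rewrite z5.
have us6 : unsettled n m d A s6 <= n + m.
  apply: leq_trans (_ : \sum_(v < n) (1 + size (in_adj A m v)) <= _).
    by apply: leq_sum => v _; case: ifP.
  rewrite big_split /= sum_nat_const card_ord muln1 leq_add2l; exact: sum_adj_upto.
(* [d] is even and positive, hence at least 2. *)
have d2 : h + 1 <= d by have := prd n_gt0; move: evd; clear; lia.
have d1 : 0 < d by have := prd n_gt0; clear; lia.
have b1 : 0 < bits n by [].
rewrite /potential un0 sz0 in t6le; move: t1le t2le t3le t4le t5le t6le t7le t8le us6.
rewrite /potential; set b := d * (n * bits n); set a := d * m.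
have e1 : n * L = b by rewrite /b mulnCA.
have e2 : (h + 1) * m <= a by rewrite leq_mul2r d2 orbT.
have e3 : d * n <= b by rewrite leq_mul2l leq_pmulr ?orbT.
have e4 : n * (h + 1) <= d * n by rewrite mulnC leq_mul2r d2 orbT.
have e5 : n <= d * n by rewrite leq_pmull.
have e6 : m <= a by rewrite leq_pmull.
have e7 : L <= b by rewrite leq_mul2l leq_pmull ?orbT.
have e8 : bits n <= L by rewrite leq_pmull.
move: (unsettled n m d A s6) (unlevelled n d s6) (sizes n d s6) => us ul sz.
move=> t1le t2le t3le t4le t5le t6le t7le t8le us6.
have e9 : (h + 1) * us <= b + a.
  apply: leq_trans (_ : (h + 1) * (n + m) <= _); first by rewrite leq_mul2l us6 orbT.
  by rewrite mulnDr leq_add // mulnC (leq_trans e4).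
have e10 : d * (n + m) = d * n + a by rewrite mulnDr.
have e11 : n * (L + 2) = b + 2 * n by rewrite mulnDr e1 (mulnC n 2).
have e12 : (400 * (h + 1) + 150) * m = 400 * ((h + 1) * m) + 150 * m by rewrite mulnDl mulnA.
have e13 : 600 * (h + 1) * us = 600 * ((h + 1) * us) by rewrite mulnA.
move: t4le t6le t7le; rewrite e10 e11 e12 e13 (mulnDr d m) -/a -/b.
move: t1le t2le t3le t5le t8le e2 e3 e4 e5 e6 e7 e8 e9 b1 d1 n_gt0; clear.
move: ((h + 1) * m) ((h + 1) * us) (n * (h + 1)) (bits n) L (d * n) a b => x1 x2 x3 x4 x5 x6 x7 x8.
lia.
Qed.
End Solve.

(** * From numbers to nodes *)

Lemma nth_flatten_blocks (T : Type) (x0 : T) k (ss : seq (seq T)) i j :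
  (forall s, s \in map size ss -> s = k) -> i < size ss -> j < k ->
  nth x0 (flatten ss) (i * k + j) = nth x0 (nth [::] ss i) j.
Proof.
elim: ss i => [|s ss IH] [|i] //= sz lt jk.
  by rewrite nth_cat (sz (size s)) ?mem_head // jk.
have szs : size s = k by apply: sz; rewrite mem_head.
rewrite nth_cat szs mulSn -addnA ltnNge leq_addr /= addKn IH // => s' s's.
by apply: sz; rewrite inE s's orbT.
Qed.

Lemma nth_bounded (s : seq nat) N i : all (leq^~ N) s -> nth 0 s i <= N.
Proof.
move=> al; case: (ltnP i (size s)) => lt; last by rewrite nth_default.
exact: (allP al _ (mem_nth _ lt)).
Qed.

Section Instance.
Variables (V : finType) (d : nat) (G : parity_game V d) (tau : V -> V).
Variables (mu : labeling V d) (arcs : seq (V * V)).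
Local Notation n := #|V|.
Local Notation m := (num_arcs G).
Local Notation h := (d./2).
Hypothesis n_gt0 : 0 < n.
Hypothesis odds : odd_strategy G tau.
Hypothesis no_loose : forall v w : V, arc_tau G tau v w -> ~ loose G mu v w.
Hypothesis arcsP : arc_list G arcs.

Let s0 := input_state G tau mu arcs.
Let A := arr s0.
Let v0 : V := enum_val (Ordinal n_gt0).
Let node (i : nat) : V := nth v0 (enum V) i.
Local Notation code := (@node_code V).

Lemma size_enum : size (enum V) = n. Proof. by rewrite cardE. Qed.

Lemma code_lt v : code v < n. Proof. exact: ltn_ord. Qed.

Lemma codeK v : node (code v) = v.
Proof. by rewrite /node /node_code -enum_val_nth enum_rankK. Qed.

Lemma nodeK i : i < n -> code (node i) = i.
Proof.
move=> lt; rewrite /node; have -> : i = Ordinal lt :> nat by [].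
by rewrite -enum_val_nth /node_code enum_valK.
Qed.

Lemma num_arcsE : m = size arcs.
Proof.
have [u aP] := arcsP; rewrite /num_arcs -(card_uniqP u); apply: eq_card => -[v w].
by rewrite inE aP.
Qed.

(** Absorbs the additive [n] by which [n * bits n] exceeds [n * trunc_log 2 n]. *)
Lemma nodes_le_arcs : n <= m.
Proof.
have /fin_all_exists[f fP] : forall v, exists w, Defs.arc G v w by exact: arc_out.
have inj : injective (fun v => (v, f v)) by move=> u v [].
rewrite -(card_imset _ inj); apply: subset_leq_card.
by apply/subsetP => e /imsetP[v _ ->]; rewrite inE.
Qed.

Lemma input_owner i : i < n -> A 0 i = (node i \in odd_nodes G).
Proof. by move=> lt; rewrite /A /= (nth_map v0) ?size_enum. Qed.

Lemma input_prio i : i < n -> A 1 i = prio G (node i).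
Proof. by move=> lt; rewrite /A /= (nth_map v0) ?size_enum. Qed.

Lemma input_tau i : i < n -> A 2 i = if node i \in odd_nodes G then code (tau (node i)) else 0.
Proof. by move=> lt; rewrite /A /= (nth_map v0) ?size_enum. Qed.

Lemma size_label_code (x : label n d) : size (label_code x) = h.+1.
Proof. by case: x => [xi|] /=; rewrite ?size_map ?size_tuple ?size_nseq. Qed.

Lemma input_label i j : i < n -> j <= h -> A 3 (i * (h + 1) + j) = nth 0 (label_code (mu (node i))) j.
Proof.
move=> lt jh; rewrite /A /= /labeling_code nth_flatten_blocks ?size_map ?size_enum ?addn1 //.
  by rewrite (nth_map v0) ?size_enum.
by move=> s; rewrite -map_comp => /mapP[v _ ->] /=; apply: size_label_code.
by rewrite -enumT size_enum.
Qed.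

Lemma input_arc e : e < m -> A 4 e = code (nth (v0, v0) arcs e).1 /\
  A 5 e = code (nth (v0, v0) arcs e).2.
Proof. by rewrite num_arcsE => lt; rewrite /A /= !(nth_map (v0, v0)). Qed.

Lemma outsP v w : code w \in out_adj A m (code v) = arc_tau G tau v w.
Proof.
have [u aP] := arcsP.
have alE e : e < m -> let a := nth (v0, v0) arcs e in
    allowed A e = (a.1 \in odd_nodes G) ==> (a.2 == tau a.1).
  move=> em; have [E4 E5] := input_arc em; rewrite /allowed E4 E5 input_owner ?input_tau ?code_lt // codeK.
  case: (_ \in odd_nodes G) => //=; rewrite eq_sym.
  by rewrite /node_code; apply/eqP/eqP => [/val_inj/enum_rank_inj|->].
apply/mem_adj_upto/andP => [[e [em al E1 E2]]|[vw tw]].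
  have [E4 E5] := input_arc em; rewrite alE // in al.
  have := mem_nth (v0, v0) (_ : e < size arcs); rewrite -num_arcsE => /(_ em).
  move: E4 E5 al; rewrite E1 E2 => /val_inj/enum_rank_inj + /val_inj/enum_rank_inj +.
  by case: (nth _ _ _) => a b /= -> -> al; rewrite aP.
have ia : (v, w) \in arcs by rewrite aP.
have em : index (v, w) arcs < m by rewrite num_arcsE index_mem.
have [E4 E5] := input_arc em; exists (index (v, w) arcs).
by rewrite E4 E5 alE // nth_index.
Qed.

Lemma input_mu_value w : w < n -> mu_value n d A w = num (mu (node w)).
Proof.
move=> lt; rewrite /mu_value -[w * _]addn0 input_label //.
case E : (mu (node w)) => [xi|] //=; rewrite /tail_value /=; congr value.
apply: (@eq_from_nth _ 0); rewrite !size_map size_iota ?subn0 ?size_tuple // => j jh.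
by rewrite (nth_map 0) ?size_iota // nth_iota // /mu_digit input_label ?addn1 // E /=.
Qed.

Lemma input_mu_digit w j : w < n -> j < h -> mu_digit d A w j < n.
Proof.
move=> lt jh; rewrite /mu_digit input_label ?addn1 //.
case: (mu (node w)) => [xi|] /=; last by rewrite nth_nseq jh.
by apply: (allP (all_val (val xi))); rewrite mem_nth // size_map size_tuple.
Qed.

Lemma input_bounded N : 0 < N -> n <= N -> m <= N -> d <= N -> bounded N s0.
Proof.
move=> N0 nN mN dN; split=> [x|a i].
  by rewrite /s0 /=; do 3 case: x => [|x] //=; rewrite nth_nil.
have cN v : code v <= N by apply: leq_trans nN; apply: ltnW; apply: code_lt.
rewrite /s0 /=; apply: nth_bounded.
do 6?[case: a => [|a] /=]; last by rewrite nth_nil.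
- by apply/allP => x /mapP[v _ ->]; apply: leq_trans N0; case: (_ \in _).
- apply/allP => x /mapP[v _ ->]; apply: leq_trans dN.
  by have /andP[] := prio_range G v.
- by apply/allP => x /mapP[v _ ->]; case: ifP.
- apply/allP => x /flattenP[ds /mapP[v _ ->]]; case: (mu v) => [xi|] /=.
    rewrite inE => /predU1P[->//|/mapP[i' _ ->]].
    by apply: leq_trans nN; apply: ltnW.
  by rewrite inE mem_nseq => /predU1P[->//|/andP[_ /eqP->]].
- by apply/allP => x /mapP[v _ ->].
- by apply/allP => x /mapP[v _ ->].
Qed.

Lemma low_reach (q : nat) v w :
  reach (hedge (level_set n q (A 1)) (out_adj A m)) (code v) (code w) ->
  connect (low_arc (arc_tau G tau) (prio G) q) v w.
Proof.
case=> p; elim: p v => [|y p IH] v /=.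
  by move=> _ /val_inj/enum_rank_inj->; apply: connect0.
case/andP=> /and3P[/andP[_ pv] /andP[yn py] vy] yp yw.
rewrite -(nodeK yn) in yp yw vy py.
apply: connect_trans (IH _ yp yw); apply: connect1.
rewrite /low_arc -outsP vy /=.
by move: pv py; rewrite !input_prio ?code_lt // !codeK => -> ->.
Qed.

Lemma rank_connect (q : nat) c v w : comp_ok n m A q c ->
  connect (low_arc (arc_tau G tau) (prio G) q) v w -> c (code w) <= c (code v).
Proof.
move=> ok /connectP[p vp ->]; elim: p v vp => [|y p IH] v //= /andP[/and3P[vy pv py] yp].
apply: leq_trans (IH _ yp) _; apply: (co_mono ok).
by rewrite /hedge /level_set !code_lt !input_prio ?code_lt // !codeK pv py outsP.
Qed.

Lemma solution_least rk x (nu : labeling V d) : solution n m d A rk x ->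
  (forall v, num (nu v) = x (code v)) -> is_least_feasible G tau mu nu.
Proof.
move=> [rk_ok xmu xskip xarc xatt] nuE.
pose sk v w := arc_tau G tau v w && skipped d A rk (code v) (code w).
have pr v : A 1 (code v) = prio G v by rewrite input_prio ?code_lt // codeK.
have mv v : mu_value n d A (code v) = num (mu v) by rewrite input_mu_value ?code_lt // codeK.
have idx v : ~~ odd (prio G v) -> (d - prio G v)./2 < h /\ d - 2 * (d - prio G v)./2 = prio G v.
  by have := d_even G; have := prio_range G v; clear; lia.
apply: (@least_feasible_num V d G tau mu nu sk) => //.
- by move=> v; rewrite nuE -mv xmu ?code_lt.
- move=> v w /andP[vw]; rewrite /skipped !pr => /and3P[ev le /eqP eq_rk].
  have [ih E] := idx v ev; split=> //; apply: low_reach.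
  have := co_scc (rk_ok _ ih); rewrite E; apply => //.
  + by rewrite /level_set code_lt pr.
  + by rewrite /level_set code_lt pr /=.
- move=> v w vw ev le wv; rewrite /sk vw /skipped !pr ev le /=.
  have [ih E] := idx v ev; have ok := rk_ok _ ih; rewrite E in ok.
  rewrite eqn_leq (rank_connect ok wv) (rank_connect ok (connect1 _)) //.
  by rewrite /low_arc vw le leqnn.
- move=> v w vw nsk; rewrite !nuE -pr; apply: xarc; rewrite ?outsP //.
  by move: nsk; rewrite /sk vw.
- by move=> v w /andP[vw s]; rewrite nuE -pr -mv; apply: xskip; rewrite ?outsP.
- move=> v nv; have ne : x (code v) != n ^ h.
    rewrite -nuE; case E : (nu v) => [xi|] //; first by rewrite ltn_eqF // (num_Some_lt xi).
  have ol w' : w' \in out_adj A m (code v) -> w' = code (node w').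
    case/mem_adj_upto => e [em _ _ <-]; have [_ ->] := input_arc em.
    by rewrite nodeK ?code_lt.
  case: (xatt _ (code_lt v) ne) => [[w' [vw s] E]|[w' vw E]].
    left; exists (node w'); last by rewrite nuE -pr -mv -ol.
    by rewrite /sk -outsP -ol // vw.
  by right; exists (node w'); rewrite -?outsP -?ol // !nuE -pr -ol.
Qed.

Lemma delivered_outputs s x : delivered n d s x ->
  exists2 nu : labeling V d, outputs s nu & forall v, num (nu v) = x (code v).
Proof.
move=> del.
have /fin_all_exists[nu nuP] : forall v : V, exists y : label n d, num y = x (code v) /\
    forall j, j < h + 1 -> arr s 6 (code v * (h + 1) + j) = nth 0 (label_code y) j.
  move=> v; have [ds [sz al o1 o2]] := del _ (code_lt v).
  case: ifP => [/eqP E|ne] Ed; last first.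
    have [xi Exi] := num_digits n_gt0 sz al.
    exists (Some xi); split; first by rewrite /num Exi.
    rewrite /label_code Exi => -[_|j]; first by rewrite addn0 o2 ne.
    by rewrite addn1 ltnS => jh; rewrite /= -o1 // !addn1.
  exists None; split=> //; rewrite /label_code -Ed => -[_|j]; first by rewrite addn0 o2 E eqxx.
  by rewrite addn1 ltnS => jh; rewrite /= -o1 // !addn1.
exists nu => [i|v]; last by have [] := nuP v.
have szs t : t \in map size [seq label_code (nu v) | v <- enum V] -> t = h + 1.
  by rewrite -map_comp => /mapP[v _ ->] /=; rewrite addn1; apply: size_label_code.
have h1 : 0 < h + 1 by rewrite addn1.
have szf : size (labeling_code nu) = n * (h + 1).
  rewrite size_flatten /shape -map_comp (eq_map (g := fun _ => h + 1)) => [|v /=].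
    by rewrite sumnE big_map big_enum sum_nat_const.
  by rewrite addn1; exact: size_label_code.
rewrite szf => lt; have ih : i %/ (h + 1) < n by rewrite ltn_divLR.
rewrite (divn_eq i (h + 1)) nth_flatten_blocks ?size_map ?size_enum ?ltn_pmod //; last by rewrite -enumT size_enum.
rewrite (nth_map v0) ?size_enum // -/(node _).
by have [_ <-] := nuP (node (i %/ (h + 1))); rewrite ?ltn_pmod // nodeK.
Qed.

End Instance.

(* Words of O(log(n + m + d)) bits; the program and the constants C and k do not
   depend on the instance.  Rounding the logarithm down is harmless as m >= n. *)
Theorem theorem5p5 :
  exists (prog : cmd) (C k : nat),
  forall (V : finType) (d : nat) (G : parity_game V d)
         (tau : V -> V) (mu : labeling V d) (arcs : seq (V * V)),
  let n := #|V| in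
  let m := num_arcs G in
  0 < n ->
  odd_strategy G tau ->
  (forall v w : V, arc_tau G tau v w -> ~ loose G mu v w) ->
  arc_list G arcs ->
  exists (nu : labeling V d) (t : nat) (s : state),
  [/\ is_least_feasible G tau mu nu,
      exec ((n + m + d) ^ k) prog (input_state G tau mu arcs) t s,
      outputs s nu &
      t <= C * (d * (m + n * trunc_log 2 n))].
Proof.
(* The bound of [solve_ok] is stated with [bits n], one more than the logarithm; the surplus [n] is
   at most [m], whence the factor 2. The exponent 36 is 3 for the cube [N] times 12 from [fits]. *)
exists solve_prog, (2 * 4000), 36 => V d G tau mu arcs n m n_gt0 odds no_loose arcsP.
have nm : n <= m by apply: nodes_le_arcs.
pose v0 : V := enum_val (Ordinal n_gt0).
have d2 : 1 < d by have := d_even G; have := prio_range G v0; move: (prio G v0); clear; lia.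
(* [d * n] may be quadratic in [S = n + m + d], and [4 * S + S ^ 2 + 8 <= S ^ 3] holds from [S = 4]
   on. *)
pose N := (n + m + d) ^ 3; pose A := arr (input_state G tau mu arcs).
have S4 : 4 <= n + m + d by move: nm (n_gt0) d2; rewrite -/n; clear; lia.
have HN : 4 * (n + m + d) + d * n + 8 <= N.
  have dn : d * n <= (n + m + d) * (n + m + d) by apply: leq_mul; lia.
  by rewrite /N; move: S4 dn; move: (n + m + d) (d * n) => S p; clear; nia.
have WN : fits ((n + m + d) ^ 36) N.
  by rewrite /fits /N -expnM leqnn andbT; move: HN; rewrite -/N; clear; lia.
have prd v : v < n -> 0 < A 1 v <= d by move=> lt; rewrite /A (input_prio _ _ _ _ n_gt0) // prio_range.
have tails e : e < m -> A 4 e < n by move=> em; rewrite /A (input_arc tau mu n_gt0 arcsP em).1 code_lt.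
have heads e : e < m -> A 5 e < n by move=> em; rewrite /A (input_arc tau mu n_gt0 arcsP em).2 code_lt.
have mu_digit_lt : forall w j, w < n -> j < d./2 -> mu_digit d A w j < n by apply: input_mu_digit.
have mu_arc v w : w \in out_adj A m v -> mu_value n d A v <= liftl n d (A 1 v) (mu_value n d A w).
  move=> vw; have [vn wn] := outs_lt tails heads vw.
  rewrite /A !(input_mu_value _ _ _ _ n_gt0) // (input_prio _ _ _ _ n_gt0) //; apply: no_loose_le; apply: no_loose.
  by rewrite -(outsP tau mu n_gt0 arcsP) !nodeK.
have bs : bounded N (input_state G tau mu arcs).
  by apply: input_bounded; rewrite -/n -/m; move: HN; clear; lia.
have K : keeps n m d A (input_state G tau mu arcs) by split.
have z a x : 5 < a -> arr (input_state G tau mu arcs) a x = 0.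
  by do 6 case: a => [|a] //; move=> _ /=; rewrite nth_nil nth_nil.
have [t [s [ex _ [rk [x [sol del le]]]]]] :=
  solve_ok WN n_gt0 HN (d_even G) prd tails heads mu_digit_lt mu_arc bs K z bs.
have [nu out nuE] := delivered_outputs n_gt0 del.
exists nu, t, s; split=> //; first exact: solution_least sol nuE.
apply: leq_trans le _; rewrite /bits.
have le2 : n * (trunc_log 2 n).+1 <= n * trunc_log 2 n + m by rewrite mulnSr leq_add2l.
rewrite (mulnC 2) -mulnA leq_mul2l /= mulnCA leq_mul2l; apply/orP; right.
by move: le2; rewrite mulnS; move: (n * trunc_log 2 n); clear; lia.
Qed.
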